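(* Let $1\le d\leq n$ be integers, let $A\in \mathbb{Z}^{d\times n}$ be a matrix of full rank $d$ and let $\beta \in \mathbb{C}^d$ be such that $M_A(\beta)$ has a rank jump, i.e. $q := \operatorname{rank}(M_A(\beta))/\operatorname{vol}_{\mathbb{Z}A}(A) > 1$. For each integer $r\geq 1$ put $d_r = rd$ and $n_r = rn$, let $A_r\in \mathbb{Z}^{d_r\times n_r}$ be the direct sum of $r$ copies of $A$, and let $\beta_r = (\beta,\ldots,\beta)\in \mathbb{C}^{d_r}$ be the vector formed by $r$ copies of $\beta$. Then for every $r\ge 1$ $$\frac{\operatorname{rank}(M_{A_r}(\beta_r))}{\operatorname{vol}_{\mathbb{Z}A_r}(A_r)} \geq a^{d_r},\qquad\text{where } a = \sqrt[d]{q} > 1.$$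
   Context: Let $A=(a_{ij})=(a_1\;\cdots\;a_n)\in\mathbb{Z}^{d\times n}$ have full rank $d\le n$, with columns $a_j\in\mathbb{Z}^d$, and let $\beta\in\mathbb{C}^d$. Let $D=\mathbb{C}[x_1,\ldots,x_n]\langle\partial_1,\ldots,\partial_n\rangle$ be the Weyl algebra. The $A$-hypergeometric system $H_A(\beta)$ is the left ideal of $D$ generated by the operators $\Box_u=\prod_{i:u_i>0}\partial_i^{u_i}-\prod_{i:u_i<0}\partial_i^{-u_i}$ for all $u\in\mathbb{Z}^n$ with $Au=0$, and the operators $E_i-\beta_i=\sum_{j=1}^n a_{ij}x_j\partial_j-\beta_i$ for $i=1,\ldots,d$. Set $M_A(\beta)=D/H_A(\beta)$; it is a holonomic $D$-module. Its holonomic rank $\operatorname{rank}(M_A(\beta))$ is the (finite) dimension over $\mathbb{C}$ of its space of holomorphic solutions at a nonsingular point. The normalized volume of $A$ is $\operatorname{vol}_{\mathbb{Z}A}(A)=d!\,\dfrac{\operatorname{vol}_{\mathbb{R}^d}(\Delta_A)}{[\mathbb{Z}^d:\mathbb{Z}A]}$, where $\mathbb{Z}A=\sum_{i=1}^n\mathbb{Z}a_i\subseteq\mathbb{Z}^d$, $[\mathbb{Z}^d:\mathbb{Z}A]$ is the index of this subgroup, $\Delta_A$ is the convex hull in $\mathbb{R}^d$ of the columns of $A$ and the origin, and $\operatorname{vol}_{\mathbb{R}^d}$ is Euclidean volume. The direct sum of $A_1\in\mathbb{Z}^{d_1\times n_1}$ and $A_2\in\mathbb{Z}^{d_2\times n_2}$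 is the block diagonal matrix $A_1\oplus A_2=\begin{pmatrix}A_1&0\\0&A_2\end{pmatrix}\in\mathbb{Z}^{(d_1+d_2)\times(n_1+n_2)}$. *)

(* Defs.v *)
From HB Require Import structures.
From mathcomp Require Import all_boot all_order all_algebra.
From mathcomp.multinomials Require mpoly.

Set Implicit Arguments.
Unset Strict Implicit.
Unset Printing Implicit Defensive.

(* The purely algebraic part is confined to a module because the notations of
   mpoly and of MathComp-Analysis cannot be active together. *)
Module Weyl.
Import mpoly.
Import GRing.Theory.
Local Open Scope ring_scope.

Section Weyl.
Variables (K : fieldType) (n : nat).

(* An element of the Weyl algebra in normally ordered form
   \sum_alpha p_alpha(x) d^alpha is encoded by its coefficients p_alpha in
   K[x_1, ..., x_n]: the outer variables stand for d_1, ..., d_n.  Addition is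
   that of polynomials, but the product is [mul] below and NOT the
   commutative product of {mpoly {mpoly K[n]}[n]}. *)
Definition weyl : Type := {mpoly {mpoly K[n]}[n]}.

Definition mbinom (a b : 'X_{1..n}) : nat := \prod_(i < n) 'C(a i, b i).

(* Leibniz rule:
   (p d^a)(q d^b) = \sum_(g <= a) binom(a, g) p (d^g q) d^(a - g + b). *)
Definition mul (P Q : weyl) : weyl :=
  \sum_(a <- msupp P) \sum_(b <- msupp Q)
    \sum_(g : 'X_{1..n < (mdeg a).+1} | (g <= a)%MM)
      (P@_a * (Q@_b)^`M[g] *+ mbinom a g) *: 'X_[a - g + b].

Definition left_ideal (S : weyl -> Prop) (P : weyl) : Prop :=
  exists (k : nat) (Q G : 'I_k -> weyl),
    (forall i, S (G i)) /\ P = \sum_(i < k) mul (Q i) (G i).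

(* Principal symbol for the order filtration, evaluated at (x, xi). *)
Definition symbol (P : weyl) (x xi : 'I_n -> K) : K :=
  \sum_(a <- msupp P | (mdeg a).+1 == msize P)
    (P@_a).@[x] * \prod_(i < n) xi i ^+ a i.

(* The value at x of P applied to a function whose partial derivatives at x
   are D a. *)
Definition apply_at (P : weyl) (x : 'I_n -> K) (D : 'X_{1..n} -> K) : K :=
  \sum_(a <- msupp P) (P@_a).@[x] * D a.

Definition psum (c : 'X_{1..n} -> K) (y : 'I_n -> K) (N : nat) : K :=
  \sum_(a : 'X_{1..n < N}) c a * \prod_(i < n) y i ^+ a i.

Definition mindex : Type := 'X_{1..n}.

Definition iter_partials (T : Type) (D : 'I_n -> T -> T) (a : 'X_{1..n}) (f : T)
  : T := foldr (fun i => iter (a i) (D i)) f (enum 'I_n).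

End Weyl.

Section Hypergeometric.
Variables (K : fieldType) (d n : nat) (A : 'M[int]_(d, n)) (beta : 'cV[K]_d).

Definition posm (u : 'cV[int]_n) : 'X_{1..n} :=
  [multinom (if (0 <= u i 0)%R then absz (u i 0%R) else 0%N) | i < n].

Definition box (u : 'cV[int]_n) : weyl K n := 'X_[posm u] - 'X_[posm (- u)].

(* The inner 'X_j is x_j and the outer one is d_j. *)
Definition euler (i : 'I_d) : weyl K n :=
  \sum_(j < n) ((A i j)%:~R *: 'X_j) *: 'X_j - (beta i 0)%:MP%:MP.

Definition hypergeometric_ideal : weyl K n -> Prop :=
  left_ideal (fun P => (exists2 u, A *m u = 0 & P = box u)
                       \/ exists i, P = euler i).

End Hypergeometric.
End Weyl.

From mathcomp Require Import finmap complex.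
From mathcomp Require Import all_classical all_reals all_analysis.
Import Order.TTheory GRing.Theory Num.Theory.
Import numFieldNormedType.Exports.
Local Open Scope classical_set_scope.
Local Open Scope ring_scope.

(* R[i], as a numClosedFieldType so that it carries its norm topology. *)
Definition Cplx (R : realType) : numClosedFieldType := R[i].

Section HolonomicRank.
Variables (R : realType) (n : nat).
Local Notation C := (Cplx R).
Implicit Types (f : 'rV[C]_n -> C) (p : 'rV[C]_n) (I : Weyl.weyl C n -> Prop).

(* f is holomorphic at p: near p it is the sum of an absolutely convergent
   power series centred at p. *)
Definition holomorphic_at p f : Prop :=
  exists (c : Weyl.mindex n -> C) (r : C),
    [/\ 0 < r,
        exists M : C, forall N,
          Weyl.psum (fun a => `|c a|) (fun=> r) N <= M
      & \forall x \near p,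
          (fun N => Weyl.psum c ((x - p) 0) N) @ \oo --> f x].

Definition partial (i : 'I_n) f : 'rV[C]_n -> C :=
  fun x => 'D_(delta_mx 0 i) f x.

Definition act (P : Weyl.weyl C n) f : 'rV[C]_n -> C :=
  fun x => Weyl.apply_at P (x 0) (fun a => Weyl.iter_partials partial a f x).

Definition solution I p f : Prop :=
  holomorphic_at p f /\ forall P, I P -> \forall x \near p, act P f x = 0.

(* The germs at p of solutions of D/I form a space of dimension m: some m of
   them are a basis. *)
Definition solution_dim I p (m : nat) : Prop :=
  exists s : 'I_m -> 'rV[C]_n -> C,
    (forall k, solution I p (s k)) /\
    forall f, solution I p f ->
      exists! l : 'rV[C]_m,
        \forall x \near p, f x = \sum_(k < m) l 0 k * s k x.

Definition char_variety I : set ('rV[C]_n * 'rV[C]_n) :=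
  [set z : 'rV[C]_n * 'rV[C]_n | forall P, I P -> Weyl.symbol P (z.1 0) (z.2 0) = 0].

(* p is not in the singular locus of D/I, the projection to C^n of its
   characteristic variety minus the zero section. *)
Definition nonsingular I p : Prop :=
  forall xi, char_variety I (p, xi) -> xi = 0.

(* The common dimension of the solution spaces at nonsingular points; junk
   value 0 if there is no such number, which does not happen when D/I is
   holonomic. *)
Definition holonomic_rank I : nat :=
  xget 0%N [set m | (exists p, nonsingular I p)
                    /\ forall p, nonsingular I p -> solution_dim I p m].

End HolonomicRank.

(* rank (M_A(beta)) *)
Definition hyp_rank (R : realType) (d n : nat) (A : 'M[int]_(d, n))
    (beta : 'cV[Cplx R]_d) : nat :=
  holonomic_rank (Weyl.hypergeometric_ideal A beta).

Section Volume.
Variable R : realType.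
Local Open Scope ereal_scope.

(* Lebesgue measure on R^d as a d-fold product measure: like the product
   measure of the library, it integrates the measures of the sections. *)
Fixpoint volume (d : nat) : set 'cV[R]_d -> \bar R :=
  match d with
  | 0%N => fun S => (\1_S 0)%:E
  | d'.+1 => fun S =>
      \int[lebesgue_measure]_t
        volume [set y : 'cV[R]_d' | S (col_mx (t%:M : 'cV[R]_1) y)]
  end.

Definition convex_hull (d : nat) (S : set 'cV[R]_d) : set 'cV[R]_d :=
  smallest (@convex_set R 'cV[R]_d) S.

Definition Delta (d n : nat) (A : 'M[int]_(d, n)) : set 'cV[R]_d :=
  convex_hull (range (fun j => map_mx intr (col j A)) `|` [set 0%R]).

End Volume.

Definition coset_ZA (d n : nat) (A : 'M[int]_(d, n)) (z : 'cV[int]_d) :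
  set 'cV[int]_d := [set w | exists u : 'cV[int]_n, w = z + A *m u].

(* [Z^d : ZA], the number of cosets (0 if there are infinitely many). *)
Definition index_ZA (d n : nat) (A : 'M[int]_(d, n)) : nat :=
  #|` fset_set (range (coset_ZA A))|%fset.

Definition normalized_volume (R : realType) (d n : nat) (A : 'M[int]_(d, n)) :
  R := d`!%:R * (fine (volume (Delta A : set 'cV[R]_d)) / (index_ZA A)%:R).

Definition direct_sum (d1 n1 d2 n2 : nat) (A1 : 'M[int]_(d1, n1))
  (A2 : 'M[int]_(d2, n2)) : 'M[int]_(d1 + d2, n1 + n2) := block_mx A1 0 0 A2.

Fixpoint direct_sum_copies (d n : nat) (A : 'M[int]_(d, n)) (r : nat) :
    'M[int]_(r * d, r * n) :=
  match r with
  | 0%N => 0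
  | r'.+1 => direct_sum A (direct_sum_copies A r')
  end.

Fixpoint vector_copies (T : zmodType) (d : nat) (b : 'cV[T]_d) (r : nat) :
    'cV[T]_(r * d) :=
  match r with
  | 0%N => 0
  | r'.+1 => col_mx b (vector_copies b r')
  end.

(* Main.v *)
(* Rank and normalized volume are both multiplicative under direct sums, so the
   quotient for r copies is q^r = a^(rd).

   Rank.  The ideal of A (+) B is generated by the ideals I1 and I2 of the two
   summands, acting on separate variables.  If h is a solution near (p1, p2)
   with Taylor coefficients d(a, b), then for each b the sequence d(., b) is,
   up to a factor, the Taylor series of y |-> (d_2^b h)(y, p2), which is killed
   by I1; symmetrically in b.  Hence h is a finite sum of products f_k g_l of
   basis solutions.  Conversely, (p1, p2) can be nonsingular only if p1 and p2
   are: take (p1, xi1) in the characteristic variety of I1, P in the ideal of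
   the sum, and a solution f <> 0 of I2.  Letting P act on f in the second
   group of variables and freezing these at y yields an operator in I1 whose
   symbol is f(y) times that of P at ((p1, y), (xi1, 0)).  So this polynomial in
   y vanishes where f does not, hence identically.

   Volume.  If x lies on the boundary of t Delta_A, then the section of
   Delta_{A (+) B} over x is (1 - t) Delta_B.  Cutting Delta_A into N shells
   encloses the volume between Riemann sums of
   m \int_0^1 t^(m-1) (1 - t)^k dt = k! m! / (k + m)!. *)

Require Import Defs.
From HB Require Import structures.
From mathcomp Require Import all_boot all_order all_algebra ring lra.
From mathcomp.multinomials Require mpoly ssrcomplements.
From Stdlib Require List.

Set Implicit Arguments.
Unset Strict Implicit.
Unset Printing Implicit Defensive.

(** No general existence or finiteness theorem for ranks, volumes or indices is proved. In the
    definitions an ill-defined rank, an infinite volume and an infinite index all become 0, and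
    division by 0 gives 0; so q > 1 makes the data of A genuine. The induction on r starts at the
    empty sum, of rank and volume 1, and carries the full specification of the rank, since an
    equation between numbers could be one between default values. The rank must be the same at every
    nonsingular point of the sum, which is why nonsingularity has to descend to the factors; this
    uses a nonzero solution of the other factor, hence its positive rank. Germs are replaced by
    their arrays d(a, b) of Taylor coefficients, so that spanning and independence become linear
    algebra without any choice of a common domain. The volume of a section is never shown to be
    measurable in its base point. It is only compared with step functions, monotonicity of the
    integral holding for all nonnegative functions. Accordingly the Riemann sums multiply the drops
    of (1 - t)^k by volumes of nested copies of Delta_A. *)

Module WeylTensor.
Import ssrcomplements mpoly Weyl.
Import Order.TTheory GRing.Theory Num.Theory.
Local Open Scope ring_scope.

(** * Exterior products in the Weyl algebra *)

Section MultinomSums.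
Variables (V : nmodType) (n : nat).

(** Bounded multi-indices for different [n] and [k] form unrelated types; lists of plain
    multi-indices make such sums comparable. *)
Lemma big_bmultinom_seq k (P : pred 'X_{1..n}) (F : 'X_{1..n} -> V)
    (s : seq 'X_{1..n}) :
  uniq s -> (forall g, (g \in s) = (mdeg g < k)%N && P g) ->
  \sum_(g : 'X_{1..n < k} | P g) F g = \sum_(g <- s) F g.
Proof.
move=> us sE.
have -> : \sum_(g : 'X_{1..n < k} | P g) F g =
  \sum_(g <- [seq val g | g <- enum [pred g : 'X_{1..n < k} | P g]]) F g.
  by rewrite big_map big_enum.
apply: perm_big; apply: uniq_perm => //.
  by rewrite map_inj_uniq ?enum_uniq //; exact: val_inj.
move=> g; rewrite sE; apply/mapP/andP => [[h]|[gk Pg]].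
  by rewrite mem_enum inE => Ph ->; split=> //; apply: bmdeg.
by exists (BMultinom gk); rewrite // mem_enum inE.
Qed.

End MultinomSums.

(* Exchanging the two groups of variables is again a splitting ([swap] below), so
   that each statement about the first factor yields the one about the second. *)
Record splitting (n1 n2 n : nat) := Splitting {
  inj1 : 'I_n1 -> 'I_n;
  inj2 : 'I_n2 -> 'I_n;
  side : 'I_n -> 'I_n1 + 'I_n2;
  side_inj1 : forall i, side (inj1 i) = inl i;
  side_inj2 : forall j, side (inj2 j) = inr j;
  sideK : forall k, match side k with inl i => inj1 i | inr j => inj2 j end = k
}.

Definition swap n1 n2 n (sp : splitting n1 n2 n) : splitting n2 n1 n.
Proof.
refine (@Splitting n2 n1 n (inj2 sp) (inj1 sp)
  (fun k => match side sp k with inl i => inr i | inr j => inl j end) _ _ _).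
- by move=> i; rewrite side_inj2.
- by move=> i; rewrite side_inj1.
- by move=> k; move: (sideK sp k); case: (side sp k).
Defined.

Definition lrsplit n1 n2 : splitting n1 n2 (n1 + n2).
Proof.
refine (@Splitting n1 n2 _ (@lshift n1 n2) (@rshift n1 n2) (@split n1 n2) _ _ _).
- by move=> i; rewrite -[lshift _ _]/(unsplit (inl i)) unsplitK.
- by move=> i; rewrite -[rshift _ _]/(unsplit (inr i)) unsplitK.
- by move=> k; apply: splitK.
Defined.

Section Join.
Variables (n1 n2 n : nat) (sp : splitting n1 n2 n).

Definition fjoin T (f : 'I_n1 -> T) (g : 'I_n2 -> T) (k : 'I_n) : T :=
  match side sp k with inl i => f i | inr j => g j end.

Lemma fjoin1 T f g i : @fjoin T f g (inj1 sp i) = f i.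
Proof. by rewrite /fjoin side_inj1. Qed.

Lemma fjoin2 T f g j : @fjoin T f g (inj2 sp j) = g j.
Proof. by rewrite /fjoin side_inj2. Qed.

Variant side_spec : 'I_n -> Type :=
  | Side1 i : side_spec (inj1 sp i)
  | Side2 j : side_spec (inj2 sp j).

Lemma sideP k : side_spec k.
Proof. by rewrite -(sideK sp k); case: (side sp k) => x; constructor. Qed.

Lemma big_side (R : Type) (idx : R) (op : Monoid.com_law idx) (F : 'I_n -> R) :
  \big[op/idx]_k F k =
  op (\big[op/idx]_i F (inj1 sp i)) (\big[op/idx]_j F (inj2 sp j)).
Proof.
rewrite -(big_sumType _ (fun=> true)
  (fun x => F (match x with inl i => inj1 sp i | inr j => inj2 sp j end))).
rewrite (reindex (fun x : 'I_n1 + 'I_n2 =>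
  match x with inl i => inj1 sp i | inr j => inj2 sp j end)) //.
exists (side sp) => x _; last exact: sideK.
by case: x => x; rewrite ?side_inj1 ?side_inj2.
Qed.

Definition mjoin (a : 'X_{1..n1}) (b : 'X_{1..n2}) : 'X_{1..n} :=
  [multinom fjoin a b k | k < n].
Definition mproj1 (e : 'X_{1..n}) : 'X_{1..n1} := [multinom e (inj1 sp i) | i < n1].
Definition mproj2 (e : 'X_{1..n}) : 'X_{1..n2} := [multinom e (inj2 sp j) | j < n2].

Lemma mjoin1 a b i : mjoin a b (inj1 sp i) = a i.
Proof. by rewrite mnmE fjoin1. Qed.
Lemma mjoin2 a b j : mjoin a b (inj2 sp j) = b j.
Proof. by rewrite mnmE fjoin2. Qed.

Lemma mproj1K a b : mproj1 (mjoin a b) = a.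
Proof. by apply/mnmP => i; rewrite mnmE mjoin1. Qed.
Lemma mproj2K a b : mproj2 (mjoin a b) = b.
Proof. by apply/mnmP => i; rewrite mnmE mjoin2. Qed.
Lemma mjoinK e : mjoin (mproj1 e) (mproj2 e) = e.
Proof.
by apply/mnmP => k; case: (sideP k) => i; rewrite (mjoin1, mjoin2) mnmE.
Qed.

Lemma mjoin_inj a b a' b' : mjoin a b = mjoin a' b' -> a = a' /\ b = b'.
Proof.
by move=> h; split; [rewrite -(mproj1K a b) h mproj1K
  | rewrite -(mproj2K a b) h mproj2K].
Qed.

Lemma mdeg_mjoin a b : mdeg (mjoin a b) = (mdeg a + mdeg b)%N.
Proof.
rewrite !mdegE big_side.
by congr (_ + _)%N; apply: eq_bigr => i _; rewrite (mjoin1, mjoin2).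
Qed.

Lemma mjoinD a b a' b' :
  mjoin (a + a')%MM (b + b')%MM = (mjoin a b + mjoin a' b')%MM.
Proof.
by apply/mnmP => k; rewrite mnmDE; case: (sideP k) => i;
  rewrite !(mjoin1, mjoin2) mnmDE.
Qed.

Lemma mjoinB a b a' b' :
  mjoin (a - a')%MM (b - b')%MM = (mjoin a b - mjoin a' b')%MM.
Proof.
by apply/mnmP => k; rewrite mnmBE; case: (sideP k) => i;
  rewrite !(mjoin1, mjoin2) mnmBE.
Qed.

Lemma mjoin0 : mjoin 0%MM 0%MM = 0%MM.
Proof. by apply/mnmP => k; case: (sideP k) => i; rewrite !(mjoin1, mjoin2) !mnm0E. Qed.

Lemma mjoin_le a b a' b' :
  (mjoin a b <= mjoin a' b')%MM = (a <= a')%MM && (b <= b')%MM.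
Proof.
apply/mnm_lepP/andP => [h|[/mnm_lepP h /mnm_lepP h'] k].
  by split; apply/mnm_lepP => i;
    [have := h (inj1 sp i); rewrite !mjoin1 | have := h (inj2 sp i); rewrite !mjoin2].
by case: (sideP k) => i; rewrite (mjoin1, mjoin2) (mjoin1, mjoin2).
Qed.

Lemma prod_mjoin (R : comPzSemiRingType) (x : 'I_n -> R) a b :
  \prod_k x k ^+ mjoin a b k =
  (\prod_i x (inj1 sp i) ^+ a i) * (\prod_j x (inj2 sp j) ^+ b j).
Proof.
by rewrite big_side; congr (_ * _); apply: eq_bigr => i _; rewrite (mjoin1, mjoin2).
Qed.

Lemma mbinom_mjoin a b a' b' :
  mbinom (mjoin a b) (mjoin a' b') = (mbinom a a' * mbinom b b')%N.
Proof.
rewrite /mbinom big_side.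
by congr (_ * _)%N; apply: eq_bigr => i _; rewrite !(mjoin1, mjoin2).
Qed.

(** The multi-indices below [mjoin a b] are the pairs of those below [a] and below [b], and [<=]
    already implies the degree bounds. This splits the Leibniz sum of [mul] into two. *)
Lemma big_le_mjoin (V : nmodType) (a : 'X_{1..n1}) (b : 'X_{1..n2})
    (F : 'X_{1..n} -> V) :
  \sum_(g : 'X_{1..n < (mdeg (mjoin a b)).+1} | (g <= mjoin a b)%MM) F g =
  \sum_(g : 'X_{1..n1 < (mdeg a).+1} | (g <= a)%MM)
    \sum_(h : 'X_{1..n2 < (mdeg b).+1} | (h <= b)%MM) F (mjoin g h).
Proof.
pose s m (c : 'X_{1..m}) : seq 'X_{1..m} :=
  [seq val g | g <- enum [pred g : 'X_{1..m < (mdeg c).+1} | (g <= c)%MM]].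
have us m c : uniq (@s m c) by rewrite map_inj_uniq ?enum_uniq //; exact: val_inj.
have sE m c g : (g \in @s m c) = (mdeg g < (mdeg c).+1)%N && (g <= c)%MM.
  apply/mapP/andP => [[h]|[gk Pg]].
    by rewrite mem_enum inE => Ph ->; split=> //; apply: bmdeg.
  by exists (BMultinom gk); rewrite // mem_enum inE.
have lem m (g c : 'X_{1..m}) : (g <= c)%MM -> (mdeg g <= mdeg c)%N.
  by move=> /mnm_lepP h; rewrite !mdegE leq_sum.
rewrite (big_bmultinom_seq (k := (mdeg a).+1) (P := fun g => (g <= a)%MM)
   (fun g => \sum_(h : 'X_{1..n2 < (mdeg b).+1} | (h <= b)%MM) F (mjoin g h))
   (us _ a) (sE _ a)).
under [in RHS]eq_bigr => g _.
  rewrite (big_bmultinom_seq (k := (mdeg b).+1) (P := fun g => (g <= b)%MM)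
   (fun h => F (mjoin g h)) (us _ b) (sE _ b)); over.
rewrite -[RHS](big_allpairs_dep (h := mjoin) (r2 := fun=> s _ b)).
apply: (big_bmultinom_seq (P := fun g => (g <= mjoin a b)%MM)).
  apply: allpairs_uniq => //.
  by move=> [x y] [x' y'] _ _ /= /mjoin_inj [-> ->].
move=> g; apply/allpairsP/andP => [[[x y] /= [xa yb ->]]|[_ gab]].
  move: xa yb; rewrite !sE => /andP[_ xa] /andP[_ yb].
  have h : (mjoin x y <= mjoin a b)%MM by rewrite mjoin_le xa yb.
  by split=> //; rewrite ltnS lem.
exists (mproj1 g, mproj2 g); rewrite /= mjoinK !sE !ltnS.
have := gab; rewrite -[g]mjoinK mjoin_le => /andP[ga gb].
by rewrite !lem ?mproj1K ?mproj2K ?ga ?gb.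
Qed.

End Join.

Lemma mjoin_swap n1 n2 n (sp : splitting n1 n2 n) a b :
  mjoin (swap sp) b a = mjoin sp a b.
Proof.
apply/mnmP => k; rewrite !mnmE /fjoin /=; by case: (side sp k).
Qed.

Section SupportSums.
Variables (n : nat) (R : nzRingType) (V : nmodType) (F : 'X_{1..n} -> R -> V).
Hypothesis F0 : forall a, F a 0 = 0.
Hypothesis FD : forall a x y, F a (x + y) = F a x + F a y.

Lemma big_msupp_widen (P : {mpoly R[n]}) k : (msize P <= k)%N ->
  \sum_(a <- msupp P) F a P@_a = \sum_(a : 'X_{1..n < k}) F a P@_a.
Proof.
move=> le_pi; set I : subFinType _ := 'X_{1..n < k}.
rewrite (big_mksub I) ?msupp_uniq //=; first last.
  by move=> x /msize_mdeg_lt /leq_trans; apply.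
by rewrite big_rmcond //= => j /memN_msupp_eq0 ->.
Qed.

(** Supports are not additive, since terms may cancel. As [F a 0 = 0], all three sums extend to the
    multi-indices below one common degree bound, where additivity is termwise. *)
Lemma big_msuppD (P Q : {mpoly R[n]}) :
  \sum_(a <- msupp (P + Q)) F a (P + Q)@_a =
  \sum_(a <- msupp P) F a P@_a + \sum_(a <- msupp Q) F a Q@_a.
Proof.
pose k := maxn (msize (P + Q)) (maxn (msize P) (msize Q)).
rewrite !(@big_msupp_widen _ k) ?leq_max ?leqnn ?orbT // -big_split /=.
by apply: eq_bigr => a _; rewrite mcoeffD FD.
Qed.

Lemma big_msuppZX c a :
  \sum_(b <- msupp (c *: 'X_[a] : {mpoly R[n]})) F b (c *: 'X_[a])@_b = F a c.
Proof.
have [->|c0] := eqVneq c 0; first by rewrite scale0r msupp0 big_nil F0.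
by rewrite msuppMCX // big_seq1 mcoeffZ mcoeffX eqxx mulr1.
Qed.

End SupportSums.

Lemma mpoly_sum_ind n (R : nzRingType) (Pr : {mpoly R[n]} -> Prop) :
  Pr 0 -> (forall P Q, Pr P -> Pr Q -> Pr (P + Q)) ->
  (forall c a, Pr (c *: 'X_[a])) -> forall P, Pr P.
Proof. by move=> h0 hD hX P; rewrite [P]mpolyE; apply: big_ind. Qed.

Section WeylAlgebra.
Variables (K : fieldType) (n : nat).
Local Notation mul := (@mul K n).
Implicit Types (P Q : weyl K n) (x : 'I_n -> K) (D : 'X_{1..n} -> K).

Lemma weyl_ind (Pr : weyl K n -> Prop) :
  Pr 0 -> (forall P Q, Pr P -> Pr Q -> Pr (P + Q)) ->
  (forall p a, Pr (p *: 'X_[a])) -> forall P, Pr P.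
Proof. exact: mpoly_sum_ind. Qed.

Lemma weyl_mono_ind (Pr : weyl K n -> Prop) :
  Pr 0 -> (forall P Q, Pr P -> Pr Q -> Pr (P + Q)) ->
  (forall m a c, Pr ((c *: 'X_[m]) *: 'X_[a])) -> forall P, Pr P.
Proof.
move=> h0 hD hX; apply: weyl_ind => // p a.
elim/mpoly_sum_ind: p => [|p q hp hq|c m]; first by rewrite scale0r.
  by rewrite scalerDl; apply: hD.
exact: hX.
Qed.

Lemma mul_addl P P' Q : mul (P + P') Q = mul P Q + mul P' Q.
Proof.
rewrite /mul (big_msuppD (F := fun a p => \sum_(b <- msupp Q)
    \sum_(g : 'X_{1..n < (mdeg a).+1} | (g <= a)%MM)
      (p * (Q@_b)^`M[g] *+ mbinom a g) *: 'X_[a - g + b])) //.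
  by move=> a; rewrite big1 // => b _; rewrite big1 // => g _;
    rewrite mul0r mul0rn scale0r.
move=> a p q; rewrite -big_split; apply: eq_bigr => b _.
rewrite -big_split; apply: eq_bigr => g _.
by rewrite /= mulrDl mulrnDl scalerDl.
Qed.

Lemma mul_addr P Q Q' : mul P (Q + Q') = mul P Q + mul P Q'.
Proof.
rewrite /mul -big_split; apply: eq_bigr => a _ /=.
rewrite (big_msuppD (F := fun b q =>
    \sum_(g : 'X_{1..n < (mdeg a).+1} | (g <= a)%MM)
      (P@_a * q^`M[g] *+ mbinom a g) *: 'X_[a - g + b])) //.
  by move=> b; rewrite big1 // => g _; rewrite linear0 mulr0 mul0rn scale0r.
move=> b p q; rewrite -big_split; apply: eq_bigr => g _.
by rewrite /= mderivmD mulrDr mulrnDl scalerDl.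
Qed.

Lemma mul0w Q : mul 0 Q = 0.
Proof. by rewrite /mul msupp0 big_nil. Qed.

Lemma mulw0 P : mul P 0 = 0.
Proof. by rewrite /mul big1 // => a _; rewrite msupp0 big_nil. Qed.

Lemma mulXX p a q b : mul (p *: 'X_[a]) (q *: 'X_[b]) =
  \sum_(g : 'X_{1..n < (mdeg a).+1} | (g <= a)%MM)
    (p * q^`M[g] *+ mbinom a g) *: 'X_[a - g + b].
Proof.
rewrite /mul (big_msuppZX (F := fun a p => \sum_(b0 <- msupp (q *: 'X_[b]))
    \sum_(g : 'X_{1..n < (mdeg a).+1} | (g <= a)%MM)
      (p * ((q *: 'X_[b])@_b0)^`M[g] *+ mbinom a g) *: 'X_[a - g + b0])); last first.
  by move=> c; rewrite big1 // => c' _; rewrite big1 // => g _;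
    rewrite mul0r mul0rn scale0r.
rewrite (big_msuppZX (F := fun b q =>
    \sum_(g : 'X_{1..n < (mdeg a).+1} | (g <= a)%MM)
      (p * q^`M[g] *+ mbinom a g) *: 'X_[a - g + b])) //.
by move=> c; rewrite big1 // => g _; rewrite linear0 mulr0 mul0rn scale0r.
Qed.

Lemma mulw1 P : mul P 1 = P.
Proof.
elim/weyl_ind: P => [|P Q hP hQ|p a]; first exact: mul0w.
  by rewrite mul_addl hP hQ.
rewrite -[1]scale1r -mpolyX0 mulXX.
have h0 : (mdeg (0%MM : 'X_{1..n}) < (mdeg a).+1)%N by rewrite mdeg0.
rewrite (bigD1 (BMultinom h0)) /=; last by apply/mnm_lepP => i; rewrite mnm0E.
rewrite mderivm0m mulr1 subm0 addm0 big1 ?addr0.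
  by rewrite /mbinom big1 ?mulr1n // => i _; rewrite mnm0E bin0.
(* A nonzero [g] differentiates the constant coefficient 1, so its term vanishes. *)
move=> g /andP[_ g0]; rewrite -mpolyX0 mderivmX.
have [i gi] : exists i, g i != 0%N.
  apply/existsP; apply: contraNT g0; rewrite negb_exists => /forallP gi.
  by apply/eqP/val_inj/mnmP => i; apply/eqP; rewrite mnm0E -[_ == _]negbK gi.
rewrite (bigD1 i) //= mnm0E ffact0n (negbTE gi) mul0n scale0r mulr0 mul0rn.
exact: scale0r.
Qed.

Lemma mul_cl (c : {mpoly K[n]}) P Q : mul (c *: P) Q = c *: mul P Q.
Proof.
elim/weyl_ind: P => [|P P' hP hQ|p a]; first by rewrite scaler0 mul0w scaler0.
  by rewrite scalerDr !mul_addl hP hQ scalerDr.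
elim/weyl_ind: Q => [|Q Q' hQ hQ'|q b]; first by rewrite !mulw0 scaler0.
  by rewrite !mul_addr hQ hQ' scalerDr.
rewrite scalerA !mulXX scaler_sumr; apply: eq_bigr => g _.
by rewrite scalerA -mulrA mulrnAr.
Qed.

Lemma apply_at0 x D : apply_at 0 x D = 0.
Proof. by rewrite /apply_at msupp0 big_nil. Qed.

Lemma apply_atD P Q x D : apply_at (P + Q) x D = apply_at P x D + apply_at Q x D.
Proof.
rewrite /apply_at (big_msuppD (F := fun a p => p.@[x] * D a)) //.
  by move=> a; rewrite meval0 mul0r.
by move=> a p q; rewrite mevalD mulrDl.
Qed.

Lemma apply_atX p a x D : apply_at (p *: 'X_[a]) x D = p.@[x] * D a.
Proof.
rewrite /apply_at (big_msuppZX (F := fun a p => p.@[x] * D a)) //.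
by move=> c; rewrite meval0 mul0r.
Qed.

Lemma eq_apply_at P x D D' :
  {in msupp P, D =1 D'} -> apply_at P x D = apply_at P x D'.
Proof. by move=> h; apply: eq_big_seq => a /h ->. Qed.

End WeylAlgebra.

Section Tensor.
Variables (K : fieldType) (n1 n2 n : nat) (sp : splitting n1 n2 n).
Local Notation W1 := (weyl K n1).
Local Notation W2 := (weyl K n2).
Local Notation W := (weyl K n).
Implicit Types (U : W1) (V : W2) (P : W).

Definition emb m (h : 'I_m -> 'I_n) (p : {mpoly K[m]}) : {mpoly K[n]} :=
  mmap (@mpolyC n K) (fun i => 'X_(h i)) p.

Lemma emb0 m (h : 'I_m -> 'I_n) : emb h 0 = 0.
Proof. exact: mmap0. Qed.

Lemma embD m (h : 'I_m -> 'I_n) : {morph emb h : p q / p + q}.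
Proof. exact: mmapD. Qed.

Lemma embZX m (h : 'I_m -> 'I_n) c a :
  emb h (c *: 'X_[a]) = c *: \prod_i 'X_(h i) ^+ a i.
Proof. by rewrite /emb mmapZ mmapX mul_mpolyC. Qed.

Definition pemb (p : {mpoly K[n1]}) (q : {mpoly K[n2]}) : {mpoly K[n]} :=
  emb (inj1 sp) p * emb (inj2 sp) q.

Lemma pembX c a d b :
  pemb (c *: 'X_[a]) (d *: 'X_[b]) = (c * d) *: 'X_[mjoin sp a b].
Proof.
rewrite /pemb !embZX -scalerAl -scalerAr scalerA; congr (_ *: _).
by rewrite mpolyXE_id prod_mjoin.
Qed.

Lemma pemb0l q : pemb 0 q = 0. Proof. by rewrite /pemb emb0 mul0r. Qed.
Lemma pemb0r p : pemb p 0 = 0. Proof. by rewrite /pemb emb0 mulr0. Qed.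
Lemma pembDl q : {morph pemb^~ q : p p' / p + p'}.
Proof. by move=> p p'; rewrite /pemb embD mulrDl. Qed.
Lemma pembDr p : {morph pemb p : q q' / q + q'}.
Proof. by move=> q q'; rewrite /pemb embD mulrDr. Qed.

Lemma meval_emb m (h : 'I_m -> 'I_n) p x : (emb h p).@[x] = p.@[x \o h].
Proof.
elim/mpoly_sum_ind: p => [|p q hp hq|c a]; first by rewrite emb0 !meval0.
  by rewrite embD !mevalD hp hq.
rewrite embZX !mevalZ mevalX rmorph_prod /=.
by congr (_ * _); apply: eq_bigr => i _; rewrite rmorphXn /= mevalXU.
Qed.

Lemma meval_pemb p q x :
  (pemb p q).@[x] = p.@[x \o inj1 sp] * q.@[x \o inj2 sp].
Proof. by rewrite mevalM !meval_emb. Qed.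

Lemma mderivm_pemb p q a b :
  (pemb p q)^`M[mjoin sp a b] = pemb p^`M[a] q^`M[b].
Proof.
elim/mpoly_sum_ind: p => [|p p' hp hp'|c u].
- by rewrite !(pemb0l, linear0).
- by rewrite !(pembDl, linearD) /= hp hp'.
elim/mpoly_sum_ind: q => [|q q' hq hq'|d v].
- by rewrite !(pemb0r, linear0).
- by rewrite !(pembDr, linearD) /= hq hq'.
rewrite pembX !mderivmZ !mderivmX !scalerA pembX mjoinB; congr (_ *: _).
rewrite (big_side sp) /= natrM !mulrA; congr (_ * _); last first.
  by congr (_%:R); apply: eq_bigr => i _; rewrite !mjoin2.
rewrite mulrAC; congr (_ * _ * _).
by congr (_%:R); apply: eq_bigr => i _; rewrite !mjoin1.
Qed.

(* The operator U V, with U acting on the first and V on the second group of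
   variables. *)
Definition tens U V : W :=
  \sum_(a <- msupp U) \sum_(b <- msupp V)
    pemb U@_a V@_b *: 'X_[mjoin sp a b].

Lemma tens_addl U U' V : tens (U + U') V = tens U V + tens U' V.
Proof.
rewrite /tens (big_msuppD (F := fun a p => \sum_(b <- msupp V)
    pemb p V@_b *: 'X_[mjoin sp a b])) //.
  by move=> a; rewrite big1 // => b _; rewrite pemb0l scale0r.
move=> a p q; rewrite -big_split; apply: eq_bigr => b _.
by rewrite /= pembDl scalerDl.
Qed.

Lemma tens_addr U V V' : tens U (V + V') = tens U V + tens U V'.
Proof.
rewrite /tens -big_split; apply: eq_bigr => a _ /=.
rewrite (big_msuppD (F := fun b q => pemb U@_a q *: 'X_[mjoin sp a b])) //.
  by move=> b; rewrite pemb0r scale0r.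
by move=> b p q; rewrite /= pembDr scalerDl.
Qed.

Lemma tens0l V : tens 0 V = 0.
Proof. by rewrite /tens msupp0 big_nil. Qed.

Lemma tens0r U : tens U 0 = 0.
Proof. by rewrite /tens big1 // => a _; rewrite msupp0 big_nil. Qed.

Lemma tens_suml I (r : seq I) (Pr : pred I) (F : I -> W1) V :
  tens (\sum_(i <- r | Pr i) F i) V = \sum_(i <- r | Pr i) tens (F i) V.
Proof.
exact: (big_morph (fun U => tens U V) (fun U U' => tens_addl U U' V) (tens0l V)).
Qed.

Lemma tens_sumr I (r : seq I) (Pr : pred I) (F : I -> W2) U :
  tens U (\sum_(i <- r | Pr i) F i) = \sum_(i <- r | Pr i) tens U (F i).
Proof. exact: (big_morph (tens U) (tens_addr U) (tens0r U)). Qed.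

Lemma tensXX p a q b :
  tens (p *: 'X_[a]) (q *: 'X_[b]) = pemb p q *: 'X_[mjoin sp a b].
Proof.
rewrite /tens (big_msuppZX (F := fun a p => \sum_(b0 <- msupp (q *: 'X_[b]))
    pemb p (q *: 'X_[b])@_b0 *: 'X_[mjoin sp a b0])); last first.
  by move=> c; rewrite big1 // => c' _; rewrite pemb0l scale0r.
rewrite (big_msuppZX (F := fun b q => pemb p q *: 'X_[mjoin sp a b])) //.
by move=> c; rewrite pemb0r scale0r.
Qed.

Lemma pembMM p p' q q' : pemb p q * pemb p' q' = pemb (p * p') (q * q').
Proof.
by rewrite /pemb mulrACA; congr (_ * _); rewrite /emb rmorphM.
Qed.

Lemma pembMn p q k l : pemb (p *+ k) (q *+ l) = pemb p q *+ (k * l).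
Proof.
by rewrite /pemb /emb !raddfMn /= mulrnAl mulrnAr -mulrnA mulnC.
Qed.

(** Operators in different variables commute. By bilinearity it suffices to look at monomials, where
    binomials, derivatives and exponents all factor over the two groups. *)
Lemma mul_tens U U' V V' :
  mul (tens U V) (tens U' V') = tens (mul U U') (mul V V').
Proof.
elim/weyl_ind: U => [|U1 U2 h1 h2|p a].
- by rewrite tens0l !mul0w tens0l.
- rewrite tens_addl !mul_addl tens_addl; congr (_ + _); [exact: h1 | exact: h2].
elim/weyl_ind: V => [|V1 V2 h1 h2|q b].
- by rewrite tens0r !mul0w tens0r.
- rewrite tens_addr !mul_addl tens_addr; congr (_ + _); [exact: h1 | exact: h2].
elim/weyl_ind: U' => [|U1 U2 h1 h2|p' a'].
- by rewrite tens0l !mulw0 tens0l.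
- rewrite tens_addl !mul_addr tens_addl; congr (_ + _); [exact: h1 | exact: h2].
elim/weyl_ind: V' => [|V1 V2 h1 h2|q' b'].
- by rewrite tens0r !mulw0 tens0r.
- rewrite tens_addr !mul_addr tens_addr; congr (_ + _); [exact: h1 | exact: h2].
rewrite !tensXX !mulXX.
rewrite (big_le_mjoin sp a b (fun g => (pemb p q * (pemb p' q')^`M[g] *+
  mbinom (mjoin sp a b) g) *: 'X_[mjoin sp a b - g + mjoin sp a' b'])).
rewrite tens_suml; apply: eq_bigr => g _; rewrite tens_sumr; apply: eq_bigr => h _.
by rewrite tensXX mderivm_pemb pembMM mbinom_mjoin -mjoinB -mjoinD pembMn.
Qed.

Lemma apply_at_tens U V x D :
  apply_at (tens U V) x D =
  apply_at U (x \o inj1 sp)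
    (fun a => apply_at V (x \o inj2 sp) (fun b => D (mjoin sp a b))).
Proof.
elim/weyl_ind: U => [|U1 U2 h1 h2|p a].
- by rewrite tens0l !apply_at0.
- rewrite tens_addl !apply_atD; congr (_ + _); [exact: h1 | exact: h2].
elim/weyl_ind: V => [|V1 V2 h1 h2|q b].
- by rewrite tens0r !apply_at0 apply_atX apply_at0 mulr0.
- rewrite tens_addr apply_atD !apply_atX apply_atD mulrDr.
  congr (_ + _); [exact: etrans h1 (apply_atX _ _ _ _)
    | exact: etrans h2 (apply_atX _ _ _ _)].
by rewrite tensXX !apply_atX meval_pemb mulrA.
Qed.

(** Each monomial in x and d is the product of one monomial in each group of variables. *)
Lemma weyl_tens_ind (Pr : W -> Prop) :
  Pr 0 -> (forall P Q, Pr P -> Pr Q -> Pr (P + Q)) ->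
  (forall U V, Pr (tens U V)) -> forall P, Pr P.
Proof.
move=> h0 hD hT; apply: weyl_mono_ind => // m a c.
rewrite -(mjoinK sp m) -(mjoinK sp a) -[c]mulr1 -pembX -tensXX.
exact: hT.
Qed.

Definition pemb_at (y : 'I_n2 -> K) (p : {mpoly K[n]}) : {mpoly K[n1]} :=
  mmap (@mpolyC n1 K) (fjoin sp (fun i => 'X_i) (fun j => (y j)%:MP)) p.

Lemma pemb_at_pemb y p q : pemb_at y (pemb p q) = q.@[y] *: p.
Proof.
rewrite /pemb_at /pemb rmorphM /=.
elim/mpoly_sum_ind: p => [|p p' hp hp'|c a].
- by rewrite emb0 rmorph0 mul0r scaler0.
- by rewrite embD rmorphD mulrDl hp hp' scalerDr.
elim/mpoly_sum_ind: q => [|q q' hq hq'|d b].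
- by rewrite emb0 rmorph0 mulr0 meval0 scale0r.
- by rewrite embD rmorphD mulrDr hq hq' mevalD scalerDl.
rewrite !embZX !mmapZ !rmorph_prod /= mevalZ mevalX -!mul_mpolyC.
rewrite [X in _ * X * _](_ : _ = 'X_[a]); last first.
  rewrite mpolyXE_id; apply: eq_bigr => i _.
  by rewrite rmorphXn /= mmapX mmap1U fjoin1.
rewrite [X in _ * (_ * X)](_ : _ = (\prod_i y i ^+ b i)%:MP); last first.
  rewrite rmorph_prod; apply: eq_bigr => i _.
  by rewrite rmorphXn /= mmapX mmap1U fjoin2 rmorphXn.
by rewrite -rmorphM /= mulrC.
Qed.

(* [P] acts in the second group of variables on a function whose derivatives at
   [y] are [D], and these variables are then frozen at [y]. *)
Definition pact P (y : 'I_n2 -> K) (D : 'X_{1..n2} -> K) : W1 :=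
  \sum_(e <- msupp P) (D (mproj2 sp e) *: pemb_at y P@_e) *: 'X_[mproj1 sp e].

Lemma pactD P Q y D : pact (P + Q) y D = pact P y D + pact Q y D.
Proof.
rewrite /pact (big_msuppD (F := fun e p =>
  (D (mproj2 sp e) *: pemb_at y p) *: 'X_[mproj1 sp e])) //.
  by move=> a; rewrite /pemb_at rmorph0 scaler0 scale0r.
by move=> a p q; rewrite /pemb_at rmorphD scalerDr scalerDl.
Qed.

Lemma pact0 y D : pact 0 y D = 0.
Proof. by rewrite /pact msupp0 big_nil. Qed.

(** What [pact] is made for: a product leaves a multiple of [U], which stays in any ideal containing
    [U] and vanishes when [V] kills the given function at [y]. *)
Lemma pact_tens U V y D : pact (tens U V) y D = (apply_at V y D)%:MP *: U.
Proof.
elim/weyl_ind: U => [|U1 U2 h1 h2|p a].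
- by rewrite tens0l pact0 scaler0.
- rewrite tens_addl pactD scalerDr; congr (_ + _); [exact: h1 | exact: h2].
elim/weyl_ind: V => [|V1 V2 h1 h2|q b].
- by rewrite tens0r pact0 apply_at0 scale0r.
- rewrite tens_addr pactD apply_atD rmorphD scalerDl.
  by congr (_ + _); [exact: h1 | exact: h2].
rewrite tensXX /pact (big_msuppZX (F := fun e p =>
  (D (mproj2 sp e) *: pemb_at y p) *: 'X_[mproj1 sp e])); last first.
  by move=> c; rewrite /pemb_at rmorph0 scaler0 scale0r.
rewrite mproj1K mproj2K pemb_at_pemb apply_atX [RHS]scalerA mul_mpolyC.
by rewrite [D b *: _]scalerA [_ * D b]mulrC.
Qed.

Lemma apply_at_pact P y D x D1 :
  apply_at (pact P y D) x D1 =
  apply_at P (fjoin sp x y) (fun e => D1 (mproj1 sp e) * D (mproj2 sp e)).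
Proof.
elim/weyl_tens_ind: P => [|P Q hP hQ|U V].
- by rewrite pact0 !apply_at0.
- by rewrite pactD !apply_atD; congr (_ + _); [exact: hP | exact: hQ].
rewrite pact_tens apply_at_tens.
have e1 : (fjoin sp x y \o inj1 sp) =1 x by move=> i; rewrite /= fjoin1.
have e2 : (fjoin sp x y \o inj2 sp) =1 y by move=> i; rewrite /= fjoin2.
elim/weyl_ind: U => [|U1 U2 h1 h2|p a].
- by rewrite scaler0 !apply_at0.
- by rewrite scalerDr !apply_atD; congr (_ + _); [exact: h1 | exact: h2].
rewrite scalerA !apply_atX mevalM mevalC (meval_eq _ e1).
elim/weyl_ind: V => [|V1 V2 h1 h2|q b].
- by rewrite !apply_at0 !(mul0r, mulr0).
- by rewrite !apply_atD mulrDl mulrDl mulrDr h1 h2.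
rewrite !apply_atX (meval_eq _ e2) mproj1K mproj2K.
by rewrite [_ * D b * _]mulrC -!mulrA; do 2!congr (_ * _); rewrite mulrC.
Qed.

Lemma msize_pact P y D : (msize (pact P y D) <= msize P)%N.
Proof.
rewrite /pact big_seq; apply: (leq_trans (mmeasure_sum _ _ _ _)).
apply/bigmax_leqP_seq => e _ eP; apply: leq_trans (msizeZ_le _ _) _.
rewrite msizeX; apply: leq_ltn_trans (msize_mdeg_lt eP).
by rewrite -{2}(mjoinK sp e) mdeg_mjoin leq_addr.
Qed.

End Tensor.

Lemma tens_swap K n1 n2 n (sp : splitting n1 n2 n) (U : weyl K n1) (V : weyl K n2) :
  tens (swap sp) V U = tens sp U V.
Proof.
rewrite /tens exchange_big; apply: eq_bigr => a _; apply: eq_bigr => b _.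
by rewrite mjoin_swap /pemb mulrC.
Qed.

(** The restriction to top order is moved into the numbers that stand for derivatives, so that
    everything known about [apply_at] applies to symbols. *)
Lemma symbolE (K : fieldType) n (P : weyl K n) x xi :
  symbol P x xi =
  apply_at P x (fun a => if (mdeg a).+1 == msize P then \prod_i xi i ^+ a i else 0).
Proof.
rewrite /symbol /apply_at big_mkcond; apply: eq_bigr => a _.
by case: ifP => _; rewrite ?mulr0.
Qed.

(* [left_ideal] quantifies over indexed families; this form allows induction. *)
Inductive addspan (V : nmodType) (S : V -> Prop) : V -> Prop :=
  | addspan0 : addspan S 0
  | addspanD x y : S x -> addspan S y -> addspan S (x + y).

Lemma addspan_add (V : nmodType) (S : V -> Prop) x y :
  addspan S x -> addspan S y -> addspan S (x + y).
Proof.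
elim=> [|{}x z Sx _ ih] hy; first by rewrite add0r.
by rewrite -addrA; apply: addspanD => //; exact: ih.
Qed.

Lemma addspan1 (V : nmodType) (S : V -> Prop) x : S x -> addspan S x.
Proof. by move=> Sx; rewrite -[x]addr0; apply: addspanD => //; exact: addspan0. Qed.

Section Ideal.
Variables (K : fieldType) (n : nat) (S : weyl K n -> Prop).

Lemma left_idealE P :
  left_ideal S P <-> addspan (fun P => exists Q G, S G /\ P = mul Q G) P.
Proof.
split=> [[k [Q [G [SG ->]]]]|].
  elim: k Q G SG => [|k ih] Q G SG; first by rewrite big_ord0; exact: addspan0.
  rewrite big_ord_recl; apply: addspanD; first by exists (Q ord0), (G ord0).
  exact: (ih (fun i => Q (lift ord0 i)) (fun i => G (lift ord0 i))).
elim=> [|x y [Q [G [SG ->]]] _ [k [Q' [G' [SG' ->]]]]].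
  by exists 0%N, (fun=> 0), (fun=> 0); split; [case | rewrite big_ord0].
exists k.+1, (fun i => if unlift ord0 i is Some j then Q' j else Q),
  (fun i => if unlift ord0 i is Some j then G' j else G); split.
  by move=> i; case: (unlift ord0 i).
rewrite big_ord_recl unlift_none; congr (_ + _).
by apply: eq_bigr => i _; rewrite liftK.
Qed.

Lemma left_ideal_mulC c P : left_ideal S P -> left_ideal S (c *: P).
Proof.
move=> /left_idealE h; apply/left_idealE.
elim: h => [|x y [Q [G [SG ->]]] _ ih]; first by rewrite scaler0; exact: addspan0.
rewrite scalerDr; apply: addspanD => //.
by exists (c *: Q), G; rewrite mul_cl.
Qed.

Lemma left_idealD P Q : left_ideal S P -> left_ideal S Q -> left_ideal S (P + Q).
Proof.
move=> /left_idealE hP /left_idealE hQ; apply/left_idealE.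
exact: addspan_add.
Qed.

Lemma left_ideal0 : left_ideal S 0.
Proof. by apply/left_idealE; exact: addspan0. Qed.

End Ideal.

Section ExtPair.
Variables (K : fieldType) (n1 n2 n : nat) (sp : splitting n1 n2 n).

(* Every generator of a factor is one of the whole; conversely, a generator of
   the whole is only required to be a sum of products having a factor in [S1] or
   [S2], as for the binomial operator of a vector (u1, u2). *)
Definition ext_pair (S : weyl K n -> Prop) (S1 : weyl K n1 -> Prop)
    (S2 : weyl K n2 -> Prop) : Prop :=
  [/\ forall G, S1 G -> S (tens sp G 1), forall G, S2 G -> S (tens sp 1 G) &
    forall G, S G -> addspan (fun T => (exists G1 V, S1 G1 /\ T = tens sp G1 V) \/
      (exists U G2, S2 G2 /\ T = tens sp U G2)) G].

Variables (S : weyl K n -> Prop) (S1 : weyl K n1 -> Prop) (S2 : weyl K n2 -> Prop).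
Hypothesis ext : ext_pair S S1 S2.

(** If [P] is a sum of terms [Q G], then [P V] is the sum of the [(Q V) (G 1)], because [V] commutes
    with [G]. *)
Lemma left_ideal_tens P V : left_ideal S1 P -> left_ideal S (tens sp P V).
Proof.
case: ext => h1 _ _ /left_idealE h; apply/left_idealE.
elim: h => [|x y [Q [G [SG ->]]] _ ih]; first by rewrite tens0l; exact: addspan0.
rewrite tens_addl; apply: addspanD => //.
exists (tens sp Q V), (tens sp G 1); split; first exact: h1.
by rewrite mul_tens mulw1.
Qed.

(** In the usual notation, I lies in I1 D2 + D1 I2: a left multiplier is a sum of products [Q1 Q2],
    and [Q1 Q2 G1 V] regroups as [(Q1 G1) (Q2 V)]. *)
Lemma ideal_tens_dec P : left_ideal S P ->
  addspan (fun T => exists U V,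
    (left_ideal S1 U \/ left_ideal S2 V) /\ T = tens sp U V) P.
Proof.
case: ext => _ _ h3 /left_idealE h.
elim: h => [|x y [Q [G [/h3 SG ->]]] _ ih]; first exact: addspan0.
apply: addspan_add => //.
elim/(@weyl_tens_ind K _ _ _ sp): Q => [|P1 P2 hP1 hP2|Q1 Q2].
- by rewrite mul0w; exact: addspan0.
- by rewrite mul_addl; exact: addspan_add.
elim: SG => [|z t hz _ ih2]; first by rewrite mulw0; exact: addspan0.
rewrite mul_addr; apply: addspanD => //.
have e m (S' : weyl K m -> Prop) Q' G' : S' G' -> left_ideal S' (mul Q' G').
  by move=> SG; apply/left_idealE/addspan1; exists Q', G'.
case: hz => [[G1 [V [SG1 ->]]]|[U [G2 [SG2 ->]]]]; rewrite mul_tens.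
  by exists (mul Q1 G1), (mul Q2 V); split=> //; left; exact: e.
by exists (mul Q1 U), (mul Q2 G2); split=> //; right; exact: e.
Qed.

End ExtPair.

Lemma ext_pair_swap K n1 n2 n (sp : splitting n1 n2 n) S S1 S2 :
  @ext_pair K n1 n2 n sp S S1 S2 -> ext_pair (swap sp) S S2 S1.
Proof.
case=> h1 h2 h3; split=> [G|G|G /h3 hG].
- by rewrite tens_swap; exact: h2.
- by rewrite tens_swap; exact: h1.
elim: hG => [|x y hx _ ih]; first exact: addspan0.
apply: addspanD => //; case: hx => [[G1 [V [SG1 ->]]]|[U [G2 [SG2 ->]]]].
  by right; exists V, G1; rewrite tens_swap.
by left; exists G2, U; rewrite tens_swap.
Qed.

(** * The hypergeometric ideal of a direct sum *)

Section DirectSum.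
Variables (K : fieldType) (d1 n1 d2 n2 : nat).
Variables (A : 'M[int]_(d1, n1)) (B : 'M[int]_(d2, n2)).
Variables (beta : 'cV[K]_d1) (gamma : 'cV[K]_d2).
Local Notation sp := (lrsplit n1 n2).

(** [hypergeometric_ideal A b] is [left_ideal (hyp_gens A b)] by conversion. *)
Definition hyp_gens d n (A : 'M[int]_(d, n)) (b : 'cV[K]_d) (P : weyl K n) : Prop :=
  (exists2 u, A *m u = 0 & P = box K u) \/ exists i, P = euler A b i.

Lemma posm_col (u1 : 'cV[int]_n1) (u2 : 'cV[int]_n2) :
  posm (col_mx u1 u2) = mjoin sp (posm u1) (posm u2).
Proof.
apply/mnmP => k; case: (sideP sp k) => i; rewrite (mjoin1, mjoin2) !mnmE /=.
  by rewrite col_mxEu.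
by rewrite col_mxEd.
Qed.

Lemma tensX a b : tens sp ('X_[a] : weyl K n1) ('X_[b] : weyl K n2) = 'X_[mjoin sp a b].
Proof.
have e m c : ('X_[c] : weyl K m) = (1 *: 'X_[0] : {mpoly K[m]}) *: 'X_[c].
  by rewrite scale1r mpolyX0 scale1r.
by rewrite (e n1 a) (e n2 b) tensXX pembX mulr1 mjoin0 scale1r mpolyX0 scale1r.
Qed.

Lemma tensNl (U : weyl K n1) (V : weyl K n2) : tens sp (- U) V = - tens sp U V.
Proof.
by apply/eqP; rewrite -addr_eq0 -tens_addl addNr tens0l.
Qed.

Lemma tensNr (U : weyl K n1) (V : weyl K n2) : tens sp U (- V) = - tens sp U V.
Proof.
by apply/eqP; rewrite -addr_eq0 -tens_addr addNr tens0r.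
Qed.

Lemma posm0 m : posm (0 : 'cV[int]_m) = 0%MM.
Proof. by apply/mnmP => i; rewrite !mnmE mxE lexx. Qed.

Lemma mpolyC_ZX m (c : K) : c%:MP%:MP = (c *: 'X_[0] : {mpoly K[m]}) *: 'X_[0] :> weyl K m.
Proof. by rewrite !mpolyX0 -[_ *: 1]mul_mpolyC mulr1 -mul_mpolyC mulr1. Qed.

(** The telescoping [x y - x' y' = (x - x') y + x' (y - y')] for the monomials of the two
    factors. *)
Lemma box_col (u1 : 'cV[int]_n1) (u2 : 'cV[int]_n2) :
  box K (col_mx u1 u2) =
  tens sp (box K u1) 'X_[posm u2] + tens sp 'X_[posm (- u1)] (box K u2).
Proof.
rewrite /box tens_addl tens_addr tensNl tensNr !tensX.
by rewrite opp_col_mx !posm_col addrA subrK.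
Qed.

Lemma tens_euler1 i :
  tens sp (euler A beta i) 1 =
  euler (direct_sum A B) (col_mx beta gamma) (lshift d2 i).
Proof.
have e1 : (1 : weyl K n2) = (1 *: 'X_[0] : {mpoly K[n2]}) *: 'X_[0].
  by rewrite scale1r mpolyX0 scale1r mpolyX0.
rewrite /euler tens_addl tensNl tens_suml col_mxEu; congr (_ - _); last first.
  by rewrite !mpolyC_ZX e1 tensXX pembX mulr1 !mjoin0.
rewrite big_split_ord /= [X in _ = _ + X]big1 ?addr0 => [|j _]; last first.
  by rewrite /direct_sum block_mxEur mxE scale0r scale0r.
apply: eq_bigr => j _; rewrite e1 tensXX pembX mulr1 /direct_sum block_mxEul.
suff -> : mjoin sp U_(j)%MM 0%MM = U_(lshift n2 j)%MM by [].
apply/mnmP => k; case: (sideP sp k) => l; rewrite (mjoin1, mjoin2) !mnmE /=.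
  by rewrite (inj_eq (@lshift_inj _ _)).
by rewrite eq_lrshift.
Qed.

Lemma tens_euler2 i :
  tens sp 1 (euler B gamma i) =
  euler (direct_sum A B) (col_mx beta gamma) (rshift d1 i).
Proof.
have e1 : (1 : weyl K n1) = (1 *: 'X_[0] : {mpoly K[n1]}) *: 'X_[0].
  by rewrite scale1r mpolyX0 scale1r mpolyX0.
rewrite /euler tens_addr tensNr tens_sumr col_mxEd; congr (_ - _); last first.
  by rewrite !mpolyC_ZX e1 tensXX pembX mul1r !mjoin0.
rewrite big_split_ord /= [X in _ = X + _]big1 ?add0r => [|j _]; last first.
  by rewrite /direct_sum block_mxEdl mxE scale0r scale0r.
apply: eq_bigr => j _; rewrite e1 tensXX pembX mul1r /direct_sum block_mxEdr.
suff -> : mjoin sp 0%MM U_(j)%MM = U_(rshift n1 j)%MM by [].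
apply/mnmP => k; case: (sideP sp k) => l; rewrite (mjoin1, mjoin2) !mnmE /=.
  by rewrite eq_rlshift.
by rewrite (inj_eq (@rshift_inj _ _)).
Qed.

Lemma box0 m : box K (0 : 'cV[int]_m) = 0.
Proof. by rewrite /box oppr0 subrr. Qed.

(** The kernel of the block matrix is the product of the two kernels. Padding a kernel vector by
    zeros makes the monomials of the other group equal to 1. *)
Lemma hyp_gens_direct_sum :
  ext_pair sp (hyp_gens (direct_sum A B) (col_mx beta gamma))
    (hyp_gens A beta) (hyp_gens B gamma).
Proof.
split=> G.
- case=> [[u Au ->]|[i ->]]; last by right; exists (lshift d2 i); exact: tens_euler1.
  left; exists (col_mx u 0).
    by rewrite /direct_sum mul_block_col Au !mul0mx !mulmx0 !addr0 col_mx0.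
  by rewrite box_col box0 tens0r addr0 posm0 mpolyX0.
- case=> [[u Au ->]|[i ->]]; last by right; exists (rshift d1 i); exact: tens_euler2.
  left; exists (col_mx 0 u).
    by rewrite /direct_sum mul_block_col Au !mul0mx !mulmx0 !addr0 col_mx0.
  by rewrite box_col box0 tens0l add0r oppr0 posm0 mpolyX0.
case=> [[u Au ->]|[i ->]].
  move: Au; rewrite -[u]vsubmxK /direct_sum mul_block_col !mul0mx addr0 add0r.
  rewrite -col_mx0 => /eq_col_mx [Au1 Bu2]; rewrite box_col.
  apply: addspanD; last apply: addspan1.
    left; exists (box K (usubmx u)), 'X_[posm (dsubmx u)]; split=> //.
    by left; exists (usubmx u).
  right; exists 'X_[posm (- usubmx u)], (box K (dsubmx u)); split=> //.
  by left; exists (dsubmx u).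
apply: addspan1; case: (split_ordP i) => j ->.
  by left; exists (euler A beta j), 1; rewrite tens_euler1; split=> //; right; exists j.
by right; exists 1, (euler B gamma j); rewrite tens_euler2; split=> //; right; exists j.
Qed.

End DirectSum.

(** In zero variables the only box operator is that of [u = 0], which is 0, and there is no Euler
    operator. *)
Lemma hyp_gens0 (K : fieldType) (A : 'M[int]_(0, 0)) (b : 'cV[K]_0) P :
  left_ideal (hyp_gens A b) P -> P = 0.
Proof.
move=> /left_idealE; elim=> // x y [Q [G [SG ->]]] _ ->; rewrite addr0.
case: SG => [[u _ ->]|[[]//]].
by rewrite (_ : u = 0) ?box0 ?mulw0 //; apply/matrixP => -[].
Qed.

(** * Symbols of products and of frozen operators *)

Section SymbolSlices.
Variables (K : fieldType).

(* Restates ['X_[b]] for use where the notations of mpoly are not available. *)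
Definition weylX n (b : 'X_{1..n}) : weyl K n := 'X_[b].

Lemma apply_at_mpolyX n (b : 'X_{1..n}) (x : 'I_n -> K) D :
  apply_at (weylX b) x D = D b.
Proof. by rewrite /weylX -[X in apply_at X]scale1r apply_atX meval1 mul1r. Qed.

Lemma apply_at_mulr n (P : weyl K n) x k D :
  apply_at P x (fun a => D a * k) = apply_at P x D * k.
Proof. by rewrite /apply_at mulr_suml; apply: eq_bigr => a _; rewrite mulrA. Qed.

Lemma apply_at_mull n (P : weyl K n) x k D :
  apply_at P x (fun a => k * D a) = k * apply_at P x D.
Proof. by rewrite /apply_at mulr_sumr; apply: eq_bigr => a _; rewrite mulrCA. Qed.

(** Stated with [List.In] to combine with [near_seq], which works over an arbitrary type. *)
Lemma eq_apply_at_In n (P : weyl K n) x D D' :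
  (forall a, List.In a (msupp P) -> D a = D' a) -> apply_at P x D = apply_at P x D'.
Proof.
rewrite /apply_at; elim: (msupp P : seq _) => [|a s ih] h; first by rewrite !big_nil.
by rewrite !big_cons (h a) ?ih //; [move=> b bs; apply: h; right | left].
Qed.

Lemma iter_partials0 n (T : Type) (D : 'I_n -> T -> T) (f : T) :
  iter_partials D 0%MM f = f.
Proof.
by rewrite /iter_partials; elim: (enum _) => //= i s ->; rewrite mnm0E.
Qed.

(** On a line, vanishing can be propagated by counting roots in one variable; the derivatives [D]
    stay fixed. *)
Lemma apply_at_line n (P : weyl K n) (x v : 'I_n -> K) D :
  exists q : {poly K}, forall t, apply_at P (fun i => x i + t * v i) D = q.[t].
Proof.
elim/weyl_mono_ind: P => [|P Q [q hq] [q' hq']|m a c].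
- by exists 0 => t; rewrite apply_at0 horner0.
- by exists (q + q') => t; rewrite apply_atD hornerD hq hq'.
exists ((c * D a) *: \prod_i ((x i)%:P + v i *: 'X) ^+ m i) => t.
rewrite apply_atX mevalZ mevalX hornerZ horner_prod mulrAC; congr (_ * _).
apply: eq_bigr => i _; rewrite horner_exp; congr (_ ^+ _).
by rewrite hornerD hornerC hornerZ hornerX mulrC.
Qed.

Lemma symbol_line n (P : weyl K n) (x v xi : 'I_n -> K) :
  exists q : {poly K}, forall t, symbol P (fun i => x i + t * v i) xi = q.[t].
Proof.
have [q hq] := apply_at_line P x v
  (fun a => if (mdeg a).+1 == msize P then \prod_i xi i ^+ a i else 0).
by exists q => t; rewrite symbolE hq.
Qed.

Variables (n1 n2 n : nat) (sp : splitting n1 n2 n).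

Lemma msize_tens1 (P : weyl K n1) : msize (tens sp P 1) = msize P.
Proof.
apply/eqP; rewrite eqn_leq; apply/andP; split.
  rewrite /tens big_seq; apply: (leq_trans (mmeasure_sum _ _ _ _)).
  apply/bigmax_leqP_seq => a _ aP; rewrite msupp1 big_seq1.
  apply: leq_trans (msizeZ_le _ _) _.
  by rewrite msizeX mdeg_mjoin mdeg0 addn0; exact: msize_mdeg_lt.
(* For the other inequality: freezing recovers [P] from [tens sp P 1], and freezing never raises the
   order. *)
pose D := fun _ : 'X_{1..n2} => (1 : K).
have {1}-> : P = pact sp (tens sp P 1) (fun=> 0) D.
  by rewrite pact_tens -mpolyX0 -/(weylX _) apply_at_mpolyX mpolyC1 scale1r.
exact: msize_pact.
Qed.

Lemma symbol_tens1 (P : weyl K n1) x xi :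
  symbol (tens sp P 1) x xi = symbol P (x \o inj1 sp) (xi \o inj1 sp).
Proof.
rewrite !symbolE apply_at_tens msize_tens1; apply: eq_apply_at => a _.
rewrite -mpolyX0 -/(weylX _) apply_at_mpolyX mdeg_mjoin mdeg0 addn0 prod_mjoin.
by rewrite [X in _ * X]big1 ?mulr1 // => i _; rewrite mnm0E expr0.
Qed.

Lemma symbol_left_ideal (S : weyl K n -> Prop) S1 (S2 : weyl K n2 -> Prop) P x xi :
  ext_pair sp S S1 S2 -> (forall Q, left_ideal S Q -> symbol Q x xi = 0) ->
  left_ideal S1 P -> symbol P (x \o inj1 sp) (xi \o inj1 sp) = 0.
Proof.
by move=> ext h hP; rewrite -symbol_tens1; exact: h (left_ideal_tens ext 1 hP).
Qed.

(* The quantified [R] serves the same purpose as [weylX]: the caller need not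
   mention polynomial structures. *)
Lemma symbol_slice (P : weyl K n) x1 xi1 y (D : 'X_{1..n2} -> K) :
  (forall R, R = pact sp P y D -> symbol R x1 xi1 = 0) ->
  D 0%MM * symbol P (fjoin sp x1 y) (fjoin sp xi1 (fun=> 0)) = 0.
Proof.
set R := pact _ _ _ _ => /(_ _ erefl) hR; rewrite symbolE -apply_at_mull.
pose D1 (a : 'X_{1..n1}) : K := if (mdeg a).+1 == msize P then \prod_i xi1 i ^+ a i else 0.
(* Exponents with a nonzero second part contribute nothing to either side: on the left xi is 0
   there, on the right the first part has degree below the order of [P]. *)
have -> : apply_at P (fjoin sp x1 y) (fun e => D 0%MM *
     (if (mdeg e).+1 == msize P then \prod_k fjoin sp xi1 (fun=> 0) k ^+ e k else 0)) =
  apply_at P (fjoin sp x1 y) (fun e => D1 (mproj1 sp e) * D (mproj2 sp e)).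
  apply: eq_apply_at => e /msize_mdeg_lt; rewrite -{1 2 3}(mjoinK sp e).
  rewrite prod_mjoin mdeg_mjoin /D1.
  have -> : \prod_i fjoin sp xi1 (fun=> 0) (inj1 sp i) ^+ mproj1 sp e i =
      \prod_i xi1 i ^+ mproj1 sp e i by apply: eq_bigr => i _; rewrite fjoin1.
  have -> : \prod_j fjoin sp xi1 (fun=> 0) (inj2 sp j) ^+ mproj2 sp e j =
      (mproj2 sp e == 0%MM)%:R.
    rewrite -mdeg_eq0 -expr0n mdegE.
    by elim/big_rec2: _ => [|i k z _ ->]; rewrite ?expr0 ?exprD ?fjoin2.
  have [->|] := eqVneq (mproj2 sp e) 0%MM => /=.
    by rewrite mdeg0 addn0 mulr1 => _; exact: mulrC.
  rewrite -mdeg_eq0 -lt0n => e0 eP; rewrite mulr0 if_same mulr0.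
  suff /negbTE -> : (mdeg (mproj1 sp e)).+1 != msize P by rewrite mul0r.
  by rewrite ltn_eqF // (leq_trans _ eP) // ltnS -addn1 leq_add2l.
rewrite -apply_at_pact -/R.
have [kR|kR] := eqVneq (msize R) (msize P).
  by rewrite -[RHS]hR symbolE kR.
(* When [R] has smaller order than [P], none of its terms reaches the degree selected by [D1]. *)
have -> : apply_at R x1 D1 = apply_at R x1 (fun=> 0).
  apply: eq_apply_at => a /msize_mdeg_lt aR.
  rewrite /D1 ltn_eqF //; apply: leq_ltn_trans aR _.
  by rewrite ltn_neqAle kR; exact: msize_pact.
by rewrite /apply_at big1 // => a _; rewrite mulr0.
Qed.

End SymbolSlices.

(** * Coefficient bounds for power series *)

Section Enumeration.
Variable (n : nat).

Definition bms N : seq 'X_{1..n} := [seq val g | g <- enum {: 'X_{1..n < N}}].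

Lemma bms_uniq N : uniq (bms N).
Proof. by rewrite map_inj_uniq ?enum_uniq //; exact: val_inj. Qed.

Lemma mem_bms N a : (a \in bms N) = (mdeg a < N)%N.
Proof.
apply/mapP/idP => [[h _ ->]|gk]; first exact: bmdeg.
by exists (BMultinom gk); rewrite // mem_enum inE.
Qed.

Lemma big_bms (V : nmodType) N (F : 'X_{1..n} -> V) :
  \sum_(a : 'X_{1..n < N}) F a = \sum_(a <- bms N) F a.
Proof. by rewrite /bms big_map big_enum. Qed.

Lemma big_subseq_perm (V : nmodType) (s t : seq 'X_{1..n}) (F : 'X_{1..n} -> V) :
  uniq s -> uniq t -> {subset s <= t} ->
  \sum_(a <- t) F a = \sum_(a <- s) F a + \sum_(a <- t | a \notin s) F a.
Proof.
move=> us ut st; rewrite -(big_filter t (fun a => a \notin s)) -big_cat; apply: perm_big.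
apply: uniq_perm => //.
  rewrite cat_uniq us filter_uniq // andbT /=.
  by apply/hasPn => a; rewrite mem_filter => /andP[].
move=> a; rewrite mem_cat mem_filter.
by have [/st ->|] := boolP (a \in s).
Qed.

Lemma prod_cst_mdeg (R : comPzSemiRingType) (x : R) (a : 'X_{1..n}) :
  \prod_i x ^+ a i = x ^+ mdeg a.
Proof. by rewrite mdegE; elim/big_rec2: _ => [|i k y _ ->]; rewrite ?expr0 ?exprD. Qed.

End Enumeration.

Section Bounds.
Variables (K : numFieldType) (n : nat).
Implicit Types (c : 'X_{1..n} -> K) (y : 'I_n -> K).

(** Cauchy estimates. Unlike bounded partial sums, they pass termwise to products, slices and
    derivatives; returning to partial sums costs half the radius. *)
Definition cbound c (rho M : K) := forall a, `|c a| * rho ^+ mdeg a <= M.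

Lemma psumE c y N : psum c y N = \sum_(a <- bms n N) c a * \prod_i y i ^+ a i.
Proof. exact: (big_bms N (fun a => c a * \prod_i y i ^+ a i)). Qed.

(* Majorant for the partial sums on the polydisc of radius rho / 2. *)
Definition hsum N : K := \sum_(a <- bms n N) 2^-1 ^+ mdeg a.

Lemma sum_subset_le (s t : seq 'X_{1..n}) (F : 'X_{1..n} -> K) :
  (forall a, 0 <= F a) -> uniq s -> uniq t -> {subset s <= t} ->
  \sum_(a <- s) F a <= \sum_(a <- t) F a.
Proof.
by move=> F0 us ut st; rewrite (big_subseq_perm _ us ut st) lerDl sumr_ge0.
Qed.

Lemma bms_subset N N' : (N <= N')%N -> {subset bms n N <= bms n N'}.
Proof. by move=> NN a; rewrite !mem_bms => /leq_trans; apply. Qed.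

Lemma hsum_le N N' : (N <= N')%N -> hsum N <= hsum N'.
Proof.
move=> NN; apply: sum_subset_le (bms_subset NN); rewrite ?bms_uniq // => a.
by rewrite exprn_ge0 // invr_ge0 ler0n.
Qed.

Lemma hsum_ge0 N : 0 <= hsum N.
Proof. by apply: sumr_ge0 => a _; rewrite exprn_ge0 // invr_ge0 ler0n. Qed.

Lemma geometric_half N : \sum_(k < N) (2^-1 : K) ^+ k <= 2.
Proof.
suff -> : \sum_(k < N) (2^-1 : K) ^+ k = 2 - 2 * 2^-1 ^+ N.
  by rewrite gerBl mulr_ge0 ?ler0n // exprn_ge0 // invr_ge0 ler0n.
elim: N => [|N ih]; first by rewrite big_ord0 expr0 mulr1 subrr.
rewrite big_ord_recr /= ih exprS mulrA divff ?pnatr_eq0 // mul1r.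
ring.
Qed.

(** Multi-indices of degree below [N] embed into the cube of functions to ['I_N], and over the cube
    the sum is the n-th power of a geometric sum, itself at most 2. *)
Lemma hsum_bounded N : hsum N <= 2 ^+ n.
Proof.
pose m (f : {ffun 'I_n -> 'I_N}) : 'X_{1..n} := [multinom f i : nat | i < n].
pose t := [seq m f | f <- enum {: {ffun 'I_n -> 'I_N}}].
have mi : injective m.
  by move=> f g /mnmP fg; apply/ffunP => i; apply/val_inj; have := fg i; rewrite !mnmE.
apply: (@le_trans _ _ (\sum_(a <- t) 2^-1 ^+ mdeg a)).
  apply: sum_subset_le; rewrite ?bms_uniq //.
  - by move=> a; rewrite exprn_ge0 // invr_ge0 ler0n.
  - by rewrite map_inj_uniq ?enum_uniq.
  move=> a; rewrite mem_bms => aN.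
  have ai i : (a i < N)%N.
    by apply: leq_ltn_trans aN; rewrite mdegE (bigD1 i) //= leq_addr.
  apply/mapP; exists [ffun i => Ordinal (ai i)]; first by rewrite mem_enum.
  by apply/mnmP => i; rewrite mnmE ffunE.
rewrite big_map big_enum /=.
under eq_bigr => f _ do rewrite -prod_cst_mdeg.
have -> : \sum_f \prod_i (2^-1 : K) ^+ m f i =
    \sum_(f : {ffun 'I_n -> 'I_N}) \prod_i (2^-1 : K) ^+ f i.
  by apply: eq_bigr => f _; apply: eq_bigr => i _; rewrite mnmE.
rewrite -(bigA_distr_bigA (fun (i : 'I_n) (k : 'I_N) => (2^-1 : K) ^+ k)) /=.
rewrite prodr_const card_ord lerXn2r ?geometric_half ?nnegrE ?ler0n //.
by apply: sumr_ge0 => k _; rewrite exprn_ge0 // invr_ge0 ler0n.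
Qed.

Lemma cbound_ge0 c rho M : 0 <= rho -> cbound c rho M -> 0 <= M.
Proof.
by move=> r0 /(_ 0%MM); apply: le_trans; rewrite mulr_ge0 ?exprn_ge0.
Qed.

Lemma mpow_le y (s : K) (a : 'X_{1..n}) : (forall i, `|y i| <= s) -> `|\prod_i y i ^+ a i| <= s ^+ mdeg a.
Proof.
move=> ys; rewrite normr_prod -prod_cst_mdeg; apply: ler_prod => i _.
by rewrite normr_ge0 normrX lerXn2r ?nnegrE ?(le_trans _ (ys i)).
Qed.

Lemma cbound_term c rho M y a : 0 < rho -> cbound c rho M ->
  (forall i, `|y i| <= rho / 2) ->
  `|c a * \prod_i y i ^+ a i| <= M * 2^-1 ^+ mdeg a.
Proof.
move=> r0 cM yr; rewrite normrM; apply: le_trans (_ : `|c a| * (rho / 2) ^+ mdeg a <= _).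
  by apply: ler_wpM2l => //; exact: mpow_le.
by rewrite exprMn mulrA ler_wpM2r ?cM // exprn_ge0 // invr_ge0 ler0n.
Qed.

(** All tails are measured by the one sequence [hsum], whatever [c] and [y] are; this gives
    uniformity in [y] along with convergence. *)
Lemma psum_diff c rho M y N N' : 0 < rho -> cbound c rho M ->
  (forall i, `|y i| <= rho / 2) -> (N <= N')%N ->
  `|psum c y N' - psum c y N| <= M * (hsum N' - hsum N).
Proof.
move=> r0 cM yr NN; rewrite !psumE /hsum.
have e (F : 'X_{1..n} -> K) : \sum_(a <- bms n N') F a - \sum_(a <- bms n N) F a =
    \sum_(a <- bms n N' | a \notin bms n N) F a.
  rewrite (big_subseq_perm _ (bms_uniq n N) (bms_uniq n N') (bms_subset NN)).
  by rewrite addrAC subrr add0r.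
rewrite !e mulr_sumr; apply: le_trans (ler_norm_sum _ _ _) _.
by apply: ler_sum => a _; exact: (cbound_term a r0 cM yr).
Qed.

Lemma psum_abs_cbound c r M : 0 < r ->
  (forall N, psum (fun a => `|c a|) (fun=> r) N <= M) -> cbound c r M.
Proof.
move=> r0 h a; apply: le_trans (h (mdeg a).+1); rewrite psumE.
rewrite (bigD1_seq a) ?bms_uniq ?mem_bms //= prod_cst_mdeg lerDl.
by apply: sumr_ge0 => b _; rewrite prod_cst_mdeg mulr_ge0 // exprn_ge0 ?ltW.
Qed.

Lemma cbound_psum_abs c rho M : 0 < rho -> cbound c rho M ->
  forall N, psum (fun a => `|c a|) (fun=> rho / 2) N <= M * 2 ^+ n.
Proof.
move=> r0 cM N; have M0 := cbound_ge0 (ltW r0) cM.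
apply: le_trans (_ : M * hsum N <= _); last first.
  by rewrite ler_wpM2l // hsum_bounded.
rewrite psumE /hsum mulr_sumr; apply: ler_sum => a _.
by rewrite prod_cst_mdeg exprMn mulrA ler_wpM2r ?cM // exprn_ge0 // invr_ge0 ler0n.
Qed.

Lemma cbound_shrink c rho rho' M : 0 <= rho' <= rho -> cbound c rho M -> cbound c rho' M.
Proof.
move=> /andP[r0 rr] cM a; apply: le_trans (cM a).
by rewrite ler_wpM2l // lerXn2r ?nnegrE // (le_trans r0).
Qed.

Lemma psum_at0 c N : (0 < N)%N -> psum c (fun=> 0) N = c 0%MM.
Proof.
move=> N0; rewrite psumE (bigD1_seq 0%MM) ?bms_uniq ?mem_bms ?mdeg0 //=.
rewrite prod_cst_mdeg mdeg0 expr0 mulr1 big1 ?addr0 // => a a0.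
by rewrite prod_cst_mdeg expr0n mdeg_eq0 (negbTE a0) mulr0.
Qed.

Lemma psumD c c' y N : psum (fun a => c a + c' a) y N = psum c y N + psum c' y N.
Proof. by rewrite !psumE -big_split; apply: eq_bigr => a _; rewrite /= mulrDl. Qed.

Lemma psumZ k c y N : psum (fun a => k * c a) y N = k * psum c y N.
Proof. by rewrite !psumE mulr_sumr; apply: eq_bigr => a _; rewrite mulrA. Qed.

(* [dser b c] are the coefficients of the b-th derivative of the series [c]. *)
Definition fall (a b : 'X_{1..n}) : nat := (\prod_i (a i + b i) ^_ (b i))%N.
Definition dser (b : 'X_{1..n}) c : 'X_{1..n} -> K := fun a => c (a + b)%MM *+ fall a b.

Lemma dser_dser i b c : dser U_(i)%MM (dser b c) = dser (U_(i) + b)%MM c :> (_ -> K).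
Proof.
apply: boolp.funext => a; rewrite /dser addmA -mulrnA; congr (_ *+ _).
rewrite /fall -big_split; apply: eq_bigr => j _ /=; rewrite !mnmDE mnm1E.
have [_|_] := eqVneq i j; last by rewrite !addn0 add0n ffactn0 muln1.
by rewrite addnA ffactn1 [X in _ = _ ^_ X]add1n ffactnSr addnK.
Qed.

Lemma dser0 c : dser 0%MM c = c.
Proof.
apply: boolp.funext => a; rewrite /dser addm0 /fall big1 // => j _.
by rewrite mnm0E ffactn0.
Qed.

Lemma fall1 a i : fall a U_(i)%MM = (a i).+1.
Proof.
rewrite /fall (bigD1 i) //= mnm1E eqxx addn1 ffactn1 big1 ?muln1 // => j ji.
by rewrite mnm1E eq_sym (negbTE ji) ffactn0.
Qed.

Lemma dser_at0 b c : dser b c 0%MM = c b *+ \prod_i (b i)`!.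
Proof.
rewrite /dser add0m /fall; congr (_ *+ _); apply: eq_bigr => i _.
by rewrite mnm0E add0n ffactnn.
Qed.

Lemma leS_exp2 k : (k.+1 <= 2 ^ k)%N.
Proof.
elim: k => // k ih; rewrite expnS mul2n -addnn -addn1.
by apply: leq_add => //; rewrite expn_gt0.
Qed.

(** Halving the radius gains [2^-1 ^+ m] in degree [m], which absorbs the new factor [(a i).+1] by
    [leS_exp2]. *)
Lemma cbound_dser i c rho M : 0 < rho -> cbound c rho M ->
  cbound (dser U_(i)%MM c) (rho / 2) (M / rho).
Proof.
move=> r0 cM a; rewrite /dser fall1 normrMn ler_pdivlMr //.
have := cM (a + U_(i))%MM; rewrite mdegD mdeg1 addn1 exprSr; apply: le_trans.
set m := mdeg a; set x := `|_|.
rewrite [X in X <= _](_ : _ = x * (rho ^+ m * rho) * ((a i).+1%:R * 2^-1 ^+ m)); last first.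
  by rewrite exprMn -mulr_natr; ring.
rewrite ler_piMr ?mulr_ge0 ?exprn_ge0 ?normr_ge0 ?(ltW r0) //.
rewrite exprVn ler_pdivrMr ?exprn_gt0 ?ltr0n // mul1r -natrX ler_nat.
by apply: leq_trans (leS_exp2 _) _; rewrite leq_exp2l // /m mdegE (bigD1 i) //= leq_addr.
Qed.

Lemma pow_diff1 (u t s : K) k : 0 <= s -> `|u| <= s -> `|t| <= s ->
  s * `|(u + t) ^+ k - u ^+ k| <= `|t| * (2 * s) ^+ k.
Proof.
move=> s0 us ts; elim: k => [|k ih]; first by rewrite !expr0 subrr normr0 !mulr0 mulr1.
have -> : (u + t) ^+ k.+1 - u ^+ k.+1 = u * ((u + t) ^+ k - u ^+ k) + t * (u + t) ^+ k.
  by rewrite !exprS mulrBr mulrDl addrAC.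
apply: le_trans (_ : s * (s * `|(u + t) ^+ k - u ^+ k|) + s * (`|t| * (2 * s) ^+ k) <= _).
  rewrite -mulrDr ler_wpM2l //; apply: le_trans (ler_normD _ _) _.
  rewrite !normrM; apply: lerD; first by rewrite ler_wpM2r.
  rewrite ler_wpM2l // normrX lerXn2r ?nnegrE ?mulr_ge0 ?ler0n //.
  by apply: le_trans (ler_normD _ _) _; rewrite mulr_natl mulr2n lerD.
rewrite exprS [X in _ <= X](_ : _ =
    s * (`|t| * (2 * s) ^+ k) + s * (`|t| * (2 * s) ^+ k)); last by ring.
by rewrite lerD2r ler_wpM2l.
Qed.

(** Second-order Taylor remainder of the k-th power, by induction with [pow_diff1] as first-order
    input; [2 * s] bounds [|u + t|]. Multiplying by [s ^+ 2] avoids a division. *)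
Lemma pow_diff2 (u t s : K) k : 0 <= s -> `|u| <= s -> `|t| <= s ->
  s ^+ 2 * `|(u + t) ^+ k - u ^+ k - t * (u ^+ k.-1 *+ k)| <= `|t| ^+ 2 * (2 * s) ^+ k.
Proof.
move=> s0 us ts; elim: k => [|k ih].
  by rewrite !expr0 subrr mulr0n mulr0 subr0 normr0 mulr0 mulr1 exprn_ge0.
have -> : (u + t) ^+ k.+1 - u ^+ k.+1 - t * (u ^+ k.+1.-1 *+ k.+1) =
   u * ((u + t) ^+ k - u ^+ k - t * (u ^+ k.-1 *+ k)) + t * ((u + t) ^+ k - u ^+ k).
  case: (k) => [|k'] /=; first by rewrite !expr0 !expr1 mulr0n mulr1n; ring.
  rewrite -(mulr_natr (u ^+ k'.+1) k'.+2) -(mulr_natr (u ^+ k') k'.+1).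
  by rewrite -(natr1 k'.+1) !exprS; ring.
set p := (u + t) ^+ k - u ^+ k - _ in ih *; set q := (u + t) ^+ k - u ^+ k.
apply: le_trans (_ : s * (s ^+ 2 * `|p|) + s * (`|t| * (s * `|q|)) <= _).
  rewrite [X in _ <= X](_ : _ = s ^+ 2 * (s * `|p| + `|t| * `|q|)); last first.
    by move: `|p| `|q| `|t| => X Y Z; ring.
  rewrite ler_wpM2l ?exprn_ge0 //; apply: le_trans (ler_normD _ _) _.
  by rewrite !normrM lerD2r ler_wpM2r.
rewrite [(2 * s) ^+ k.+1]exprS [X in _ <= X](_ : _ =
    s * (`|t| ^+ 2 * (2 * s) ^+ k) + s * (`|t| * (`|t| * (2 * s) ^+ k))); last by ring.
by apply: lerD; rewrite ler_wpM2l // ler_wpM2l // pow_diff1.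
Qed.

End Bounds.

Section Derivative.
Variables (K : numFieldType) (n : nat).
Implicit Types (c : 'X_{1..n} -> K) (y : 'I_n -> K).

(** Differentiation lowers degrees by one, hence [N] against [N.+1]; the multi-indices on the right
    that are not of the form [a + U_(i)] have i-th entry 0 and contribute nothing. *)
Lemma psum_dser i c y N :
  psum (dser U_(i)%MM c) y N = \sum_(a <- bms n N.+1)
    c a * ((y i ^+ (a i).-1 *+ a i) * \prod_(j | j != i) y j ^+ a j).
Proof.
rewrite psumE; pose s := [seq (a + U_(i))%MM | a <- bms n N].
have us : uniq s by rewrite map_inj_uniq ?bms_uniq //; exact: addIm.
have ss : {subset s <= bms n N.+1}.
  by move=> _ /mapP[a ha ->]; move: ha; rewrite !mem_bms mdegD mdeg1 addn1.
rewrite (big_subseq_perm _ us (bms_uniq n N.+1) ss) [X in _ = _ + X]big1_seq ?addr0.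
  rewrite [in RHS]big_map; apply: eq_bigr => a _; rewrite /dser fall1 mulrnAl.
  rewrite mnmDE mnm1E eqxx addn1 mulrnAl mulrnAr (bigD1 i) //=; congr (_ * (_ * _) *+ _).
  by apply: eq_bigr => j ji; rewrite mnmDE mnm1E eq_sym (negbTE ji) addn0.
move=> a /andP[ans ain]; suff -> : a i = 0%N by rewrite mulr0n mul0r mulr0.
apply/eqP; apply: contraNT ans => ai.
apply/mapP; exists (a - U_(i))%MM; last by rewrite submK // lep1mP.
move: ain; rewrite !mem_bms -{1}(submK (m := U_(i)%MM) (m' := a)) ?lep1mP //.
by rewrite mdegD mdeg1 addn1 ltnS.
Qed.

(** The error constant does not depend on [N], so the estimate survives the limit. With
    [s = rho / 4] the powers of [2 * s] from [pow_diff2] fit the radius [rho / 2], where [hsum]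
    dominates. *)
Lemma psum_deriv_le i c rho M y t N : 0 < rho -> cbound c rho M ->
  (forall j, `|y j| <= rho / 4) -> `|t| <= rho / 4 ->
  `|psum c (fun j => y j + (if j == i then t else 0)) N.+1 - psum c y N.+1
    - t * psum (dser U_(i)%MM c) y N| <=
  `|t| ^+ 2 * ((rho / 4) ^- 2 * M * 2 ^+ n).
Proof.
move=> r0 cM ys ts; set s := rho / 4; rewrite psum_dser !psumE mulr_sumr -!sumrB.
have s0 : 0 < s by rewrite divr_gt0 ?ltr0n.
have r2 : 2 * s = rho / 2 by rewrite /s; field.
have M0 := cbound_ge0 (ltW r0) cM.
apply: le_trans (ler_norm_sum _ _ _) _.
apply: le_trans (_ : `|t| ^+ 2 * (s ^- 2 * M * hsum K n N.+1) <= _); last first.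
  rewrite ler_wpM2l ?exprn_ge0 // ler_wpM2l ?hsum_bounded //.
  by rewrite mulr_ge0 // invr_ge0 exprn_ge0 // ltW.
rewrite /hsum !mulr_sumr; apply: ler_sum => a _.
set R := \prod_(j | j != i) y j ^+ a j.
have -> : \prod_j (y j + (if j == i then t else 0)) ^+ a j = (y i + t) ^+ a i * R.
  rewrite (bigD1 i) //= eqxx; congr (_ * _); apply: eq_bigr => j /negbTE ->.
  by rewrite addr0.
have -> : \prod_j y j ^+ a j = y i ^+ a i * R by rewrite (bigD1 i).
have -> : c a * ((y i + t) ^+ a i * R) - c a * (y i ^+ a i * R) -
  t * (c a * (y i ^+ (a i).-1 *+ a i * R)) =
  c a * (((y i + t) ^+ a i - y i ^+ a i - t * (y i ^+ (a i).-1 *+ a i)) * R).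
  by move: (_ *+ _) (_ ^+ _) (_ ^+ _) => A B D; ring.
have hR : `|R| <= \prod_(j | j != i) (2 * s) ^+ a j.
  rewrite /R normr_prod; apply: ler_prod => j _; rewrite normr_ge0 normrX /=.
  have ys2 : `|y j| <= 2 * s.
    by apply: le_trans (ys j) _; rewrite -/s mulr_natl mulr2n lerDl ltW.
  by rewrite lerXn2r // nnegrE // (le_trans _ ys2).
have hP := pow_diff2 (a i) (ltW s0) (ys i) ts.
set P := (_ - _ - _ : K) in hP *.
rewrite !normrM -(ler_pM2l (exprn_gt0 2 s0)).
apply: le_trans (_ : `|c a| * (`|t| ^+ 2 * (2 * s) ^+ mdeg a) <= _).
  rewrite mulrCA ler_wpM2l // mulrA.
  have -> : (2 * s) ^+ mdeg a = (2 * s) ^+ a i * \prod_(j | j != i) (2 * s) ^+ a j.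
    by rewrite -prod_cst_mdeg (bigD1 i).
  by rewrite mulrA; apply: ler_pM => //; rewrite mulr_ge0 // exprn_ge0 // ltW.
have -> : s ^+ 2 * (`|t| ^+ 2 * (s ^- 2 * M * 2^-1 ^+ mdeg a)) =
   `|t| ^+ 2 * (M * 2^-1 ^+ mdeg a).
  rewrite mulrCA; congr (_ * _); rewrite -mulrA mulVKf //.
  by rewrite expf_neq0 // gt_eqF.
rewrite mulrCA ler_wpM2l ?exprn_ge0 // r2 exprMn mulrA ler_wpM2r ?cM //.
by rewrite exprn_ge0 // invr_ge0 ler0n.
Qed.

Lemma cboundD c c' rho M M' : cbound c rho M -> cbound c' rho M' -> 0 <= rho ->
  cbound (fun a => c a + c' a) rho (M + M').
Proof.
move=> h h' r0 a; apply: le_trans (lerD (h a) (h' a)).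
by rewrite -mulrDl ler_wpM2r ?exprn_ge0 // ler_normD.
Qed.

Lemma cboundZ k c rho M : cbound c rho M -> cbound (fun a => k * c a) rho (`|k| * M).
Proof. by move=> h a; rewrite normrM -mulrA ler_wpM2l. Qed.

End Derivative.

Section TensorSeries.
Variables (K : numFieldType) (n1 n2 n : nat) (sp : splitting n1 n2 n).

Definition stens (c : 'X_{1..n1} -> K) (c' : 'X_{1..n2} -> K) (e : 'X_{1..n}) : K :=
  c (mproj1 sp e) * c' (mproj2 sp e).

Lemma stens_mjoin c c' a b : stens c c' (mjoin sp a b) = c a * c' b.
Proof. by rewrite /stens mproj1K mproj2K. Qed.

Lemma cbound_stens c c' rho M M' : 0 <= rho -> cbound c rho M -> cbound c' rho M' ->
  cbound (stens c c') rho (M * M').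
Proof.
move=> r0 h h' e; rewrite -(mjoinK sp e) stens_mjoin mdeg_mjoin exprD normrM mulrACA.
by apply: ler_pM => //; rewrite mulr_ge0 ?exprn_ge0.
Qed.

(** The product of the partial sums runs over the pairs with both degrees below [N]. This set lies
    between total degree below [N] and total degree below [N + N]. *)
Lemma psum_stens_le c c' rho M M' y y' N : 0 < rho ->
  cbound c rho M -> cbound c' rho M' ->
  (forall i, `|y i| <= rho / 2) -> (forall i, `|y' i| <= rho / 2) ->
  `|psum c y N * psum c' y' N - psum (stens c c') (fjoin sp y y') N| <=
  M * M' * (hsum K n (N + N) - hsum K n N).
Proof.
move=> r0 cM cM' yr yr'.
pose P := [seq mjoin sp a b | a <- bms n1 N, b <- bms n2 N].
have uP : uniq P.
  apply: allpairs_uniq; rewrite ?bms_uniq // => -[a b] [a' b'] _ _ /=.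
  by move=> /mjoin_inj [-> ->].
have yrj i : `|fjoin sp y y' i| <= rho / 2.
  by case: (sideP sp i) => j; rewrite (fjoin1, fjoin2).
have sP : {subset bms n N <= P}.
  move=> e; rewrite mem_bms -{1}(mjoinK sp e) mdeg_mjoin => h.
  apply/allpairsP; exists (mproj1 sp e, mproj2 sp e); rewrite /= mjoinK !mem_bms.
  by rewrite (leq_ltn_trans _ h) ?leq_addr // (leq_ltn_trans _ h) ?leq_addl.
have sP2 : {subset P <= bms n (N + N)}.
  move=> e /allpairsP[[a b] /=]; rewrite !mem_bms => -[ha hb ->].
  by rewrite mdeg_mjoin; apply: (leq_trans (n := mdeg a + N)); rewrite ?ltn_add2l // leq_add2r ltnW.
rewrite !psumE mulr_suml.
have -> : \sum_(a <- bms n1 N) c a * \prod_i y i ^+ a i *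
    (\sum_(b <- bms n2 N) c' b * \prod_i y' i ^+ b i) =
    \sum_(e <- P) stens c c' e * \prod_i fjoin sp y y' i ^+ e i.
  rewrite big_allpairs_dep; apply: eq_bigr => a _; rewrite mulr_sumr.
  apply: eq_bigr => b _; rewrite stens_mjoin prod_mjoin mulrACA; congr (_ * (_ * _)).
    by apply: eq_bigr => i _; rewrite fjoin1.
  by apply: eq_bigr => i _; rewrite fjoin2.
rewrite (big_subseq_perm _ (bms_uniq n N) uP sP) addrAC subrr add0r.
have sN : {subset bms n N <= bms n (N + N)} by move=> e /sP /sP2.
rewrite /hsum (big_subseq_perm _ (bms_uniq n N) (bms_uniq n (N + N)) sN) addrAC subrr add0r.
rewrite -big_filter -[in X in _ <= X]big_filter mulr_sumr.
apply: le_trans (ler_norm_sum _ _ _) _.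
apply: le_trans (_ : \sum_(e <- [seq e <- P | e \notin bms n N]) M * M' * 2^-1 ^+ mdeg e <= _).
  apply: ler_sum => e _; apply: (cbound_term (rho := rho)) => //.
  by apply: cbound_stens => //; exact: ltW.
apply: sum_subset_le; rewrite ?filter_uniq ?bms_uniq //.
- move=> e; rewrite mulr_ge0 ?exprn_ge0 ?invr_ge0 ?ler0n //.
  by rewrite mulr_ge0 ?(cbound_ge0 (ltW r0) cM) ?(cbound_ge0 (ltW r0) cM').
- by move=> e; rewrite !mem_filter => /andP[-> /sP2].
Qed.

Definition slice (c : 'X_{1..n} -> K) (a : 'X_{1..n1}) : K := c (mjoin sp a 0%MM).

Lemma cbound_slice c rho M : cbound c rho M -> cbound (slice c) rho M.
Proof.
by move=> h a; have := h (mjoin sp a 0%MM); rewrite mdeg_mjoin mdeg0 addn0.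
Qed.

Lemma psum_slice c y N :
  psum c (fjoin sp y (fun=> 0)) N = psum (slice c) y N.
Proof.
pose s := [seq mjoin sp a 0%MM | a <- bms n1 N].
have us : uniq s by rewrite map_inj_uniq ?bms_uniq // => a b /mjoin_inj[].
have ss : {subset s <= bms n N}.
  by move=> _ /mapP[a ha ->]; move: ha; rewrite !mem_bms mdeg_mjoin mdeg0 addn0.
rewrite !psumE (big_subseq_perm _ us (bms_uniq n N) ss) [X in _ + X]big1_seq ?addr0.
  rewrite [in LHS]big_map; apply: eq_bigr => a _; rewrite prod_mjoin [X in _ * (_ * X)]big1 ?mulr1.
    by congr (_ * _); apply: eq_bigr => i _; rewrite fjoin1.
  by move=> i _; rewrite mnm0E expr0.
move=> e /andP[ens eN]; rewrite -(mjoinK sp e) prod_mjoin.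
have e2 : mproj2 sp e != 0%MM.
  apply: contraNneq ens => e2; apply/mapP; exists (mproj1 sp e).
    by move: eN; rewrite -{1}(mjoinK sp e) !mem_bms mdeg_mjoin e2 mdeg0 addn0.
  by rewrite -e2 mjoinK.
rewrite [X in _ * (_ * X)](_ : _ = 0) ?mulr0 //.
have := prod_cst_mdeg (0 : K) (mproj2 sp e); rewrite expr0n mdeg_eq0 (negbTE e2) => h.
by rewrite -[RHS]h; apply: eq_bigr => i _; rewrite fjoin2.
Qed.

Lemma fall_mjoin a b a' b' :
  fall (mjoin sp a b) (mjoin sp a' b') = (fall a a' * fall b b')%N.
Proof.
rewrite /fall (big_side sp) /=.
by congr (_ * _)%N; apply: eq_bigr => i _; rewrite !(mjoin1, mjoin2).
Qed.

Lemma dser_stens c c' a b :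
  dser (mjoin sp a b) (stens c c') = stens (dser a c) (dser b c').
Proof.
apply: boolp.funext => e; rewrite -(mjoinK sp e) /dser stens_mjoin -mjoinD.
by rewrite stens_mjoin fall_mjoin mulrnAl mulrnAr -mulrnA mulnC.
Qed.

Lemma fall0r m (a : 'X_{1..m}) : fall a 0%MM = 1%N.
Proof. by rewrite /fall big1 // => i _; rewrite mnm0E ffactn0. Qed.

Lemma ffact_add k d b : ((k + d) ^_ d * k ^_ b = (k + d) ^_ (d + b))%N.
Proof.
elim: b => [|b ih]; first by rewrite ffactn0 muln1 addn0.
by rewrite addnS !ffactnSr mulnA ih [(k + d)%N]addnC subnDl.
Qed.

Lemma fall_add m (a b d : 'X_{1..m}) : (fall (a + b) d * fall a b)%N = fall a (b + d)%MM.
Proof.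
rewrite /fall -big_split; apply: eq_bigr => i _ /=; rewrite !mnmDE.
by rewrite ffact_add addnA [(d i + b i)%N]addnC.
Qed.

Lemma dserD m (a b : 'X_{1..m}) (c : 'X_{1..m} -> K) : dser a (dser b c) = dser (a + b)%MM c.
Proof.
apply: boolp.funext => e; rewrite /dser -mulrnA fall_add addmA.
by [].
Qed.

Lemma dser_slice a b c :
  dser a (slice (dser (mjoin sp 0%MM b) c)) = slice (dser (mjoin sp a b) c).
Proof.
have -> : mjoin sp a b = (mjoin sp a 0 + mjoin sp 0 b)%MM.
  by rewrite -mjoinD addm0 add0m.
rewrite -dserD; apply: boolp.funext => e.
by rewrite /slice {1 3}/dser -!mjoinD !addm0 fall_mjoin fall0r muln1.
Qed.

(** The factor is b!. Thus differentiating [b] times in the second group and slicing extracts one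
    line of the coefficient array. *)
Lemma slice_dser b c a :
  slice (dser (mjoin sp 0%MM b) c) a = c (mjoin sp a b) *+ fall 0%MM b.
Proof. by rewrite /slice /dser -mjoinD addm0 add0m fall_mjoin fall0r mul1n. Qed.

Lemma fall_gt0 m (a b : 'X_{1..m}) : (0 < fall a b)%N.
Proof. by rewrite /fall prodn_gt0 // => i; rewrite ffact_gt0 leq_addl. Qed.

End TensorSeries.

End WeylTensor.

From mathcomp Require Import polyrcf.
Import Order.TTheory GRing.Theory Num.Theory.
Local Open Scope ring_scope.

(** * Riemann sums of a beta integral *)

Section BetaSums.
Variable R : rcfType.
Implicit Types (k m N i : nat) (s t : R).

Definition beta_coef k m : R := (k`! * m`!)%:R / (k + m)`!%:R.

(** The beta integral through a polynomial primitive; the induction on [k] is integration by parts,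
    trading a factor [1 - 'X] for a factor ['X]. *)
Lemma beta_poly k m : exists2 p : {poly R},
  p^`() = m.+1%:R *: ('X^m * (1 - 'X) ^+ k) & p.[1] - p.[0] = beta_coef k m.+1.
Proof.
elim: k m => [|k ih] m.
  exists 'X^(m.+1); first by rewrite derivXn expr0 mulr1 scaler_nat.
  rewrite !hornerXn expr1n expr0n subr0 /beta_coef mul1n add0n divff //.
  by rewrite pnatr_eq0 -lt0n fact_gt0.
have [p p' p01] := ih m.+1.
have m2 : m.+2%:R != 0 :> R by rewrite pnatr_eq0.
exists ((1 - 'X) ^+ k.+1 * 'X^(m.+1) + (k.+1%:R / m.+2%:R) *: p).
  rewrite derivD derivZ p' derivM derivXn deriv_exp derivB derivX derivC sub0r /=.
  rewrite scalerA divfK // !scaler_nat !exprS.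
  move: ('X^m) ((1 - 'X) ^+ k) => u v.
  ring.
rewrite !hornerE /= subrr !(expr0n, mul0r, mulr0, add0r, add0n) -mulrBr p01.
rewrite /beta_coef addSnnS mulf_div.
have f0 : (k + m.+2)`!%:R != 0 :> R by rewrite pnatr_eq0 -lt0n fact_gt0.
apply/eqP; rewrite eqr_div ?mulf_neq0 //; apply/eqP.
by rewrite !factS !natrM; ring.
Qed.

(** On [s, t] the factor [(1 - x) ^+ k] lies between its values at the endpoints; freezing it there
    leaves a difference with [p] whose derivative has constant sign. *)
Lemma beta_step k m (p : {poly R}) s t :
  p^`() = m.+1%:R *: ('X^m * (1 - 'X) ^+ k) -> 0 <= s -> s <= t -> t <= 1 ->
  (1 - t) ^+ k * (t ^+ m.+1 - s ^+ m.+1) <= p.[t] - p.[s] <=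
  (1 - s) ^+ k * (t ^+ m.+1 - s ^+ m.+1).
Proof.
move=> p' s0 st t1.
have mono (q : {poly R}) : (forall x, x \in `]s, t[ -> 0 <= q^`().[x]) ->
    q.[s] <= q.[t].
  by move=> hq; apply: (ler_hornerW hq) => //; rewrite bound_in_itv.
have dX (c x : R) : (c *: 'X^(m.+1))^`().[x] = m.+1%:R * (x ^+ m * c).
  by rewrite derivZ derivXn hornerZ hornerMn hornerXn -mulr_natl; ring.
have px x : p^`().[x] = m.+1%:R * (x ^+ m * (1 - x) ^+ k).
  by rewrite p' !hornerE.
have pos x : x \in `]s, t[ -> [/\ 0 <= x, s <= x & x <= t].
  rewrite in_itv /= => /andP[sx xt].
  by split; rewrite ?(le_trans s0) // ltW.
apply/andP; split.
  have := mono (p - (1 - t) ^+ k *: 'X^(m.+1)).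
  rewrite !hornerE => h; rewrite -subr_ge0; apply: le_trans (_ : 0 <= _ - _) _.
    rewrite subr_ge0; apply: h => x /pos[x0 sx xt].
    rewrite derivB hornerD hornerN px dX. rewrite -!mulrBr.
    rewrite !mulr_ge0 ?exprn_ge0 ?subr_ge0 // lerXn2r ?nnegrE; clear -x0 sx xt s0 st t1; lra.
  by rewrite le_eqVlt; apply/orP; left; apply/eqP; ring.
have := mono ((1 - s) ^+ k *: 'X^(m.+1) - p).
rewrite !hornerE => h; rewrite -subr_ge0; apply: le_trans (_ : 0 <= _ - _) _.
  rewrite subr_ge0; apply: h => x /pos[x0 sx xt].
  rewrite derivB hornerD hornerN px dX. rewrite -!mulrBr.
  rewrite !mulr_ge0 ?exprn_ge0 ?subr_ge0 // lerXn2r ?nnegrE; clear -x0 sx xt s0 st t1; lra.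
by rewrite le_eqVlt; apply/orP; left; apply/eqP; ring.
Qed.

Section Sums.
Variables (k m N : nat).
Let x i : R := i%:R / N.+1%:R.

(* The last weight is 0 even for k = 0, when (1 - 1)^k = 1. *)
Definition weight i : R := if (i <= N)%N then (1 - i%:R / N.+1%:R) ^+ k else 0.

Lemma weight0 : weight 0 = 1.
Proof. by rewrite /weight mul0r subr0 expr1n. Qed.

Lemma le_weight i : weight i.+1 <= weight i.
Proof.
have h j : (j <= N)%N -> 0 <= 1 - j%:R / N.+1%:R :> R.
  by rewrite subr_ge0 ler_pdivrMr ?ltr0n // mul1r ler_nat => /leqW.
rewrite /weight; case: ltnP => [iN|_].
  rewrite (ltnW iN) lerXn2r ?nnegrE ?h // 1?ltnW // lerD2l lerN2.
  by rewrite ler_pM2r ?invr_gt0 ?ltr0n // ler_nat.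
by case: ifP => // iN; rewrite exprn_ge0 ?h.
Qed.

Lemma sum_weight_by_parts (a b : nat -> R) n :
  \sum_(i < n) (a i - a i.+1) * b i.+1 =
  \sum_(i < n) a i * (b i.+1 - b i) + (a 0%N * b 0%N - a n * b n).
Proof.
elim: n => [|n ih]; first by rewrite !big_ord0 subrr addr0.
by rewrite !big_ord_recr /= ih; ring.
Qed.

(** Abel-summed: drops of the weight times volumes of nested copies, instead of weights times
    volumes of shells. All coefficients are nonnegative and no set difference has to be measured. *)
Definition upper_sum : R :=
  \sum_(i < N.+1) (weight i - weight i.+1) * x i.+1 ^+ m.+1.
Definition lower_sum : R :=
  \sum_(i < N.+1) (weight i - weight i.+1) * x i ^+ m.+1.

Let xN : x N.+1 = 1. Proof. by rewrite /x divff // pnatr_eq0. Qed.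
Let x0 : x 0 = 0. Proof. by rewrite /x mul0r. Qed.
Let wN : weight N.+1 = 0. Proof. by rewrite /weight ltnn. Qed.

Let x_bounds i : (i <= N)%N -> [/\ 0 <= x i, x i <= x i.+1 & x i.+1 <= 1].
Proof.
move=> iN; split; first by rewrite divr_ge0 ?ler0n.
  by rewrite ler_pM2r ?invr_gt0 ?ltr0n // ler_nat.
by rewrite ler_pdivrMr ?ltr0n // mul1r ler_nat.
Qed.

Let horner_telescope (p : {poly R}) :
  p.[1] - p.[0] = \sum_(i < N.+1) (p.[x i.+1] - p.[x i]).
Proof.
rewrite -(big_mkord xpredT (fun i => p.[x i.+1] - p.[x i])).
by rewrite (telescope_sumr (fun i => p.[x i])) // xN x0.
Qed.

(** Summation by parts restores weights times increments; its boundary terms vanish because the last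
    weight and [x 0] are 0. Each term is then the upper bound of [beta_step]. *)
Lemma beta_le_upper : beta_coef k m.+1 <= upper_sum.
Proof.
have [p p' <-] := beta_poly k m.
rewrite /upper_sum (@sum_weight_by_parts weight (fun i => x i ^+ m.+1)).
rewrite wN x0 expr0n mulr0 mul0r subrr addr0 horner_telescope.
apply: ler_sum => i _; have /x_bounds[a b c] : (i <= N)%N by rewrite -ltnS.
by have /andP[_] := beta_step p' a b c; rewrite /weight -ltnS ltn_ord.
Qed.

Lemma lower_le_beta : lower_sum <= beta_coef k m.+1.
Proof.
have [p p' <-] := beta_poly k m.
have -> : lower_sum = \sum_(i < N.+1) weight i.+1 * (x i.+1 ^+ m.+1 - x i ^+ m.+1).
  transitivity (upper_sum - \sum_(i < N.+1)
      (weight i - weight i.+1) * (x i.+1 ^+ m.+1 - x i ^+ m.+1)).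
    by rewrite -sumrB; apply: eq_bigr => i _; ring.
  rewrite /upper_sum (@sum_weight_by_parts weight (fun i => x i ^+ m.+1)).
  rewrite wN x0 expr0n mulr0 mul0r subrr addr0 -sumrB.
  by apply: eq_bigr => i _; ring.
rewrite horner_telescope.
apply: ler_sum => i _; have /x_bounds[a b c] : (i <= N)%N by rewrite -ltnS.
have /andP[h _] := beta_step p' a b c; apply: le_trans h; apply: ler_wpM2r.
  by rewrite subr_ge0 lerXn2r // nnegrE // (le_trans a).
(* At the last index the weight is 0, possibly below the power, which is 1 for [k = 0]; only the
   inequality is used. *)
rewrite /weight; case: ifP => // _.
by rewrite exprn_ge0 // subr_ge0.
Qed.

(** Each increment of the (m+1)-st power on a step of length [1 / N.+1] is at most [m.+1 / N.+1],
    and the drops of the weight add up to 1. *)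
Lemma upper_lower_sum : upper_sum - lower_sum <= m.+1%:R / N.+1%:R.
Proof.
rewrite -sumrB (@le_trans _ _ (\sum_(i < N.+1)
  (weight i - weight i.+1) * (m.+1%:R / N.+1%:R))) //.
  apply: ler_sum => i _; rewrite -mulrBr ler_wpM2l ?subr_ge0 ?le_weight //.
  have /x_bounds[a b c] : (i <= N)%N by rewrite -ltnS.
  have xi1 : x i <= 1 by exact: le_trans c.
  have x1 : 0 <= x i.+1 by exact: le_trans b.
  have -> : x i.+1 ^+ m.+1 - x i ^+ m.+1 =
      (\sum_(j < m.+1) x i.+1 ^+ (m.+1.-1 - j) * x i ^+ j) / N.+1%:R.
    by rewrite subrXX /x -mulrBl -natrB // subSnn mul1r mulrC.
  rewrite ler_wpM2r ?invr_ge0 ?ler0n //.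
  have -> : m.+1%:R = \sum_(j < m.+1) 1 :> R by rewrite sumr_const card_ord.
  by apply: ler_sum => j _; rewrite mulr_ile1 ?exprn_ge0 ?exprn_ile1.
rewrite -mulr_suml.
have -> : \sum_(i < N.+1) (weight i - weight i.+1) = 1.
  rewrite -(big_mkord xpredT (fun i => weight i - weight i.+1)).
  rewrite (@telescope_sumr_eq _ 0 N.+1 (fun i => - weight i)) //.
    by rewrite wN weight0 oppr0 opprK add0r.
  by move=> i _; rewrite opprK addrC.
by rewrite mul1r.
Qed.

End Sums.
End BetaSums.

From mathcomp Require Import finmap complex.
From mathcomp Require Import all_classical all_reals all_analysis.
From mathcomp Require Import measurable_realfun.
Import Order.TTheory GRing.Theory Num.Theory.
Import numFieldNormedType.Exports.
Import WeylTensor.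
Local Open Scope classical_set_scope.
Local Open Scope ring_scope.

#[local] Opaque Weyl.psum.

(** * Solutions of exterior products *)

Section FunctionFamilies.
Variable K : fieldType.

Definition independent (X : Type) m (c : 'I_m -> X -> K) : Prop :=
  forall mu : 'I_m -> K, (forall a, \sum_k mu k * c k a = 0) -> forall k, mu k = 0.

(** Points are added one at a time: for fewer than [m] points some nonzero [mu] is orthogonal to all
    rows so far, and independence provides a point where the combination [mu] does not vanish. *)
Lemma independent_points (X : Type) m (c : 'I_m -> X -> K) :
  independent c -> exists a : 'I_m -> X, \matrix_(i, k) c k (a i) \in unitmx.
Proof.
move=> ci.
suff h r : (r <= m)%N -> exists a : 'I_r -> X, row_free (\matrix_(i, k) c k (a i)).
  have [a ha] := h m (leqnn m); exists a.
  by rewrite -row_free_unit.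
elim: r => [_|r ih rm].
  have a0 : 'I_0 -> X by case.
  by exists a0; apply: inj_row_free => v _; apply/rowP => -[].
have [a ha] := ih (ltnW rm); set A := \matrix_(i, k) _ in ha.
have [mu mu0 muA] : exists2 mu : 'rV_m, mu != 0 & mu *m A^T = 0.
  have : kermx A^T != 0.
    rewrite -mxrank_eq0 mxrank_ker mxrank_tr; move/eqP: ha => ->.
    by rewrite -lt0n subn_gt0.
  by move=> /rowV0Pn [v /sub_kermxP v0 vn]; exists v.
have [b hb] : exists b, \sum_k mu 0 k * c k b != 0.
  apply/not_existsP => hn; case/eqP: mu0; apply/rowP => k; rewrite mxE.
  by apply: (ci (fun k => mu 0 k)) => x; apply/eqP; rewrite -[_ == _]negbK; apply/negP/hn.
pose a' (i : 'I_(r + 1)) := match fintype.split i with inl j => a j | inr _ => b end.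
rewrite -[r.+1]addn1; exists a'; apply: inj_row_free => v hv.
have e : \matrix_(i, k) c k (a' i) = col_mx A (\row_k c k b).
  apply/matrixP => i k; rewrite mxE /a'; case: (split_ordP i) => j ->.
    by rewrite col_mxEu mxE.
  by rewrite col_mxEd mxE.
move: hv; rewrite e -[v]hsubmxK mul_row_col => hv.
have r0 : rsubmx v = 0.
  (* Pairing with [mu] kills the old rows and isolates the coefficient of the new one. *)
  have : (lsubmx v *m A + rsubmx v *m \row_k c k b) *m mu^T = 0 by rewrite hv mul0mx.
  rewrite mulmxDl -mulmxA -[A]trmxK -trmx_mul muA trmx0 mulmx0 add0r.
  rewrite [rsubmx v]mx11_scalar mul_scalar_mx -scalemxAl.
  move=> /matrixP/(_ 0 0); rewrite !mxE => /eqP; rewrite mulf_eq0.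
  have -> : \sum_j (\row_k c k b) 0 j * mu^T j 0 = \sum_k mu 0 k * c k b.
    by apply: eq_bigr => k _; rewrite !mxE mulrC.
  rewrite (negbTE hb) orbF => /eqP v0.
  by rewrite v0 raddf0.
move: hv; rewrite r0 mul0mx addr0 => /eqP; rewrite mulmx_free_eq0 // => /eqP ->.
by rewrite row_mx0.
Qed.

(** At the points of [independent_points] the coefficients of [D(., y)] are obtained by inverting a
    matrix. They are combinations of the finitely many [D (a i) y], hence of the [e j y]. *)
Lemma bilinear_span (X Y : Type) m p (c : 'I_m -> X -> K) (e : 'I_p -> Y -> K)
    (D : X -> Y -> K) : independent c ->
  (forall y, exists l : 'I_m -> K, forall x, D x y = \sum_k l k * c k x) ->
  (forall x, exists l : 'I_p -> K, forall y, D x y = \sum_j l j * e j y) ->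
  exists L : 'I_m -> 'I_p -> K,
    forall x y, D x y = \sum_k \sum_j L k j * (c k x * e j y).
Proof.
move=> /independent_points[a aU] hc he.
set A := \matrix_(i, k) _ in aU.
have [l hl] := choice (fun i => he (a i)).
exists (fun k j => \sum_i invmx A k i * l i j) => x y.
have [mu hmu] := hc y; rewrite hmu; apply: eq_bigr => k _.
have -> : mu k = \sum_i invmx A k i * D (a i) y.
  have : invmx A *m (A *m \col_k mu k) = \col_k mu k by rewrite mulKmx.
  move=> /matrixP/(_ k 0); rewrite [RHS]mxE => <-; rewrite mxE; apply: eq_bigr => i _.
  rewrite hmu mxE; congr (_ * _); apply: eq_bigr => k' _; rewrite !mxE.
  exact: mulrC.
rewrite mulr_suml; under eq_bigr do rewrite hl mulr_sumr mulr_suml.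
rewrite exchange_big; apply: eq_bigr => j _; rewrite mulr_suml; apply: eq_bigr => i _.
by rewrite -!mulrA; congr (_ * (_ * _)); rewrite mulrC.
Qed.

Lemma bilinear_independent (X Y : Type) m p (c : 'I_m -> X -> K) (e : 'I_p -> Y -> K)
    (L : 'I_m -> 'I_p -> K) : independent c -> independent e ->
  (forall x y, \sum_k \sum_j L k j * (c k x * e j y) = 0) -> forall k j, L k j = 0.
Proof.
move=> hc he h k j.
apply: (he (fun j => L k j)) => y.
apply: (hc (fun k => \sum_j L k j * e j y)) => x.
rewrite -[RHS](h x y); apply: eq_bigr => k' _; rewrite mulr_suml.
by apply: eq_bigr => j' _; rewrite -mulrA [e _ _ * _]mulrC.
Qed.

(** Independence makes the matrix of coefficients row free, so it has at most as many rows as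
    columns. *)
Lemma independent_le (X : Type) m p (c : 'I_m -> X -> K) (c' : 'I_p -> X -> K) :
  independent c ->
  (forall k, exists l : 'I_p -> K, forall a, c k a = \sum_j l j * c' j a) ->
  (m <= p)%N.
Proof.
move=> hc /choice[l hl].
suff /eqP <- : row_free (\matrix_(k, j) l k j) by exact: rank_leq_col.
apply: inj_row_free => v hv; apply/rowP => k; rewrite mxE.
apply: (hc (fun k => v 0 k)) => a.
under eq_bigr do rewrite hl mulr_sumr.
rewrite exchange_big big1 // => j _.
under eq_bigr do rewrite mulrA.
rewrite -mulr_suml; move/rowP: hv => /(_ j); rewrite !mxE => hv.
by rewrite [X in X * _](_ : _ = 0) ?mul0r // -[RHS]hv; apply: eq_bigr => i _; rewrite mxE.
Qed.

End FunctionFamilies.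

(** * Convergence of dominated complex sequences *)

Section ComplexSequences.
Variable R : realType.
Local Notation C := (Cplx R).
Local Notation real_C x := (real_complex R x : C).
Local Notation ii := (Complex 0 1 : C).

Lemma real_pos_C (e : C) : 0 < e -> exists2 r : R, 0 < r & e = real_C r.
Proof.
rewrite ltcE /= => /andP[/eqP h1 h2]; exists (complex.Re e) => //.
by rewrite [LHS]complexE h1 mulr0 addr0.
Qed.

Lemma real_ge0_C (e : C) : 0 <= e -> exists2 r : R, 0 <= r & e = real_C r.
Proof.
rewrite lecE /= => /andP[/eqP h1 h2]; exists (complex.Re e) => //.
by rewrite [LHS]complexE h1 mulr0 addr0.
Qed.

Lemma norm_real_C (r : R) : `|real_C r| = real_C `|r|.
Proof. by rewrite normc_def /= expr0n addr0 sqrtr_sqr. Qed.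

Lemma normRe_le (z : C) (r : R) : `|z| <= real_C r -> `|complex.Re z| <= r.
Proof.
rewrite normc_def lecR; apply: le_trans.
by rewrite -sqrtr_sqr ler_wsqrtr // lerDl sqr_ge0.
Qed.

Lemma normIm_le (z : C) (r : R) : `|z| <= real_C r -> `|complex.Im z| <= r.
Proof.
rewrite normc_def lecR; apply: le_trans.
by rewrite -sqrtr_sqr ler_wsqrtr // lerDr sqr_ge0.
Qed.

Lemma norm_ReIm_le (z : C) : `|z| <= real_C (`|complex.Re z| + `|complex.Im z|).
Proof.
rewrite {1}[z]complexE rmorphD /=; apply: le_trans (ler_normD _ _) _.
rewrite normrM !norm_real_C lerD2l.
by rewrite (_ : `|_| = 1) ?mul1r // normc_def /= expr0n expr1n add0r sqrtr1.
Qed.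

Lemma cvg_C (u : nat -> C) (a b : R) :
  (fun N => complex.Re (u N)) @ \oo --> a -> (fun N => complex.Im (u N)) @ \oo --> b ->
  u @ \oo --> (real_C a + ii * real_C b : C).
Proof.
move=> ha hb; apply/cvgrPdist_le => e /real_pos_C[r r0 ->].
have r2 : 0 < r / 2 by rewrite divr_gt0.
have /cvgrPdist_le/(_ _ r2) ha2 := ha; have /cvgrPdist_le/(_ _ r2) hb2 := hb.
near=> N; apply: le_trans (norm_ReIm_le _) _; rewrite lecR.
have e1 : complex.Re (real_C a + ii * real_C b - u N) = a - complex.Re (u N).
  by case: (u N) => x y /=; rewrite !(mul0r, mul1r, mulr0, subr0, addr0, oppr0, sub0r).
have e2 : complex.Im (real_C a + ii * real_C b - u N) = b - complex.Im (u N).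
  by case: (u N) => x y /=; rewrite !(mul0r, mul1r, mulr0, subr0, addr0, add0r, oppr0, sub0r).
rewrite e1 e2 [leRHS](splitr r); apply: lerD.
  by near: N.
by near: N.
Unshelve. all: by end_near. Qed.

Lemma hsum_C n N : hsum C n N = real_C (hsum R n N).
Proof.
rewrite /hsum rmorph_sum; apply: eq_bigr => a _.
by rewrite rmorphXn fmorphV rmorph_nat.
Qed.

Lemma hsum_cvg n : cvgn (hsum R n).
Proof.
apply: nondecreasing_is_cvgn => [i j|]; first exact: hsum_le.
by exists (2 ^+ n) => _ [N _ <-]; exact: hsum_bounded.
Qed.

Lemma hsum_tail n (M e : C) : 0 <= M -> 0 < e -> exists N0, forall N N', (N0 <= N)%N ->
  (N <= N')%N -> M * (hsum C n N' - hsum C n N) <= e.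
Proof.
move=> /real_ge0_C[m m0 ->] /real_pos_C[r r0 ->].
have m1 : 0 < m + 1 by rewrite ltr_wpDl.
have e0 : 0 < r / (m + 1) by rewrite divr_gt0.
have /cvgrPdist_le/(_ _ e0) [N0 _ h] := @hsum_cvg n.
exists N0 => N N' NN NN'; rewrite !hsum_C -rmorphB -rmorphM /= lecR.
have h1 : hsum R n N' - hsum R n N <= r / (m + 1).
  apply: le_trans (h N NN); rewrite ler_normr; apply/orP; left.
  by rewrite lerD2r; apply: nondecreasing_cvgn_le (@hsum_cvg n) _ => i j; exact: hsum_le.
have h0 : 0 <= hsum R n N' - hsum R n N by rewrite subr_ge0 hsum_le.
apply: le_trans (_ : (m + 1) * (hsum R n N' - hsum R n N) <= _).
  by rewrite ler_wpM2r // lerDl.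
by rewrite mulrC -ler_pdivlMr.
Qed.

(** Adding [m * hsum] turns [u] into a nondecreasing bounded sequence, and [hsum] itself
    converges. *)
Lemma dominated_cvg (u : nat -> R) n (m : R) : 0 <= m ->
  (forall N N', (N <= N')%N -> `|u N' - u N| <= m * (hsum R n N' - hsum R n N)) ->
  cvgn u.
Proof.
move=> m0 h; pose v N := u N + m * hsum R n N.
have cv : cvgn v.
  apply: nondecreasing_is_cvgn => [i j ij|].
    rewrite -subr_ge0 /v opprD addrACA -mulrBr -lerBlDr sub0r.
    by have := h _ _ ij; rewrite ler_norml => /andP[].
  exists (u 0%N + m * 2 ^+ n + m * 2 ^+ n) => _ [N _ <-]; rewrite /v.
  have b N' : m * hsum R n N' <= m * 2 ^+ n by rewrite ler_wpM2l // hsum_bounded.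
  rewrite lerD // -lerBlDl; apply: le_trans (ler_norm _) _; apply: le_trans (h _ _ _) _ => //.
  by rewrite mulrBr; apply: le_trans (b N); rewrite gerBl mulr_ge0 // hsum_ge0.
have -> : u = v \- (fun N => m * hsum R n N) by apply/funext => N; rewrite /v /= addrK.
by apply: is_cvgB => //; apply: is_cvgMl_tmp; exact: hsum_cvg.
Qed.

Variable n : nat.
Implicit Types (c : Weyl.mindex n -> C) (y : 'I_n -> C).

Lemma psum_cvg c rho M y : 0 < rho -> cbound c rho M ->
  (forall i, `|y i| <= rho / 2) -> exists l : C, Weyl.psum c y @ \oo --> l.
Proof.
move=> r0 cM yr; have M0 := cbound_ge0 (ltW r0) cM.
have h := psum_diff r0 cM yr; have [m m0 mE] := real_ge0_C M0.
have h' N N' : (N <= N')%N ->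
    `|Weyl.psum c y N' - Weyl.psum c y N| <= real_C (m * (hsum R n N' - hsum R n N)).
  by move=> NN; rewrite rmorphM rmorphB /= -!hsum_C -mE; exact: h.
have /cvg_ex[a ha] : cvgn (fun N => complex.Re (Weyl.psum c y N)).
  apply: (dominated_cvg (n := n) m0) => N N' /h' /normRe_le.
  by case: (Weyl.psum c y N) => ? ?; case: (Weyl.psum c y N').
have /cvg_ex[b hb] : cvgn (fun N => complex.Im (Weyl.psum c y N)).
  apply: (dominated_cvg (n := n) m0) => N N' /h' /normIm_le.
  by case: (Weyl.psum c y N) => ? ?; case: (Weyl.psum c y N').
by exists (real_C a + ii * real_C b : C); exact: cvg_C.
Qed.

Lemma cvg_norm_le (u : nat -> C) (l b : C) N0 : u @ \oo --> l ->
  (forall N, (N0 <= N)%N -> `|u N| <= b) -> `|l| <= b.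
Proof.
move=> /cvgrPdist_lt ul ub; have bN0 := ub N0 (leqnn _).
have b0 : 0 <= b by apply: le_trans bN0.
(* The order on the complex numbers is partial; [b] is nonnegative, hence real, so the failure of
   [<=] is a strict inequality. *)
rewrite real_leNgt ?normr_real ?ger0_real //; apply/negP => lb.
have e0 : 0 < `|l| - b by rewrite subr_gt0.
have [N1 _ h] := ul _ e0; have := h (maxn N0 N1) (leq_maxr _ _).
have := ub (maxn N0 N1) (leq_maxl _ _) => h1 h2.
have : `|l| < `|l|.
  apply: le_lt_trans (_ : `|l - u (maxn N0 N1)| + `|u (maxn N0 N1)| < _).
    by rewrite -{1}(subrK (u (maxn N0 N1)) l) ler_normD.
  by rewrite -ltrBrDr; apply: (lt_le_trans h2); rewrite lerD2l lerN2.
by rewrite ltxx.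
Qed.

Lemma psum_tail c rho M y (l e : C) : 0 < rho -> cbound c rho M ->
  (forall i, `|y i| <= rho / 2) -> Weyl.psum c y @ \oo --> l ->
  forall N, (forall N', (N <= N')%N -> M * (hsum C n N' - hsum C n N) <= e) ->
  `|l - Weyl.psum c y N| <= e.
Proof.
move=> r0 cM yr cl N hN.
have h : (fun N' => Weyl.psum c y N' - Weyl.psum c y N) @ \oo --> l - Weyl.psum c y N.
  by apply: (cvgB cl); exact: cvg_cst.
apply: (cvg_norm_le (N0 := N) h) => N' NN.
exact: le_trans (psum_diff r0 cM yr NN) (hN _ NN).
Qed.

End ComplexSequences.

(** * Taylor expansions of holomorphic germs *)

Section PowerSeries.
Variables (R : realType).
Local Notation C := (Cplx R).

Lemma nearP n (p : 'rV[C]_n) (P : 'rV[C]_n -> Prop) :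
  (\forall x \near p, P x) <->
  exists2 e : C, 0 < e & forall x : 'rV[C]_n, (forall i, `|x 0 i - p 0 i| < e) -> P x.
Proof.
split=> [/nbhs_ballP[e /= e0 h]|[e e0 h]].
  exists e => // x xe; apply: h; split=> // i j; rewrite ord1 /ball /= distrC; exact: xe.
apply/nbhs_ballP; exists e => //= x xe; apply: h => i.
by have [_ /(_ 0 i)] := xe; rewrite /ball /= distrC.
Qed.

Section OneSpace.
Variable n : nat.
Implicit Types (f g : 'rV[C]_n -> C) (p x : 'rV[C]_n) (c : Weyl.mindex n -> C).

(* [c] are the Taylor coefficients of [f] at [p], and they converge. *)
Definition hasser f p c : Prop :=
  (exists rho M, 0 < rho /\ cbound c rho M) /\
  \forall x \near p, Weyl.psum c ((x - p) 0) @ \oo --> f x.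

Lemma holomorphic_hasser f p : holomorphic_at p f <-> exists c, hasser f p c.
Proof.
split=> [[c [r [r0 [M cM] h]]]|[c [[rho [M [r0 cM]]] h]]].
  by exists c; split=> //; exists r, M; split=> //; exact: psum_abs_cbound.
exists c, (rho / 2); split=> //; first by rewrite divr_gt0.
by exists (M * 2 ^+ n); exact: cbound_psum_abs.
Qed.

Lemma near_polydisc p (e : C) : 0 < e -> \forall x \near p, forall i, `|(x - p) 0 i| <= e.
Proof.
by move=> e0; apply/nearP; exists e => // x xe i; rewrite !mxE ltW.
Qed.

Lemma hasser_eq f g p c : hasser f p c -> hasser g p c -> \forall x \near p, f x = g x.
Proof.
move=> [_ hf] [_ hg]; near=> x.
exact: (cvg_unique _ (near hf x _) (near hg x _)).
Unshelve. all: by end_near. Qed.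

Lemma hasser_ext f g p c : (\forall x \near p, f x = g x) -> hasser f p c -> hasser g p c.
Proof.
move=> fg [h hf]; split; first exact: h.
near=> x.
have <- : f x = g x by exact: (near fg x _).
exact: (near hf x _).
Unshelve. all: by end_near. Qed.

Lemma hasser_at f p c : hasser f p c -> f p = c (@mpoly.mnm0 n).
Proof.
move=> [_ /nbhs_singleton]; rewrite subrr => h.
have e : (0 : 'rV[C]_n) 0 = fun=> 0 by apply/funext => i; rewrite mxE.
rewrite e in h; apply: (cvg_unique _ h); first exact: norm_hausdorff.
change (Weyl.psum c (fun=> 0) @ \oo --> c (@mpoly.mnm0 n)).
apply/cvgrPdist_le => eps e0; exists 1%N => // N /= N0.
by rewrite psum_at0 // subrr normr0 ltW.
Qed.

Lemma hasserD f g p c c' : hasser f p c -> hasser g p c' ->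
  hasser (fun x => f x + g x) p (fun a => c a + c' a).
Proof.
move=> [[r [M [r0 cM]]] hf] [[r' [M' [r0' cM']]] hg]; split.
  pose s := Num.min r r'.
  (* Positive complex numbers are real and thus comparable, so their minimum is a common radius. *)
  have cmp : r >=< r' by apply: real_comparable; exact: gtr0_real.
  have s0 : 0 < s by rewrite /s comparable_lt_min ?r0.
  exists s, (M + M'); split=> //; apply: cboundD; last exact: ltW.
    by apply: cbound_shrink cM; rewrite ltW //= /s comparable_ge_min // lexx.
  by apply: cbound_shrink cM'; rewrite ltW //= /s comparable_ge_min // lexx orbT.
near=> x.
have -> : Weyl.psum (fun a => c a + c' a) ((x - p) 0) =
  (fun N => Weyl.psum c ((x - p) 0) N + Weyl.psum c' ((x - p) 0) N).
  by apply/funext => N; rewrite psumD.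
exact: (cvgD (near hf x _) (near hg x _)).
Unshelve. all: by end_near. Qed.

Lemma hasserZ k f p c : hasser f p c -> hasser (fun x => k * f x) p (fun a => k * c a).
Proof.
move=> [[r [M [r0 cM]]] hf]; split.
  by exists r, (`|k| * M); split=> //; exact: cboundZ.
near=> x.
have -> : Weyl.psum (fun a => k * c a) ((x - p) 0) =
  (fun N => k * Weyl.psum c ((x - p) 0) N).
  by apply/funext => N; rewrite psumZ.
exact: (cvgMl_tmp (near hf x _)).
Unshelve. all: by end_near. Qed.

Lemma hasser0 p : hasser (fun=> 0) p (fun=> 0).
Proof.
split; first by exists 1, 0; split=> // a; rewrite normr0 mul0r.
near=> x; have -> : Weyl.psum (fun=> 0) ((x - p) 0) = fun=> 0.
  by apply/funext => N; rewrite psumE big1 // => a _; rewrite mul0r.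
exact: cvg_cst.
Unshelve. all: by end_near. Qed.

Lemma hasser_sum (I : Type) (r : seq I) (F : I -> 'rV[C]_n -> C) p
    (c : I -> Weyl.mindex n -> C) :
  (forall i, hasser (F i) p (c i)) ->
  hasser (fun x => \sum_(i <- r) F i x) p (fun a => \sum_(i <- r) c i a).
Proof.
move=> h; elim: r => [|i r ih].
  have -> : (fun x => \sum_(i <- [::]) F i x) = fun=> 0 by apply/funext => x; rewrite big_nil.
  have -> : (fun a => \sum_(i <- [::]) c i a) = fun=> 0 by apply/funext => x; rewrite big_nil.
  exact: hasser0.
have -> : (fun x => \sum_(j <- i :: r) F j x) = fun x => F i x + \sum_(j <- r) F j x.
  by apply/funext => x; rewrite big_cons.
have -> : (fun a => \sum_(j <- i :: r) c j a) = fun a => c i a + \sum_(j <- r) c j a.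
  by apply/funext => x; rewrite big_cons.
exact: (hasserD (h i) ih).
Qed.

(** Termwise differentiation: the bound of [psum_deriv_le] passes to the limit in [N] and makes the
    difference quotient of [f] differ from the derived series by at most [K |t|]. The radius [e / 2]
    keeps both [x] and its translate where the series represents [f]. *)
Lemma hasser_partial i f p c : hasser f p c ->
  hasser (partial i f) p (dser (mpoly.mnm1 i) c).
Proof.
move=> [[rho [M [r0 cM]]] /nearP[e e0 hf]].
have M0 := cbound_ge0 (ltW r0) cM.
have r2 : 0 < rho / 2 by rewrite divr_gt0.
have cM' := cbound_dser i r0 cM.
split; first by exists (rho / 2), (M / rho).
have r24 : rho / 2 / 2 = rho / 4 by field.
have r4 : 0 < rho / 4 by rewrite divr_gt0.
have e2 : 0 < e / 2 by rewrite divr_gt0.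
near=> x.
have xr : forall j, `|(x - p) 0 j| <= rho / 4.
  by near: x; exact: near_polydisc.
have xe : forall j, `|x 0 j - p 0 j| < e / 2.
  by near: x; apply/nearP; exists (e / 2).
have [g hg] : exists l : C, Weyl.psum (dser (mpoly.mnm1 i) c) ((x - p) 0) @ \oo --> l.
  by apply: (psum_cvg r2 cM') => j; rewrite r24.
suff -> : partial i f x = g by [].
have fx : Weyl.psum c ((x - p) 0) @ \oo --> f x.
  apply: hf => j; apply: lt_trans (xe j) _.
  by rewrite ltr_pdivrMr // mulr_natr mulr2n ltrDl.
pose K := (rho / 4) ^- 2 * M * 2 ^+ n.
have K0 : 0 <= K.
  by rewrite /K mulr_ge0 ?exprn_ge0 // mulr_ge0 // invr_ge0 exprn_ge0 // ltW.
have key t : `|t| <= rho / 4 -> `|t| < e / 2 ->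
    `|f (t *: delta_mx 0 i + x) - f x - t * g| <= `|t| ^+ 2 * K.
  move=> tr te; pose y' j := (x - p) 0 j + (if j == i then t else 0).
  have y'E : ((t *: delta_mx 0 i + x - p) 0 : 'I_n -> C) = y'.
    apply/funext => j; rewrite /y' !mxE eqxx /=.
    by case: (j == i); rewrite /= ?mulr1n ?mulr0n; ring.
  have fx' : Weyl.psum c y' @ \oo --> f (t *: delta_mx 0 i + x).
    rewrite -y'E; apply: hf => j; rewrite !mxE eqxx /= -addrA.
    apply: le_lt_trans (ler_normD _ _) _; rewrite [e]splitr; apply: ler_ltD => //.
    by case: eqP => _; rewrite ?mulr1 ?mulr0 ?normr0 ltW.
  apply: (@cvg_norm_le _ (fun N => Weyl.psum c y' N.+1 - Weyl.psum c ((x - p) 0) N.+1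
      - t * Weyl.psum (dser (mpoly.mnm1 i) c) ((x - p) 0) N) _ _ 0%N); last first.
    by move=> N _; exact: psum_deriv_le.
  have sh (u : nat -> C) (l : C) : u @ \oo --> l -> (fun N => u N.+1) @ \oo --> l.
    by move=> ul; move: ul; rewrite -cvg_shiftS.
  exact: (cvgB (cvgB (sh _ _ fx') (sh _ _ fx)) (cvgMl_tmp (a := t) hg)).
rewrite /partial; apply: cvg_lim; first exact: norm_hausdorff.
apply/cvgrPdist_le => eps eps0.
have eK : 0 < eps / (K + 1) by rewrite divr_gt0 // ltr_wpDl.
near=> h.
have h0 : h != 0 by near: h; exact: nbhs_dnbhs_neq.
have hr : `|h| <= rho / 4 by near: h; exact: dnbhs0_le.
have he : `|h| < e / 2 by near: h; exact: dnbhs0_lt.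
have hK : `|h| <= eps / (K + 1) by near: h; exact: dnbhs0_le.
have := key h hr he; rewrite /= => kh.
have -> : g - h^-1 *: (f (h *: delta_mx 0 i + x) - f x) =
   - h^-1 * (f (h *: delta_mx 0 i + x) - f x - h * g).
  by rewrite mulNr mulrBr mulKf // opprB.
rewrite normrM normrN normfV ler_pdivrMl ?normr_gt0 //.
apply: le_trans kh _; rewrite expr2 -mulrA ler_wpM2l //.
apply: le_trans (_ : eps / (K + 1) * K <= _); first by rewrite ler_wpM2r.
by rewrite mulrAC ler_pdivrMr ?ltr_wpDl // ler_pM2l // lerDl.
Unshelve. all: by end_near. Qed.

Lemma hasser_iter_partials (a : Weyl.mindex n) f p c : hasser f p c ->
  hasser (Weyl.iter_partials (@partial R n) a f) p (dser a c).
Proof.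
move=> hf; rewrite /Weyl.iter_partials.
(* The induction needs an arbitrary list of variables in place of [enum]; the exponent is then the
   matching sum of unit multi-indices. *)
suff h (s : seq 'I_n) : hasser (foldr (fun i => iter (mpoly.fun_of_multinom a i) (@partial R n i)) f s) p
    (dser (\big[(@mpoly.mnm_add n)/(@mpoly.mnm0 n)]_(i <- s) mpoly.mnm_muln (mpoly.mnm1 i) (mpoly.fun_of_multinom a i)) c).
  rewrite {2}(mpoly.multinomUE_id a).
  have -> : enum 'I_n = index_enum 'I_n by rewrite enumT.
  exact: h.
elim: s => [|i s ih]; first by rewrite big_nil dser0.
rewrite big_cons /=; elim: (mpoly.fun_of_multinom a i) => [|k ihk]; first by rewrite mpoly.mulm0n mpoly.add0m.
rewrite iterS mpoly.mulmS -mpoly.addmA -dser_dser.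
exact: hasser_partial.
Qed.

(** The value at [p] of the a-th derivative is the a-th coefficient times a!, which is invertible in
    characteristic 0. *)
Lemma hasser_uniq f p c c' : hasser f p c -> hasser f p c' -> c = c'.
Proof.
move=> h h'; apply/funext => a.
have := hasser_at (hasser_iter_partials a h).
rewrite (hasser_at (hasser_iter_partials a h')) !dser_at0.
move=> /eqP; rewrite -subr_eq0 -mulrnBl mulrn_eq0 subr_eq0 => /orP[|/eqP ->//].
by rewrite eqn0Ngt prodn_gt0 // => k; exact: fact_gt0.
Qed.

Lemma continuous_at_sum (I : Type) (r : seq I) (F : I -> 'rV[C]_n -> C) p :
  (forall i, F i x @[x --> p] --> F i p) ->
  \sum_(i <- r) F i x @[x --> p] --> \sum_(i <- r) F i p.
Proof.
move=> h; elim: r => [|i r ih].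
  have -> : (fun x => \sum_(i <- [::]) F i x) = fun=> 0 by apply/funext => x; rewrite big_nil.
  by rewrite big_nil; exact: (@cvg_cst C _ _ (nbhs p) (nbhs_filter p)).
have -> : (fun x => \sum_(j <- i :: r) F j x) = fun x => F i x + \sum_(j <- r) F j x.
  by apply/funext => x; rewrite big_cons.
by rewrite big_cons; exact: (@cvgD _ _ _ (nbhs p) (nbhs_filter p) _ _ _ _ (h i) ih).
Qed.

Lemma continuous_at_prod (I : Type) (r : seq I) (F : I -> 'rV[C]_n -> C) p :
  (forall i, F i x @[x --> p] --> F i p) ->
  \prod_(i <- r) F i x @[x --> p] --> \prod_(i <- r) F i p.
Proof.
move=> h; elim: r => [|i r ih].
  have -> : (fun x => \prod_(i <- [::]) F i x) = fun=> 1 by apply/funext => x; rewrite big_nil.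
  by rewrite big_nil; exact: (@cvg_cst C _ _ (nbhs p) (nbhs_filter p)).
have -> : (fun x => \prod_(j <- i :: r) F j x) = fun x => F i x * \prod_(j <- r) F j x.
  by apply/funext => x; rewrite big_cons.
by rewrite big_cons; exact: (@cvgM _ _ (nbhs p) (nbhs_filter p) _ _ _ _ (h i) ih).
Qed.

Lemma continuous_at_exp (f : 'rV[C]_n -> C) p k :
  f x @[x --> p] --> f p -> f x ^+ k @[x --> p] --> f p ^+ k.
Proof.
move=> h; elim: k => [|k ih]; first by rewrite expr0; exact: (@cvg_cst C _ _ (nbhs p) (nbhs_filter p)).
have -> : (fun x => f x ^+ k.+1) = fun x => f x * f x ^+ k.
  by apply/funext => x; rewrite exprS.
by rewrite exprS; exact: (@cvgM _ _ (nbhs p) (nbhs_filter p) _ _ _ _ h ih).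
Qed.

(** One partial sum, a polynomial, approximates [f] within [eps / 3] on a whole polydisc. Continuity
    is needed at all points near [p], not just at [p]. *)
Lemma hasser_continuous f p c : hasser f p c ->
  \forall x \near p, {for x, continuous f}.
Proof.
move=> [[rho [M [r0 cM]]] /nearP[e e0 hf]].
have M0 := cbound_ge0 (ltW r0) cM.
have e2 : 0 < e / 2 by rewrite divr_gt0.
have r4 : 0 < rho / 4 by rewrite divr_gt0.
near=> x0.
have xr : forall j, `|(x0 - p) 0 j| <= rho / 4.
  by near: x0; exact: near_polydisc.
have xe : forall j, `|x0 0 j - p 0 j| < e / 2.
  by near: x0; apply/nearP; exists (e / 2).
apply: (proj2 (@cvgrPdist_le _ _ _ (nbhs x0) (nbhs_filter x0) f (f x0))) => eps eps0.
have eps3 : 0 < eps / 3 by rewrite divr_gt0.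
have [N hN] := hsum_tail n M0 eps3.
have hN' N' : (N <= N')%N -> M * (hsum C n N' - hsum C n N) <= eps / 3.
  by move=> NN; exact: hN.
have cont : {for x0, continuous (fun x : 'rV[C]_n => Weyl.psum c ((x - p) 0) N)}.
  have -> : (fun x : 'rV[C]_n => Weyl.psum c ((x - p) 0) N) =
     fun x => \sum_(a <- bms n N) c a * \prod_i (x 0 i - p 0 i) ^+ mpoly.fun_of_multinom a i.
    apply/funext => x; rewrite psumE; apply: eq_bigr => a _; congr (_ * _).
    by apply: eq_bigr => i _; rewrite !mxE.
  apply: continuous_at_sum => a; apply: (@cvgMl_tmp _ _ (nbhs x0)).
  pose G i (x : 'rV[C]_n) := (x 0 i - p 0 i) ^+ mpoly.fun_of_multinom a i.
  apply: (@continuous_at_prod _ _ G x0) => i.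
  apply: (@continuous_at_exp (fun x : 'rV[C]_n => x 0 i - p 0 i)).
  apply: (@cvgB _ _ _ (nbhs x0) (nbhs_filter x0)); first exact: coord_continuous.
  exact: (@cvg_cst C _ _ (nbhs x0) (nbhs_filter x0)).
have cont' := proj1 (@cvgrPdist_le _ _ _ (nbhs x0) (nbhs_filter x0) _ _) cont _ eps3.
near=> x.
have xx : forall j, `|x 0 j - x0 0 j| < e / 2.
  by near: x; apply/nearP; exists (e / 2).
have xx' : forall j, `|(x - x0) 0 j| <= rho / 4.
  by near: x; exact: near_polydisc.
have tri j : x 0 j - p 0 j = (x 0 j - x0 0 j) + (x0 0 j - p 0 j) by rewrite addrA subrK.
have fx : Weyl.psum c ((x - p) 0) @ \oo --> f x.
  apply: hf => j; rewrite tri; apply: le_lt_trans (ler_normD _ _) _.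
  by rewrite [e]splitr ltrD.
have fx0 : Weyl.psum c ((x0 - p) 0) @ \oo --> f x0.
  apply: hf => j; apply: lt_trans (xe j) _.
  by rewrite ltr_pdivrMr // mulr_natr mulr2n ltrDl.
have b0 : `|f x0 - Weyl.psum c ((x0 - p) 0) N| <= eps / 3.
  apply: (psum_tail r0 cM _ fx0 hN') => j; apply: le_trans (xr j) _.
  by rewrite ler_wpM2l ?(ltW r0) // lef_pV2 ?posrE // ler_nat.
have b1 : `|f x - Weyl.psum c ((x - p) 0) N| <= eps / 3.
  apply: (psum_tail r0 cM _ fx hN') => j.
  have -> : rho / 2 = rho / 4 + rho / 4 by field.
  have := xr j; have := xx' j; rewrite !mxE tri => h1 h2.
  by apply: le_trans (ler_normD _ _) _; exact: lerD.
have b2 : `|Weyl.psum c ((x0 - p) 0) N - Weyl.psum c ((x - p) 0) N| <= eps / 3 by near: x.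
set u0 := Weyl.psum c ((x0 - p) 0) N in b0 b2 *; set u := Weyl.psum c ((x - p) 0) N in b1 b2 *.
have -> : f x0 - f x = (f x0 - u0) + ((u0 - u) - (f x - u)) by ring.
have -> : eps = eps / 3 + (eps / 3 + eps / 3) by field.
apply: le_trans (ler_normD _ _) _; apply: (lerD b0).
apply: le_trans (ler_normB _ _) _; exact: (lerD b2 b1).
Unshelve. all: by end_near. Qed.

End OneSpace.
End PowerSeries.

(** * Solution spaces and rank through Taylor coefficients *)

Section Solutions.
Variables (R : realType) (n : nat).
Local Notation C := (Cplx R).
Implicit Types (f g : 'rV[C]_n -> C) (p x : 'rV[C]_n) (I : Weyl.weyl C n -> Prop).

Lemma near_seq (T : Type) (s : seq T) (P : T -> 'rV[C]_n -> Prop) p :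
  (forall a, \forall x \near p, P a x) ->
  \forall x \near p, forall a, List.In a s -> P a x.
Proof.
move=> h; elim: s => [|a s ih]; first by near=> x => a.
near=> x => b [<-|bs]; first exact: (near (h a) x _).
exact: (near ih x _ b bs).
Unshelve. all: by end_near. Qed.

Lemma near_apply_at (P : Weyl.weyl C n) (D D' : Weyl.mindex n -> 'rV[C]_n -> C) p :
  (forall a, \forall x \near p, D a x = D' a x) ->
  \forall x \near p, Weyl.apply_at P ((x : 'rV[C]_n) 0) (D^~ x) =
    Weyl.apply_at P ((x : 'rV[C]_n) 0) (D'^~ x).
Proof.
move=> h; have hs := near_seq (mpoly.msupp P) h.
near=> x; apply: eq_apply_at_In => a aP.
exact: (near hs x _ a aP).
Unshelve. all: by end_near. Qed.

Lemma near_act f (D : Weyl.mindex n -> 'rV[C]_n -> C) c p (P : Weyl.weyl C n) :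
  hasser f p c -> (forall a, hasser (D a) p (dser a c)) ->
  \forall x \near p, act P f x = Weyl.apply_at P (x 0) (D^~ x).
Proof.
move=> hf hD; apply: near_apply_at => a.
exact: (hasser_eq (hasser_iter_partials a hf) (hD a)).
Qed.

Lemma solution0 I p : solution I p (fun=> 0).
Proof.
split; first by apply/holomorphic_hasser; exists (fun=> 0); exact: hasser0.
move=> P _; have h0 := @hasser0 R n p.
have hD a : hasser (fun=> 0 : C) p (dser a (fun=> 0 : C)).
  rewrite (_ : dser a _ = fun=> 0); first exact: h0.
  by apply/funext => b; rewrite /dser mul0rn.
have h := near_act P h0 hD.
near=> x; rewrite (near h x _) // /Weyl.apply_at big1 // => a _.
by rewrite mulr0.
Unshelve. all: by end_near. Qed.

(* [solution_dim] in terms of Taylor coefficients, where independence becomes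
   plain linear algebra in the space of sequences. *)
Definition ser_dim I p m : Prop :=
  exists (s : 'I_m -> 'rV[C]_n -> C) (c : 'I_m -> Weyl.mindex n -> C),
  [/\ forall k, solution I p (s k) /\ hasser (s k) p (c k), independent c &
    forall f d, solution I p f -> hasser f p d ->
      exists l : 'I_m -> C, forall a, d a = \sum_k l k * c k a].

Lemma solution_dimP I p m : solution_dim I p m <-> ser_dim I p m.
Proof.
split=> [[s [hs hf]]|[s [c [hs hc hf]]]].
  have [c hc] := choice (fun k => proj1 (holomorphic_hasser _ _) (proj1 (hs k))).
  have lin (l : 'I_m -> C) := hasser_sum (index_enum 'I_m) (fun k => hasserZ (l k) (hc k)).
  exists s, c; split.
  - by move=> k; split; [exact: hs | exact: hc].
  - move=> mu mu0 k.
    (* The zero solution has a unique representation, while both 0 and [mu] represent it. *)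
    have [l0 [_ lu]] := hf _ (solution0 I p).
    have h0 : \forall x \near p, 0 = \sum_(k < m) (0 : 'rV[C]_m) 0 k * s k x.
      by near=> x; rewrite big1 // => i _; rewrite mxE mul0r.
    have hmu : \forall x \near p, 0 = \sum_(k < m) (\row_j mu j) 0 k * s k x.
      have e : (fun a => \sum_k mu k * c k a) = fun=> 0 by apply/funext => a; exact: mu0.
      have hm := lin mu; rewrite e in hm.
      have h := hasser_eq (@hasser0 R n p) hm.
      near=> x; apply: etrans (near h x _) _; first by [].
      by apply: eq_bigr => i _; rewrite mxE.
    have := etrans (esym (lu _ hmu)) (lu _ h0).
    by move=> /rowP/(_ k); rewrite !mxE.
  - move=> f d sf hd; have [l [hl _]] := hf f sf.
    exists (fun k => l 0 k) => a.
    have h := hasser_ext hl hd.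
    by have := hasser_uniq h (lin (fun k => l 0 k)) => /(congr1 (@^~ a)).
exists s; split; first by move=> k; exact: (proj1 (hs k)).
have lin (l : 'I_m -> C) :=
  hasser_sum (index_enum 'I_m) (fun k => hasserZ (l k) (proj2 (hs k))).
move=> f sf; have [d hd] := proj1 (holomorphic_hasser _ _) (proj1 sf).
have [l hl] := hf f d sf hd.
exists (\row_k l k); split.
  have e : (fun a => \sum_k l k * c k a) = d by apply/funext => a; rewrite hl.
  have hm := lin l; rewrite e in hm.
  have h := hasser_eq hd hm.
  near=> x; apply: etrans (near h x _) _; first by [].
  by apply: eq_bigr => i _; rewrite mxE.
move=> l' hl'; apply/rowP => k; rewrite mxE.
have h := hasser_ext hl' hd.
have e := hasser_uniq h (lin (fun k => l' 0 k)).
apply/eqP; rewrite -subr_eq0; apply/eqP; move: k.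
apply: (hc (fun k => l k - l' 0 k)) => a.
under eq_bigr do rewrite mulrBl.
by rewrite sumrB -hl e subrr.
Unshelve. all: by end_near. Qed.

Lemma solution_dim_uniq I p m m' :
  solution_dim I p m -> solution_dim I p m' -> m = m'.
Proof.
move=> /solution_dimP[s [c [hs hc hf]]] /solution_dimP[s' [c' [hs' hc' hf']]].
apply/eqP; rewrite eqn_leq; apply/andP; split.
  apply: (independent_le hc) => k; have [h1 h2] := hs k; exact: hf' h1 h2.
apply: (independent_le hc') => k; have [h1 h2] := hs' k; exact: hf h1 h2.
Qed.

(* The rank is [m] and not the junk value 0 of [holonomic_rank]. *)
Definition rank_spec I m : Prop :=
  (exists p, nonsingular I p) /\ forall p, nonsingular I p -> solution_dim I p m.

Lemma holonomic_rank_spec I m : rank_spec I m -> holonomic_rank I = m.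
Proof.
move=> [[p np] hm]; rewrite /holonomic_rank; case: xgetP => [m' _ [_ h]|h].
  exact: solution_dim_uniq (h p np) (hm p np).
by exfalso; apply: (h m); split; [exists p | exact: hm].
Qed.

(** A positive value cannot be the default of [xget], so it satisfies the defining property. *)
Lemma rank_spec_holonomic I : (0 < holonomic_rank I)%N -> rank_spec I (holonomic_rank I).
Proof.
by rewrite /holonomic_rank; case: xgetP => [m' _ [h1 h2] _|_]; [split | rewrite ltnn].
Qed.

End Solutions.

Section Join.
Variables (R : realType) (n1 n2 n : nat) (sp : splitting n1 n2 n).
Local Notation C := (Cplx R).
Implicit Types (x p : 'rV[C]_n) (y : 'rV[C]_n1) (z : 'rV[C]_n2).

Definition rjoin y z : 'rV[C]_n := \row_k fjoin sp (y 0) (z 0) k.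
Definition rproj1 x : 'rV[C]_n1 := \row_i x 0 (inj1 sp i).
Definition rproj2 x : 'rV[C]_n2 := \row_j x 0 (inj2 sp j).

Lemma rproj1E x : (rproj1 x) 0 = x 0 \o inj1 sp.
Proof. by apply/funext => i; rewrite mxE. Qed.
Lemma rproj2E x : (rproj2 x) 0 = x 0 \o inj2 sp.
Proof. by apply/funext => i; rewrite mxE. Qed.
Lemma rjoinE y z : (rjoin y z) 0 = fjoin sp (y 0) (z 0).
Proof. by apply/funext => k; rewrite mxE. Qed.

Lemma rproj1K y z : rproj1 (rjoin y z) = y.
Proof. by apply/rowP => i; rewrite !mxE fjoin1. Qed.
Lemma rproj2K y z : rproj2 (rjoin y z) = z.
Proof. by apply/rowP => i; rewrite !mxE fjoin2. Qed.
Lemma rjoinK x : rjoin (rproj1 x) (rproj2 x) = x.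
Proof.
by apply/rowP => k; rewrite mxE; case: (sideP sp k) => i; rewrite (fjoin1, fjoin2) mxE.
Qed.

Lemma near_rproj1 (p1 : 'rV[C]_n1) (p2 : 'rV[C]_n2) (P : 'rV[C]_n1 -> Prop) :
  (\forall x1 \near p1, P x1) -> \forall x \near rjoin p1 p2, P (rproj1 x).
Proof.
move=> /nearP[e e0 h]; apply/nearP; exists e; first exact: e0.
move=> x xe; apply: h => i; have := xe (inj1 sp i).
by rewrite !mxE fjoin1.
Qed.

Lemma near_rproj2 (p1 : 'rV[C]_n1) (p2 : 'rV[C]_n2) (P : 'rV[C]_n2 -> Prop) :
  (\forall x2 \near p2, P x2) -> \forall x \near rjoin p1 p2, P (rproj2 x).
Proof.
move=> /nearP[e e0 h]; apply/nearP; exists e; first exact: e0.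
move=> x xe; apply: h => i; have := xe (inj2 sp i).
by rewrite !mxE fjoin2.
Qed.

Lemma near_rjoin1 (p1 : 'rV[C]_n1) (p2 : 'rV[C]_n2) (P : 'rV[C]_n -> Prop) :
  (\forall x \near rjoin p1 p2, P x) -> \forall x1 \near p1, P (rjoin x1 p2).
Proof.
move=> /nearP[e e0 h]; apply/nearP; exists e; first exact: e0.
move=> x xe; apply: h => k; rewrite !mxE; case: (sideP sp k) => i.
  by rewrite !fjoin1; exact: xe.
by rewrite !fjoin2 subrr normr0.
Qed.

Lemma hasser_stens (f : 'rV[C]_n1 -> C) (g : 'rV[C]_n2 -> C) (p1 : 'rV[C]_n1) (p2 : 'rV[C]_n2) c c' :
  hasser f p1 c -> hasser g p2 c' ->
  hasser (fun x => f (rproj1 x) * g (rproj2 x)) (rjoin p1 p2) (stens sp c c').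
Proof.
move=> [[r [M [r0 cM]]] hf] [[r' [M' [r0' cM']]] hg].
have [s [s0 sM sM']] : exists s, [/\ 0 < s, cbound c s M & cbound c' s M'].
  have cmp : r >=< r' by apply: real_comparable; exact: gtr0_real.
  exists (Num.min r r'); split; first by rewrite comparable_lt_min ?r0.
    by apply: cbound_shrink cM; rewrite comparable_le_min // (ltW r0) (ltW r0') comparable_ge_min // lexx.
  by apply: cbound_shrink cM'; rewrite comparable_le_min // (ltW r0) (ltW r0') comparable_ge_min // lexx orbT.
have M0 := cbound_ge0 (ltW s0) sM; have M0' := cbound_ge0 (ltW s0) sM'.
split; first by exists s, (M * M'); split; [exact: s0 | exact: (cbound_stens sp (ltW s0) sM sM')].
have hf' := near_rproj1 p2 hf; have hg' := near_rproj2 p1 hg.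
have s2 : 0 < s / 2 by rewrite divr_gt0.
near=> x.
have cx : Weyl.psum c ((rproj1 x - p1) 0) @ \oo --> f (rproj1 x).
  exact: (near hf' x _).
have cx' : Weyl.psum c' ((rproj2 x - p2) 0) @ \oo --> g (rproj2 x).
  exact: (near hg' x _).
have hx : forall j, `|(x - rjoin p1 p2) 0 j| <= s / 2.
  by near: x; exact: near_polydisc.
have xE : (x - rjoin p1 p2) 0 = fjoin sp ((rproj1 x - p1) 0) ((rproj2 x - p2) 0).
  apply/funext => k; rewrite !mxE; case: (sideP sp k) => i.
    by rewrite !fjoin1 !mxE.
  by rewrite !fjoin2 !mxE.
have hx1 i : `|(rproj1 x - p1) 0 i| <= s / 2.
  by have := hx (inj1 sp i); rewrite xE fjoin1.
have hx2 i : `|(rproj2 x - p2) 0 i| <= s / 2.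
  by have := hx (inj2 sp i); rewrite xE fjoin2.
rewrite xE.
have cprod : (fun N => Weyl.psum c ((rproj1 x - p1) 0) N * Weyl.psum c' ((rproj2 x - p2) 0) N)
    @ \oo --> f (rproj1 x) * g (rproj2 x) by exact: cvgM cx cx'.
apply/cvgrPdist_le => e e0.
have e2 : 0 < e / 2 by rewrite divr_gt0.
have [N0 hN0] := hsum_tail n (mulr_ge0 M0 M0') e2.
have /cvgrPdist_le/(_ _ e2) cprod' := cprod.
near=> N.
have h1 : `|f (rproj1 x) * g (rproj2 x) - Weyl.psum c ((rproj1 x - p1) 0) N *
    Weyl.psum c' ((rproj2 x - p2) 0) N| <= e / 2.
  exact: (near cprod' N _).
have h2 := psum_stens_le sp N s0 sM sM' hx1 hx2.
have h3 : M * M' * (hsum C n (N + N) - hsum C n N) <= e / 2.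
  apply: hN0; last exact: leq_addr.
  by near: N; exact: nbhs_infty_ge.
set u := Weyl.psum c _ N in h1 h2; set v := Weyl.psum c' _ N in h1 h2.
set w := Weyl.psum _ _ N in h2 *.
have -> : f (rproj1 x) * g (rproj2 x) - w = (f (rproj1 x) * g (rproj2 x) - u * v) + (u * v - w).
  by ring.
rewrite (splitr e); apply: le_trans (ler_normD _ _) _.
exact: lerD h1 (le_trans h2 h3).
Unshelve. all: by end_near. Qed.

Lemma hasser_slice (h : 'rV[C]_n -> C) (p1 : 'rV[C]_n1) (p2 : 'rV[C]_n2) c :
  hasser h (rjoin p1 p2) c -> hasser (fun x1 : 'rV[C]_n1 => h (rjoin x1 p2)) p1 (slice sp c).
Proof.
move=> [[r [M [r0 cM]]] hh]; split.
  by exists r, M; split; [exact: r0 | exact: cbound_slice].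
have hh' := near_rjoin1 hh.
near=> x1.
have : Weyl.psum c ((rjoin x1 p2 - rjoin p1 p2) 0) @ \oo --> h (rjoin x1 p2).
  exact: (near hh' x1 _).
have -> : (rjoin x1 p2 - rjoin p1 p2) 0 = fjoin sp ((x1 - p1) 0) (fun=> 0).
  apply/funext => k; rewrite !mxE; case: (sideP sp k) => i.
    by rewrite !fjoin1 !mxE.
  by rewrite !fjoin2 subrr.
have -> : Weyl.psum c (fjoin sp ((x1 - p1) 0) (fun=> 0)) = Weyl.psum (slice sp c) ((x1 - p1) 0).
  by apply/funext => N; exact: psum_slice.
by apply.
Unshelve. all: by end_near. Qed.

End Join.

Section Swap.
Variables (R : realType) (n1 n2 n : nat) (sp : splitting n1 n2 n).
Local Notation C := (Cplx R).

Lemma fjoin_swap T (f : 'I_n1 -> T) (g : 'I_n2 -> T) k :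
  fjoin (swap sp) g f k = fjoin sp f g k.
Proof. by rewrite /fjoin /=; case: (side sp k). Qed.

Lemma rjoin_swap (x1 : 'rV[C]_n1) (x2 : 'rV[C]_n2) : rjoin (swap sp) x2 x1 = rjoin sp x1 x2.
Proof. by apply/rowP => k; rewrite !mxE fjoin_swap. Qed.

End Swap.

(** * Solutions and operators of the product versus its factors *)

Section ExteriorProduct.
Variables (R : realType) (n1 n2 n : nat) (sp : splitting n1 n2 n).
Local Notation C := (Cplx R).
Local Notation rjoin := (rjoin sp).
Local Notation rproj1 := (rproj1 sp).
Local Notation rproj2 := (rproj2 sp).
Local Notation tens := (tens sp).

(** The derivatives of the product function are not computed: the products of derivatives have the
    right Taylor coefficients, which determine germs. *)
Lemma act_tens (f : 'rV[C]_n1 -> C) (g : 'rV[C]_n2 -> C) (p1 : 'rV[C]_n1) (p2 : 'rV[C]_n2)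
    c c' U V : hasser f p1 c -> hasser g p2 c' ->
  \forall x \near rjoin p1 p2,
    act (tens U V) (fun x => f (rproj1 x) * g (rproj2 x)) x =
    act U f (rproj1 x) * act V g (rproj2 x).
Proof.
move=> hf hg.
pose D (e : Weyl.mindex n) (x : 'rV[C]_n) :=
  Weyl.iter_partials (@partial R n1) (mproj1 sp e) f (rproj1 x) *
  Weyl.iter_partials (@partial R n2) (mproj2 sp e) g (rproj2 x).
have hD e : hasser (D e) (rjoin p1 p2) (dser e (stens sp c c')).
  rewrite -{2}(mjoinK sp e) dser_stens.
  exact: (hasser_stens sp (hasser_iter_partials _ hf) (hasser_iter_partials _ hg)).
have h := near_act (tens U V) (hasser_stens sp hf hg) hD.
near=> x; apply: etrans (near h x _) _; first by [].
rewrite apply_at_tens /act -apply_at_mulr -rproj1E -rproj2E.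
apply: eq_apply_at => a _; rewrite -apply_at_mull; apply: eq_apply_at => b _.
by rewrite /D mproj1K mproj2K.
Unshelve. all: by end_near. Qed.

Variables (S : Weyl.weyl C n -> Prop) (S1 : Weyl.weyl C n1 -> Prop)
  (S2 : Weyl.weyl C n2 -> Prop).
Hypothesis ext : ext_pair sp S S1 S2.
Local Notation I := (Weyl.left_ideal S).
Local Notation I1 := (Weyl.left_ideal S1).
Local Notation I2 := (Weyl.left_ideal S2).

Lemma solution_tens (f : 'rV[C]_n1 -> C) (g : 'rV[C]_n2 -> C)
    (p1 : 'rV[C]_n1) (p2 : 'rV[C]_n2) :
  solution I1 p1 f -> solution I2 p2 g ->
  solution I (rjoin p1 p2) (fun x => f (rproj1 x) * g (rproj2 x)).
Proof.
move=> [/holomorphic_hasser[c hf] sf] [/holomorphic_hasser[c' hg] sg]; split.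
  by apply/holomorphic_hasser; exists (stens sp c c'); exact: hasser_stens.
move=> P /(ideal_tens_dec ext); elim=> [|T Q [U [V [UV ->]]] _ ih].
  by near=> x; exact: apply_at0.
have h := act_tens U V hf hg.
case: UV => [/sf hU|/sg hV].
  have hU' := near_rproj1 sp p2 hU.
  near=> x; apply: etrans (apply_atD _ _ _ _) _.
  apply: etrans (congr1 (+%R _) (near ih x _)) _; rewrite // addr0.
  apply: etrans (near h x _) _; first by [].
  by rewrite (near hU' x _) // mul0r.
have hV' := near_rproj2 sp p1 hV.
near=> x; apply: etrans (apply_atD _ _ _ _) _.
  apply: etrans (congr1 (+%R _) (near ih x _)) _; rewrite // addr0.
apply: etrans (near h x _) _; first by [].
by rewrite (near hV' x _) // mulr0.
Unshelve. all: by end_near. Qed.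

(** For [P] in the first ideal, [P d_2^b] lies in the whole ideal and kills [h]; on the slice
    through [p2] it acts as [P] on the restriction of [d_2^b h]. *)
Lemma slice_solution (h : 'rV[C]_n -> C) (p1 : 'rV[C]_n1) (p2 : 'rV[C]_n2) d b :
  solution I (rjoin p1 p2) h -> hasser h (rjoin p1 p2) d ->
  exists f : 'rV[C]_n1 -> C, solution I1 p1 f /\
    hasser f p1 (slice sp (dser (mjoin sp (@mpoly.mnm0 n1) b) d)).
Proof.
move=> [_ sh] hh.
pose f (y : 'rV[C]_n1) :=
  Weyl.iter_partials (@partial R n) (mjoin sp (@mpoly.mnm0 n1) b) h (rjoin y p2).
have hf : hasser f p1 (slice sp (dser (mjoin sp (@mpoly.mnm0 n1) b) d)).
  exact: hasser_slice (hasser_iter_partials _ hh).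
exists f; split; last exact: hf.
split; first by apply/holomorphic_hasser; eexists; exact: hf.
move=> P /(left_ideal_tens ext (weylX C b)) /sh hP.
pose D (a : Weyl.mindex n1) (y : 'rV[C]_n1) :=
  Weyl.iter_partials (@partial R n) (mjoin sp a b) h (rjoin y p2).
have hD a : hasser (D a) p1
    (dser a (slice sp (dser (mjoin sp (@mpoly.mnm0 n1) b) d))).
  by rewrite dser_slice; exact: hasser_slice (hasser_iter_partials _ hh).
have e := near_act P hf hD.
have hP' := near_rjoin1 hP.
near=> y; apply: etrans (near e y _) _; first by [].
have : act (tens P (weylX C b)) h (rjoin y p2) = 0 by exact: (near hP' y _).
rewrite /act apply_at_tens -rproj1E -rproj2E rproj1K => <-.
by apply: eq_apply_at => a _; rewrite apply_at_mpolyX.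
Unshelve. all: by end_near. Qed.

Lemma solution_slice_coef (h : 'rV[C]_n -> C) (p1 : 'rV[C]_n1) (p2 : 'rV[C]_n2) d
    m (c : 'I_m -> Weyl.mindex n1 -> C) :
  solution I (rjoin p1 p2) h -> hasser h (rjoin p1 p2) d ->
  (forall f e, solution I1 p1 f -> hasser f p1 e ->
      exists l : 'I_m -> C, forall a, e a = \sum_k l k * c k a) ->
  forall b, exists l : 'I_m -> C, forall a, d (mjoin sp a b) = \sum_k l k * c k a.
Proof.
move=> sh hh hc b.
have [f [sf hf]] := slice_solution b sh hh.
have [l hl] := hc _ _ sf hf.
have q0 : ((fall (@mpoly.mnm0 n2) b)%:R : C) != 0 by rewrite pnatr_eq0 -lt0n fall_gt0.
exists (fun k => (fall (@mpoly.mnm0 n2) b)%:R^-1 * l k) => a.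
under eq_bigr do rewrite -mulrA.
by rewrite -mulr_sumr -hl slice_dser -[X in _ = _ * X]mulr_natl mulKf.
Qed.

Lemma symbol_join_eq0 (p1 xi1 : 'rV[C]_n1) (y : 'rV[C]_n2) (P : Weyl.weyl C n) D :
  char_variety I1 (p1, xi1) -> I1 (pact sp P (y 0) D) ->
  D (@mpoly.mnm0 n2) * Weyl.symbol P ((rjoin p1 y) 0) ((rjoin xi1 0) 0) = 0.
Proof.
move=> ch hP; rewrite !rjoinE.
have -> : (0 : 'rV[C]_n2) 0 = fun=> 0 by apply/funext => j; rewrite mxE.
apply: symbol_slice => Q ->; exact: (ch _ hP).
Qed.

(** A term [U V] of [P] yields a multiple of [U]: it is in the first ideal if [U] is, and it is 0
    near [p2] if [V] kills [f]. There are finitely many terms, so one neighbourhood serves all. *)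
Lemma near_pact_ideal (f : 'rV[C]_n2 -> C) (p2 : 'rV[C]_n2) (P : Weyl.weyl C n) :
  solution I2 p2 f -> I P -> \forall y \near p2,
  I1 (pact sp P ((y : 'rV[C]_n2) 0) (fun b => Weyl.iter_partials (@partial R n2) b f y)).
Proof.
move=> [_ sf] /(ideal_tens_dec ext); elim=> [|T Q [U [V [UV ->]]] _ ih].
  by near=> y; rewrite pact0; exact: left_ideal0.
case: UV => [hU|/sf hV].
  near=> y; rewrite pactD; apply: left_idealD; last exact: (near ih y _).
  by rewrite pact_tens; exact: left_ideal_mulC.
near=> y; rewrite pactD; apply: left_idealD; last exact: (near ih y _).
rewrite pact_tens; have : act V f y = 0 by exact: (near hV y _).
rewrite /act => ->; rewrite mpoly.mpolyC0 scale0r; exact: left_ideal0.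
Unshelve. all: by end_near. Qed.

End ExteriorProduct.

Lemma poly_eq0_small (K : numFieldType) (q : {poly K}) (e : K) : 0 < e ->
  (forall t, 0 < t -> t < e -> q.[t] = 0) -> q = 0.
Proof.
move=> e0 h; apply/eqP; apply/negPn/negP => q0.
(* Arbitrarily many roots; [k.+2] keeps them strictly below [e]. *)
pose t (k : nat) : K := e / k.+2%:R.
have ti : injective t.
  move=> i j /(mulfI (lt0r_neq0 e0)) /invr_inj /eqP; rewrite eqr_nat => /eqP.
  by case.
have h1 : all (root q) [seq t k | k <- iota 0 (size q)].
  apply/allP => _ /mapP[k _ ->]; apply/eqP; apply: h.
    by rewrite divr_gt0 // ltr0n.
  by rewrite ltr_pdivrMr ?ltr0n // ltr_pMr // ltr1n.
have h2 : uniq [seq t k | k <- iota 0 (size q)] by rewrite map_inj_uniq ?iota_uniq.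
by have := max_poly_roots q0 h1 h2; rewrite size_map size_iota ltnn.
Qed.

Section Product.
Variables (R : realType) (n1 n2 n : nat) (sp : splitting n1 n2 n).
Local Notation C := (Cplx R).
Variables (S : Weyl.weyl C n -> Prop) (S1 : Weyl.weyl C n1 -> Prop)
  (S2 : Weyl.weyl C n2 -> Prop).
Hypothesis ext : ext_pair sp S S1 S2.
Local Notation I := (Weyl.left_ideal S).
Local Notation I1 := (Weyl.left_ideal S1).
Local Notation I2 := (Weyl.left_ideal S2).

Lemma big_mul_ord (V : nmodType) m1 m2 (F : 'I_(m1 * m2) -> V) :
  \sum_i F i = \sum_k \sum_l F (mxvec_index k l).
Proof.
rewrite pair_bigA /= (reindex (uncurry (@mxvec_index m1 m2))) /=.
  by apply: eq_bigr => -[].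
exact: curry_mxvec_bij.
Qed.

Lemma solution_dim_tens (p1 : 'rV[C]_n1) (p2 : 'rV[C]_n2) m1 m2 :
  solution_dim I1 p1 m1 -> solution_dim I2 p2 m2 ->
  solution_dim I (rjoin sp p1 p2) (m1 * m2).
Proof.
move=> /solution_dimP[s [c [hs hc hf]]] /solution_dimP[s' [c' [hs' hc' hf']]].
apply/solution_dimP.
have [g gK Kg] := curry_mxvec_bij m1 m2.
have gE k l : g (mxvec_index k l) = (k, l) := gK (k, l) isT.
pose u i := fun x : 'rV[C]_n => s (g i).1 (rproj1 sp x) * s' (g i).2 (rproj2 sp x).
pose d i := stens sp (c (g i).1) (c' (g i).2).
exists u, d; split.
- move=> i; have [h1 h2] := hs (g i).1; have [h1' h2'] := hs' (g i).2; split.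
    exact: (solution_tens ext h1 h1').
  exact: (hasser_stens sp h2 h2').
- move=> mu hmu.
  suff h k l : mu (mxvec_index k l) = 0.
    by move=> i; rewrite -(Kg i isT); case: (g i) => k l; exact: h.
  apply: (bilinear_independent (L := fun k l => mu (mxvec_index k l)) hc hc') => a b.
  rewrite -[RHS](hmu (mjoin sp a b)) big_mul_ord.
  apply: eq_bigr => k' _; apply: eq_bigr => l' _.
  by rewrite /d gE /= stens_mjoin.
move=> h e sh hh.
have h1 := solution_slice_coef ext sh hh hf.
have h2 : forall a, exists l : 'I_m2 -> C, forall b, e (mjoin sp a b) = \sum_j l j * c' j b.
  have sh' : solution I (rjoin (swap sp) p2 p1) h by rewrite rjoin_swap.
  have hh' : hasser h (rjoin (swap sp) p2 p1) e by rewrite rjoin_swap.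
  move=> a; have [l hl] := solution_slice_coef (ext_pair_swap ext) sh' hh' hf' a.
  by exists l => b; rewrite -hl mjoin_swap.
have [L hL] := bilinear_span (D := fun a b => e (mjoin sp a b)) hc h1 h2.
exists (fun i => L (g i).1 (g i).2) => a.
rewrite -(mjoinK sp a) hL big_mul_ord.
apply: eq_bigr => k' _; apply: eq_bigr => l' _.
by rewrite /d gE /= stens_mjoin.
Qed.

(** Operators of one factor have symbols that involve only that factor's part of [xi], so each part
    must vanish. *)
Lemma nonsingular_join (p1 : 'rV[C]_n1) (p2 : 'rV[C]_n2) :
  nonsingular I1 p1 -> nonsingular I2 p2 -> nonsingular I (rjoin sp p1 p2).
Proof.
move=> h1 h2 xi hxi.
have e1 : rproj1 sp xi = 0.
  apply: h1 => P /(symbol_left_ideal ext hxi) /=.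
  by rewrite -rproj1E -rproj1E rproj1K.
have e2 : rproj2 sp xi = 0.
  apply: h2 => P /(symbol_left_ideal (ext_pair_swap ext) hxi) /=.
  by rewrite -rproj2E -rproj2E rproj2K.
rewrite -(rjoinK sp xi) e1 e2; apply/rowP => k; rewrite !mxE.
by case: (sideP sp k) => i; rewrite (fjoin1, fjoin2) mxE.
Qed.

(** No solution of [I2] is available at [p2] itself, so one is taken at some other [q2]. The symbol
    is then shown to vanish near a point [y0] close to [q2] and is carried to [p2] along the line
    joining them. *)
Lemma nonsingular_left (p1 : 'rV[C]_n1) (p2 q2 : 'rV[C]_n2) m2 :
  nonsingular I (rjoin sp p1 p2) -> (0 < m2)%N -> solution_dim I2 q2 m2 ->
  nonsingular I1 p1.
Proof.
move=> ns m20 /solution_dimP[s [c [hs hc _]]] xi1 ch.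
have [k0 _] : exists k0 : 'I_m2, true by exists (Ordinal m20).
have [sf hf] := hs k0.
set f := s _ in sf hf.
(* A basis element is not the zero germ, as its coefficients belong to an independent family. *)
have fn0 : ~ \forall y \near q2, f y = 0.
  move=> f0; have c0 := hasser_uniq (hasser_ext f0 hf) (@hasser0 R n2 q2).
  have /eqP : ((k0 == k0)%:R : C) = 0.
    apply: (hc (fun k => (k == k0)%:R)) => a.
    rewrite (bigD1 k0) //= eqxx mul1r c0 add0r big1 // => k /negbTE ->.
    by rewrite mul0r.
  by rewrite eqxx oner_eq0.
suff /(ns _) h : char_variety I (rjoin sp p1 p2, rjoin sp xi1 0).
  by rewrite -(rproj1K sp xi1 0) h; apply/rowP => i; rewrite !mxE.
move=> P hP /=; pose T (y : 'rV[C]_n2) := Weyl.symbol P ((rjoin sp p1 y) 0) ((rjoin sp xi1 0) 0).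
have fT : \forall y \near q2, f y * T y = 0.
  have hn := near_pact_ideal ext sf hP.
  near=> y; have hy := near hn y _.
  have := symbol_join_eq0 ch (hy _); rewrite iter_partials0; exact.
have fc := hasser_continuous hf.
(* The identity is needed on a neighbourhood of a point where [f] does not vanish, hence the
   interior. *)
have fT' := nbhs_interior fT.
have [y0 [y1 y2 y3]] : exists y0, [/\ {for y0, continuous f},
    \forall y \near y0, f y * T y = 0 & f y0 != 0].
  apply: contrapT => hn; apply: fn0; near=> y; apply: contrapT => /eqP fy; apply: hn.
  exists y; split; [exact: (near fc y _) | exact: (near fT' y _) | exact: fy].
have fy0 : \forall y \near y0, f y != 0 by exact: cvgr_neq0 y1 y3.
have /nearP[e e0 Te] : \forall y \near y0, T y = 0.
  near=> y; have /eqP : f y * T y = 0 by exact: (near y2 y _).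
  by rewrite mulf_eq0 (negbTE (near fy0 y _)) // => /eqP.
pose v := p2 - y0.
(* For [0 < t < e / B] all coordinates of [t *: v] stay below [e]; the summand 1 makes [B]
   positive. *)
pose B := 1 + \sum_i `|v 0 i|.
have B0 : 0 < B by rewrite ltr_pwDl // sumr_ge0.
have [q hq] := symbol_line P ((rjoin sp p1 y0) 0) (fjoin sp (fun=> 0) (v 0)) ((rjoin sp xi1 0) 0).
have Tq t : T (y0 + t *: v) = q.[t].
  rewrite /T -hq; congr Weyl.symbol; apply/funext => k.
  rewrite !rjoinE; case: (sideP sp k) => i; first by rewrite !fjoin1 mulr0 addr0.
  by rewrite !fjoin2 !mxE.
have q0 : q = 0.
  apply: (poly_eq0_small (e := e / B)); first by rewrite divr_gt0.
  move=> t t0 te; rewrite -Tq; apply: Te => i.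
  rewrite 2!mxE addrAC subrr add0r normrM gtr0_norm //.
  move: te; rewrite ltr_pdivlMr //; apply: le_lt_trans; rewrite ler_wpM2l ?(ltW t0) //.
  by rewrite /B (bigD1 i) //= addrCA lerDl addr_ge0 // sumr_ge0.
have := Tq 1; rewrite q0 horner0 scale1r /v addrC subrK; exact.
Unshelve. all: by end_near. Qed.

End Product.

Section RankProduct.
Variables (R : realType) (n1 n2 n : nat) (sp : splitting n1 n2 n).
Local Notation C := (Cplx R).

Lemma rank_spec_tens (S : Weyl.weyl C n -> Prop) (S1 : Weyl.weyl C n1 -> Prop)
    (S2 : Weyl.weyl C n2 -> Prop) m1 m2 :
  ext_pair sp S S1 S2 -> (0 < m1)%N -> (0 < m2)%N ->
  rank_spec (Weyl.left_ideal S1) m1 -> rank_spec (Weyl.left_ideal S2) m2 ->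
  rank_spec (Weyl.left_ideal S) (m1 * m2).
Proof.
move=> ext m10 m20 [[p1 np1] h1] [[p2 np2] h2]; split.
  by exists (rjoin sp p1 p2); exact: nonsingular_join ext _ _ np1 np2.
move=> p; rewrite -(rjoinK sp p) => np.
apply: (solution_dim_tens ext); [apply: h1 | apply: h2].
  exact: (nonsingular_left ext np m20 (h2 _ np2)).
rewrite -rjoin_swap in np.
exact: (nonsingular_left (ext_pair_swap ext) np m10 (h1 _ np1)).
Qed.

End RankProduct.

Section Rank0.
Variable R : realType.
Local Notation C := (Cplx R).

(** Base of the induction. The space is a point, the ideal is 0, every function is a solution and
    the constant 1 is a basis. *)
Lemma rank_spec0 (A : 'M[int]_(0, 0)) (b : 'cV[C]_0) :
  rank_spec (Weyl.hypergeometric_ideal A b) 1.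
Proof.
have ns (p : 'rV[C]_0) : nonsingular (Weyl.hypergeometric_ideal A b) p.
  by move=> xi _; apply/rowP => -[].
split; first by exists 0.
move=> p _; have allp (x : 'rV[C]_0) : x = p by apply/rowP => -[].
have holo (f : 'rV[C]_0 -> C) : holomorphic_at p f.
  apply/holomorphic_hasser; exists (fun=> f p); split.
    exists 1, `|f p|; split=> // a; by rewrite expr1n mulr1.
  near=> x; rewrite (allp x) subrr.
  have -> : (0 : 'rV[C]_0) 0 = fun=> 0 by apply/funext => -[].
  apply/cvgrPdist_le => e e0; exists 1%N => // N /= N0.
  by rewrite psum_at0 // subrr normr0 ltW.
have sol f : solution (Weyl.hypergeometric_ideal A b) p f.
  split; first exact: holo.
  move=> P /hyp_gens0 ->; near=> x; exact: apply_at0.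
exists (fun _ _ => 1); split=> [k|f _]; first exact: sol.
exists (\row_k f p); split.
  by near=> x; rewrite (allp x) big_ord1 mxE mulr1.
move=> l /nbhs_singleton; rewrite big_ord1 mulr1 => fl.
by apply/rowP => k; rewrite mxE (ord1 k).
Unshelve. all: by end_near. Qed.

Lemma hyp_rank_direct_sum d1 m1 d2 m2 (A : 'M[int]_(d1, m1)) (B : 'M[int]_(d2, m2))
    (beta : 'cV[C]_d1) (gamma : 'cV[C]_d2) k l : (0 < k)%N -> (0 < l)%N ->
  rank_spec (Weyl.hypergeometric_ideal A beta) k ->
  rank_spec (Weyl.hypergeometric_ideal B gamma) l ->
  rank_spec (Weyl.hypergeometric_ideal (direct_sum A B) (col_mx beta gamma)) (k * l).
Proof.
move=> k0 l0 hA hB.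
exact: (rank_spec_tens (hyp_gens_direct_sum A B beta gamma) k0 l0 hA hB).
Qed.

End Rank0.

(** * Volume of a direct sum *)

Section ProductMeasure.
Context {R : realType} {d1 d2 : measure_display} (T1 : measurableType d1)
  (T2 : measurableType d2) (m1 : {sigma_finite_measure set T1 -> \bar R})
  (m2 : {sigma_finite_measure set T2 -> \bar R}).

(* The instance of the library for the product of two sigma-finite measures is
   hidden by a later one for subprobabilities. *)
Definition prodm : set (T1 * T2)%type -> \bar R := (m1 \x m2)%E.

HB.instance Definition _ := Measure.copy prodm (m1 \x m2)%E.

Let prodm_sigma_finite : sigma_finite setT prodm.
Proof.
have [F TF hF] := sigma_finiteT m1; have [G TG hG] := sigma_finiteT m2.
exists (fun n => if (choice.unpickle n : option (nat * nat)) is Some ij then F ij.1 `*` G ij.2 else set0).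
  apply/seteqP; split=> // -[x y] _.
  have [i _ Fx] : (\bigcup_i F i) x by rewrite -TF.
  have [j _ Gy] : (\bigcup_j G j) y by rewrite -TG.
  by exists (choice.pickle (i, j)); rewrite // choice.pickleK.
move=> n; case: (choice.unpickle n) => [[i j]|] /=; last first.
  by split; [exact: measurable0 | rewrite measure0].
have [mF oF] := hF i; have [mG oG] := hG j; split; first exact: measurableX.
by rewrite [X in (X < _)%E]product_measure1E // lte_mul_pinfty // ge0_fin_numE.
Qed.

HB.instance Definition _ :=
  @Measure_isSigmaFinite.Build _ _ _ prodm prodm_sigma_finite.

End ProductMeasure.

Section Euclid.
Variable R : realType.

(* R^d is not a measurable type of the library: its copy [euclid d] is an
   iterated product following the recursion of [volume], and [vec] is the
   identification with column vectors. *)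
Record mspace := MSpace {
  mdisp : measure_display;
  mcar : measurableType mdisp;
  mmeas : {sigma_finite_measure set mcar -> \bar R}
}.

Fixpoint euclid (d : nat) : mspace :=
  match d with
  | 0%N => @MSpace _ unit (@dirac _ unit tt R)
  | d'.+1 => @MSpace _ (measurableTypeR R * mcar (euclid d'))%type
      (prodm (@lebesgue_measure R) (mmeas (euclid d')))
  end.

Fixpoint vec (d : nat) : mcar (euclid d) -> 'cV[R]_d :=
  match d return mcar (euclid d) -> 'cV[R]_d with
  | 0%N => fun _ => 0
  | d'.+1 => fun z => col_mx (z.1%:M : 'cV[R]_1) (vec z.2)
  end.
(** The recursion of [volume] for functions instead of sets, so that volumes of sections can
    themselves be integrated. *)
Fixpoint iint (d : nat) : ('cV[R]_d -> \bar R) -> \bar R :=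
  match d with
  | 0%N => fun F => F 0
  | d'.+1 => fun F =>
      (\int[lebesgue_measure]_t
        iint (fun y : 'cV[R]_d' => F (col_mx (t%:M : 'cV[R]_1) y)))%E
  end.
(** Both sides integrate the coordinates in the same order; nothing is exchanged, and so [F] may be
    arbitrary. *)
Lemma iint_add d1 d2 (F : 'cV[R]_(d1 + d2) -> \bar R) :
  iint F = iint (fun x : 'cV[R]_d1 => iint (fun y : 'cV[R]_d2 => F (col_mx x y))).
Proof.
elim: d1 F => [|d1 ih] F /=.
  congr (iint _); apply/funext => y; congr F.
  apply/matrixP => i j; case: (split_ordP (i : 'I_(0 + d2))) => [[]//|k ->].
  by rewrite col_mxEd; congr (y _ _); exact: val_inj.
apply: eq_integral => t _; rewrite ih.
congr (iint _); apply/funext => x; congr (iint _); apply/funext => y; congr F.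
by rewrite (@col_mxA _ 1 d1 d2) castmx_id.
Qed.

Lemma volumeE d (S : set 'cV[R]_d) : volume S = iint (fun x => (\1_S x : R)%:E).
Proof.
elim: d S => [//|d ih] S /=; apply: eq_integral => t _; rewrite ih.
by congr iint; apply/funext => y; rewrite !indicE /mkset.
Qed.

(* Unlike in the library, f and g need not be measurable. *)
Lemma le_integral_ge0 d (T : measurableType d) (mu : {measure set T -> \bar R})
    (f g : T -> \bar R) :
  (forall x, 0 <= f x)%E -> (forall x, f x <= g x)%E ->
  (\int[mu]_x f x <= \int[mu]_x g x)%E.
Proof.
move=> f0 fg; have g0 x : (0 <= g x)%E by exact: le_trans (f0 x) (fg x).
rewrite !ge0_integralTE //; apply: le_ereal_sup => _ [h /= hf <-].
by exists h => // x; exact: le_trans (hf x) (fg x).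
Qed.

Lemma iint_ge0 d (F : 'cV[R]_d -> \bar R) :
  (forall x, 0 <= F x)%E -> (0 <= iint F)%E.
Proof.
elim: d F => [|d ih] F F0 /=; first exact: F0.
by apply: integral_ge0 => t _; apply: ih.
Qed.

Lemma le_iint d (F G : 'cV[R]_d -> \bar R) :
  (forall x, 0 <= F x)%E -> (forall x, F x <= G x)%E -> (iint F <= iint G)%E.
Proof.
elim: d F G => [|d ih] F G F0 FG /=; first exact: FG.
apply: le_integral_ge0 => t; first by apply: iint_ge0.
by apply: ih.
Qed.

Lemma measurable_vec_coord d (i : 'I_d) :
  measurable_fun setT (fun z : mcar (euclid d) => vec z i 0 : measurableTypeR R).
Proof.
elim: d i => [[]//|d ih] i.
case: (split_ordP (i : 'I_(1 + d))) => j ->.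
  rewrite (_ : (fun z => _) = fst); first exact: measurable_fst.
  apply/funext => z; transitivity ((z.1%:M : 'cV[R]_1) j 0).
    exact: (@col_mxEu _ 1 d 1).
  by rewrite mxE !ord1.
rewrite (_ : (fun z => _) = (fun z => vec z j 0) \o snd); last first.
  by apply/funext => z; exact: (@col_mxEd _ 1 d 1).
by apply: measurableT_comp => //; exact: ih.
Qed.

(** By Tonelli, for measurable functions; this makes additivity of the integral available for step
    functions. *)
Lemma iintE d (F : 'cV[R]_d -> \bar R) :
  measurable_fun setT (fun z : mcar (euclid d) => F (vec z)) -> (forall x, 0 <= F x)%E ->
  iint F = (\int[mmeas (euclid d)]_z F (vec z))%E.
Proof.
elim: d F => [|d ih] F mF F0 /=; first by rewrite integral_dirac // diracT mul1e.
rewrite (@fubini_tonelli1 _ _ _ _ _ _ _ (fun z => F (@vec d.+1 z))) //.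
apply: eq_integral => t _; rewrite ih //.
exact: (measurableT_comp mF (measurable_pair1 t)).
Qed.

Definition vmeasurable d (S : set 'cV[R]_d) := measurable (@vec d @^-1` S).

Lemma measurable_indic_vec d (S : set 'cV[R]_d) : vmeasurable S ->
  measurable_fun setT (fun z : mcar (euclid d) => (\1_S (vec z) : R)%:E).
Proof.
move=> mS; apply/measurable_EFinP.
rewrite (_ : (fun _ => _) = \1_(@vec d @^-1` S)); first exact: measurable_indic.
by apply/funext => z /=; rewrite !indicE.
Qed.

Lemma iint_sum_indic d (I : Type) (r : seq I) (w : I -> R)
    (S : I -> set 'cV[R]_d) :
  (forall i, 0 <= w i) -> (forall i, vmeasurable (S i)) ->
  iint (fun x => \sum_(i <- r) (w i)%:E * (\1_(S i) x : R)%:E)%E =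
  (\sum_(i <- r) (w i)%:E * volume (S i))%E.
Proof.
move=> w0 mS.
have mI i := measurable_indic_vec (mS i).
have mw i : measurable_fun setT
    (fun z : mcar (euclid d) => (w i)%:E * (\1_(S i) (vec z) : R)%:E)%E.
  exact: (measurable_funeM (w i)%:E (mI i)).
rewrite iintE; last 2 first.
- exact: (emeasurable_sum r mw).
- by move=> x; apply: sume_ge0 => i _; rewrite mule_ge0 // lee_fin.
rewrite ge0_integral_sum //; last first.
  by move=> i x _; rewrite mule_ge0 // lee_fin.
apply: eq_bigr => i _; rewrite ge0_integralZl_EFin //.
by congr (_ * _)%E; rewrite volumeE iintE.
Qed.

Lemma volume_ge0 d (S : set 'cV[R]_d) : (0 <= volume S)%E.
Proof. by rewrite volumeE; apply: iint_ge0 => x; rewrite lee_fin. Qed.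

Lemma le_volume d (S T : set 'cV[R]_d) : S `<=` T -> (volume S <= volume T)%E.
Proof.
move=> ST; rewrite !volumeE; apply: le_iint => x; first by rewrite lee_fin.
by rewrite lee_fin !indicE ler_nat; case: (boolP (x \in S)) => // /set_mem/ST/mem_set ->.
Qed.

Lemma volume_sections d1 d2 (S : set 'cV[R]_(d1 + d2)) :
  volume S = iint (fun x : 'cV[R]_d1 => volume [set y : 'cV[R]_d2 | S (col_mx x y)]).
Proof.
rewrite volumeE iint_add; congr iint; apply/funext => x.
by rewrite volumeE; congr iint; apply/funext => y; rewrite !indicE /mkset.
Qed.

End Euclid.

(** * Measurability of polytopes *)

Section Polytope.
Variable R : realType.

(** The sigma-algebra of [euclid d] is built from coordinates, not from the topology; the link is
    that an open set is a countable union of cubes with rational centres. *)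
Lemma open_vmeasurable d (U : set 'cV[R]_d) : open U -> vmeasurable U.
Proof.
move=> oU.
pose box (k : {ffun 'I_d -> rat} * nat) : set 'cV[R]_d :=
  [set x : 'cV[R]_d | forall i, `|ratr (k.1 i) - x i 0| < k.2.+1%:R^-1].
have mbox k : vmeasurable (box k).
  rewrite /vmeasurable (_ : _ @^-1` _ = \bigcap_(i in [set: 'I_d])
      [set z : mcar (euclid R d) | vec z i 0 \in
        `]ratr (k.1 i) - k.2.+1%:R^-1, ratr (k.1 i) + k.2.+1%:R^-1[]).
    apply: fin_bigcap_measurable => // i _; rewrite -[X in measurable X]setTI.
    exact: (@measurable_vec_coord R d i measurableT _ (measurable_itv `]_, _[)).
  by apply/seteqP; split=> z /= h i => [_|]; [have /= := h i|have /= := h i I];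
    rewrite in_itv /= -ltr_distlC distrC.
have -> : U = \bigcup_(k in [set k | box k `<=` U]) box k.
  apply/seteqP; split=> [x Ux|x [k kU]]; last exact: kU.
  have /nbhs_ballP[e /= e0 eU] : nbhs x U by move: oU; rewrite openE; apply.
  (* With half-side below [e / 2], a cube containing [x] lies in the ball of radius [e] around
     [x]. *)
  have [N _ hN] := near_infty_natSinv_lt (PosNum (divr_gt0 e0 (ltr0n R 2))).
  have {hN} hN := hN N (leqnn N); rewrite /= in hN.
  have N0 : 0 < N.+1%:R^-1 :> R by rewrite invr_gt0 ltr0n.
  have /fin_all_exists[r hr] i : exists r : rat, `|ratr r - x i 0| < N.+1%:R^-1.
    have [|r] := @rat_in_itvoo R (x i 0 - N.+1%:R^-1) (x i 0 + N.+1%:R^-1).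
      by rewrite ltrD2l gtrN.
    by rewrite in_itv /= -ltr_distlC distrC => ?; exists r.
  exists ([ffun i => r i], N) => /= [y yb|i]; last by rewrite ffunE; exact: hr.
  apply: eU; split=> // i j; rewrite (ord1 j) /ball /= -(subrKA (ratr (r i))).
  rewrite (le_lt_trans (ler_normD _ _)) // (splitr e) ltrD //.
    by rewrite distrC (lt_trans (hr i)).
  by have := yb i; rewrite ffunE => /lt_trans; apply.
rewrite /vmeasurable preimage_bigcup bigcup_mkcond.
apply: countable_bigcupT_measurable; first exact: countableP.
by move=> k; case: ifP => _; [exact: (mbox k)|exact: measurable0].
Qed.

Lemma closed_vmeasurable d (U : set 'cV[R]_d) : closed U -> vmeasurable U.
Proof.
move=> /closed_openC/open_vmeasurable mU.
by rewrite -[U]setCK /vmeasurable preimage_setC; exact: measurableC.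
Qed.

Lemma continuous_linear_comb (V : normedModType R) n (w : 'I_n -> V) :
  continuous (fun v : 'rV[R]_n => \sum_j v 0 j *: w j).
Proof.
move=> v; elim: (index_enum _) => [|j r ih].
  rewrite (_ : (fun u => _) = fun=> 0).
    exact: (@cvg_cst V _ _ (nbhs v) (nbhs_filter v)).
  by apply/funext => u; rewrite big_nil.
rewrite (_ : (fun u => _) = fun u : 'rV[R]_n => u 0 j *: w j + \sum_(i <- r) u 0 i *: w i).
  apply: (@cvgD _ _ _ (nbhs v) (nbhs_filter v)) ih.
  apply: (@cvgZr_tmp _ _ _ (nbhs v) (nbhs_filter v)); exact: coord_continuous.
by apply/funext => u; rewrite big_cons.
Qed.

(** The hull of the columns and the origin in coordinates: the weight missing to 1 is that of the
    origin. *)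
Definition polytope d n (B : 'M[R]_(d, n)) : set 'cV[R]_d :=
  [set B *m l | l in [set l : 'cV[R]_n |
     (forall j, 0 <= l j 0) /\ \sum_j l j 0 <= 1]].

(** A continuous image of a closed subset of the unit cube, weights being at most their sum. *)
Lemma polytope_compact d n (B : 'M[R]_(d, n)) : compact (polytope B).
Proof.
pose S := [set v : 'rV[R]_n | forall j, v 0 j \in `[0, 1]] `&`
  (fun v : 'rV[R]_n => \sum_j v 0 j *: (1 : R)) @^-1` [set x | x <= 1].
have cS : compact S.
  apply: compact_closedI.
    apply: (@rV_compact R n (fun=> `[0, 1]%classic)) => i; exact: segment_compact.
  apply: preimage_closed; last exact: closed_le.
  by move=> v _; exact: (@continuous_linear_comb R^o n (fun=> 1) v).
rewrite (_ : polytope B = (fun v : 'rV[R]_n => \sum_j v 0 j *: col j B) @` S).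
  apply: continuous_compact cS; apply: continuous_subspaceT.
  exact: continuous_linear_comb.
have E (l : 'cV[R]_n) : B *m l = \sum_j l j 0 *: col j B.
  apply/colP => i; rewrite mxE summxE; apply: eq_bigr => j _.
  by rewrite !mxE mulrC.
apply/seteqP; split=> [_ [l [l0 l1] <-]|_ [v [v0 v1] <-]].
  exists l^T; last by rewrite E; apply: eq_bigr => j _; rewrite mxE.
  split=> /=.
    move=> j; rewrite mxE in_itv /= l0 (le_trans _ l1) // (bigD1 j) //= lerDl.
    exact: sumr_ge0.
  by under eq_bigr do rewrite mxE scaler1.
exists v^T; last by rewrite E; apply: eq_bigr => j _; rewrite mxE.
split=> [j|]; first by rewrite mxE; have := v0 j; rewrite in_itv => /andP[].
by under eq_bigr do rewrite mxE -[v _ _]mulr1.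
Qed.

Lemma polytope_vmeasurable d n (B : 'M[R]_(d, n)) : vmeasurable (polytope B).
Proof.
have hs : hausdorff_space 'cV[R]_d by exact: norm_hausdorff.
exact: (closed_vmeasurable (compact_closed hs (@polytope_compact d n B))).
Qed.

End Polytope.

(** * Volume under dilation *)

Section Scaling.
Variable R : realType.
Local Notation mu := (@lebesgue_measure R).

Lemma measurable_scale (t : R) :
  measurable_fun setT (fun x : measurableTypeR R => t * x : measurableTypeR R).
Proof. exact: measurable_funM (measurable_cst t) (@measurable_id _ R setT). Qed.

Definition scaled_lebesgue (t : {posnum R}) :
  {measure set (measurableTypeR R) -> \bar R}.
Proof.
refine (mscale t%:num%:nng
  (pushforward mu (fun x => (t%:num * x)%R : measurableTypeR R))).
exact: measurable_scale.
Defined.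

(** By uniqueness of Lebesgue measure, it is enough to compare on half-open intervals. This is
    linear substitution in one variable. *)
Lemma scaled_lebesgueE (t : {posnum R}) (A : set R) : measurable A ->
  scaled_lebesgue t A = mu A.
Proof.
move=> mA; apply/esym; apply: (@lebesgue_measure_unique R) mA.
move=> _ [[a b]] _ <-; transitivity
    (t%:num%:E * mu `](t%:num^-1 * a)%R, (t%:num^-1 * b)%R]%classic)%E; last first.
  congr (_ * mu _)%E.
  by apply/seteqP; split=> x /=; rewrite !in_itv /= ltr_pdivrMl // ler_pdivlMl.
rewrite !lebesgue_measure_itv /= !lte_fin ltr_pM2l ?invr_gt0 //.
case: ifP => _; last by rewrite mule0.
by rewrite -!EFinB -EFinM -mulrBr mulrA divff ?mul1r.
Qed.

Lemma ge0_integral_scale (t : {posnum R}) (f : R -> \bar R) :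
  measurable_fun [set: measurableTypeR R] f -> (forall x, 0 <= f x)%E ->
  (\int[mu]_x f x = t%:num%:E * \int[mu]_x f (t%:num * x)%R)%E.
Proof.
move=> mf f0.
transitivity (\int[scaled_lebesgue t]_x f x)%E.
  by apply: eq_measure_integral => A mA _; rewrite scaled_lebesgueE.
rewrite ge0_integral_mscale //; congr (_ * _)%E.
have h := (ge0_integral_pushforward (measurable_scale t%:num) mu measurableT mf (fun y _ => f0 y)). exact: h.
Qed.

Lemma iint_scale d (t : {posnum R}) (F : 'cV[R]_d -> \bar R) :
  measurable_fun setT (fun z : mcar (euclid R d) => F (vec z)) ->
  (forall x, 0 <= F x)%E ->
  iint F = ((t%:num ^+ d)%R%:E * iint (fun x => F (t%:num *: x)%R))%E.
Proof.
elim: d F => [|d ih] F mF F0 /=; first by rewrite expr0 mul1e scaler0.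
pose g (s : R) := iint (fun y : 'cV[R]_d => F (col_mx (s%:M : 'cV_1) y)).
have mF1 (s : R) : measurable_fun setT
    (fun z : mcar (euclid R d) => F (col_mx (s%:M : 'cV_1) (vec z))).
  exact: (measurableT_comp mF (measurable_pair1 s)).
have g0 s : (0 <= g s)%E by exact: iint_ge0.
have mg : measurable_fun [set: measurableTypeR R] g.
  rewrite (_ : g = fubini_F (mmeas (euclid R d))
    (fun z : measurableTypeR R * mcar (euclid R d) => F (@vec R d.+1 z))).
    exact: measurable_fun_fubini_tonelli_F.
  by apply/funext => s; rewrite /g iintE.
have t0 : (t%:num ^+ d)%:E != 0%E by rewrite eqe expf_neq0.
rewrite -/g [LHS](ge0_integral_scale t mg g0) exprS EFinM -muleA; congr (_ * _)%E.
pose h s := iint (fun y : 'cV[R]_d => F (t%:num *: col_mx (s%:M : 'cV_1) y)).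
have gh s : g (t%:num * s) = ((t%:num ^+ d)%R%:E * h s)%E.
  rewrite /g ih //; congr (_ * iint _)%E; apply/funext => y; congr F.
  by rewrite (@scale_col_mx _ 1 d) scale_scalar_mx.
(* Measurability of [h] is read off from that of [g] through this identity. *)
have hE s : h s = ((t%:num ^- d)%R%:E * g (t%:num * s)%R)%E.
  by rewrite gh muleA -EFinM mulVf ?mul1e // expf_neq0.
transitivity (\int[mu]_s ((t%:num ^+ d)%R%:E * h s))%E.
  by apply: eq_integral => s _; exact: gh.
rewrite ge0_integralZl_EFin //.
- by move=> s _; exact: iint_ge0.
- rewrite (_ : h = fun s => ((t%:num ^- d)%R%:E * g (t%:num * s)%R)%E); last exact/funext.
  exact: (measurable_funeM (t%:num ^- d)%R%:E (measurableT_comp mg (measurable_scale t%:num))).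
Qed.

Lemma volume_scale d (t : {posnum R}) (S : set 'cV[R]_d) : vmeasurable S ->
  volume S = ((t%:num ^+ d)%R%:E * volume [set x | S (t%:num *: x)%R])%E.
Proof.
move=> mS; rewrite volumeE (iint_scale t).
- by rewrite volumeE; congr (_ * iint _)%E; apply/funext => x; rewrite !indicE.
- exact: measurable_indic_vec.
- by move=> x; rewrite lee_fin.
Qed.

Lemma volume_polytopeZ d n (t : R) (B : 'M[R]_(d, n)) : 0 < t ->
  volume (polytope (t *: B)) = ((t ^+ d)%R%:E * volume (polytope B))%E.
Proof.
move=> t0; rewrite (volume_scale (PosNum t0)); last exact: polytope_vmeasurable.
congr (_ * volume _)%E; apply/seteqP; split=> x /= [l hl].
  by rewrite -scalemxAl => /(scalerI (lt0r_neq0 t0)) <-; exists l.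
by move=> <-; exists l => //; rewrite scalemxAl.
Qed.

End Scaling.

Lemma convex_polytope (R : realType) d n (B : 'M[R]_(d, n)) :
  @convex_set R 'cV[R]_d (polytope B).
Proof.
move=> x y p /set_mem[l [l0 l1] <-] /set_mem[k [k0 k1] <-]; apply/mem_set.
have p0 : 0 <= p%:num by [].
have q0 : 0 <= 1 - p%:num by rewrite subr_ge0.
exists (p%:num *: l + (1 - p%:num) *: k); last by rewrite mulmxDr -!scalemxAr.
split=> [j|]; first by rewrite !mxE addr_ge0 // mulr_ge0.
under eq_bigr do rewrite !mxE; rewrite big_split -!mulr_sumr /=.
by rewrite -[leRHS](subrKC p%:num) lerD // ler_piMr.
Qed.

(** Convexity speaks of two points only: split off the first term and divide the remaining weights
    by [1 - l i]. If [l i = 1], the other weights are 0. *)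
Lemma convex_comb_sub (R : realType) (M : lmodType R) (S : set M) :
  @convex_set R M S -> S 0 -> forall (I : eqType) (r : seq I) (l : I -> R) (w : I -> M),
  (forall i, 0 <= l i) -> \sum_(i <- r) l i <= 1 -> (forall i, S (w i)) ->
  S (\sum_(i <- r) l i *: w i).
Proof.
move=> cS S0 I; elim=> [|i r ih] l w l0; first by rewrite !big_nil.
rewrite !big_cons => l1 Sw.
have rl0 : 0 <= \sum_(j <- r) l j by exact: sumr_ge0.
have li1 : l i <= 1 by apply: le_trans l1; rewrite lerDl.
have [li|li] := eqVneq (l i) 1.
  have r0 : \sum_(j <- r) l j = 0.
    by apply/eqP; rewrite eq_le rl0 andbT; move: l1; rewrite li gerDl.
  rewrite li scale1r big_seq big1 ?addr0 // => j jr.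
  move/eqP: r0; rewrite psumr_eq0 // => /allP/(_ _ jr)/eqP -> /=.
  by rewrite scale0r.
have c0 : 0 < 1 - l i by rewrite subr_gt0 lt_neqAle li.
set v := \sum_(j <- r) ((1 - l i)^-1 * l j) *: w j.
have Sv : S v.
  apply: ih => //; first by move=> j; rewrite mulr_ge0 // invr_ge0 ltW.
  by rewrite -mulr_sumr ler_pdivrMl // mulr1 lerBrDl.
have := cS (w i) v (Itv01 (l0 i) li1) (mem_set (Sw i)) (mem_set Sv).
move=> /set_mem; congr (S (_ + _)); change ((1 - l i) *: v = \sum_(j <- r) l j *: w j).
rewrite /v scaler_sumr; apply: eq_bigr => j _.
by rewrite scalerA mulrA divff ?lt0r_neq0 // mul1r.
Qed.

Lemma Delta_polytope (R : realType) d n (A : 'M[int]_(d, n)) :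
  Delta A = polytope (map_mx (intr : int -> R) A).
Proof.
apply/seteqP; split.
  apply: smallest_sub; first exact: convex_polytope.
  move=> _ [[j _ <-]|->].
    exists (delta_mx j 0); last by apply/colP => i; rewrite -colE !mxE.
    split=> [k|]; first by rewrite mxE ler0n.
    rewrite (bigD1 j) //= mxE !eqxx big1 ?addr0 // => k kj.
    by rewrite mxE (negbTE kj).
  exists 0; last by rewrite mulmx0.
  by split=> [k|]; rewrite ?big1 ?mxE // => k _; rewrite mxE.
move=> _ [l [l0 l1] <-] S [cS SA].
rewrite (_ : _ *m l = \sum_j l j 0 *: map_mx intr (col j A)).
  apply: (convex_comb_sub cS) => // [|j]; first by apply: SA; right.
  by apply: SA; left; exists j.
apply/colP => i; rewrite mxE summxE; apply: eq_bigr => j _.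
by rewrite !mxE mulrC.
Qed.

(** * Enclosing the volume of a direct sum by shells *)

Section Shells.
Variable R : realType.

Lemma volume0 d : volume (set0 : set 'cV[R]_d) = 0%E.
Proof.
elim: d => [|d ih] /=; first by rewrite indicE in_set0.
by under eq_integral do rewrite ih; rewrite integral0.
Qed.

Lemma polytopeZP d n (B : 'M[R]_(d, n)) t (l : 'cV[R]_n) : 0 <= t ->
  (forall j, 0 <= l j 0) -> \sum_j l j 0 <= t -> polytope (t *: B) (B *m l).
Proof.
move=> t0 l0 lt; have [t_eq0|tn0] := eqVneq t 0.
  have /eqP l_eq0 : \sum_j l j 0 == 0.
    by rewrite eq_le sumr_ge0 // andbT (le_trans lt) // t_eq0.
  have -> : l = 0.
    apply/colP => j; rewrite mxE; move/eqP: l_eq0; rewrite psumr_eq0 // => /allP.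
    by move=> /(_ j (mem_index_enum _))/eqP.
  exists 0; last by rewrite !mulmx0.
  by split=> [k|]; rewrite ?big1 ?mxE // => k _; rewrite mxE.
have tp : 0 < t by rewrite lt0r tn0.
exists (t^-1 *: l); last by rewrite -scalemxAl -scalemxAr scalerA divff // scale1r.
split=> [j|]; first by rewrite mxE mulr_ge0 // invr_ge0.
by under eq_bigr do rewrite mxE; rewrite -mulr_sumr ler_pdivrMl // mulr1.
Qed.

Variables (m n k p : nat) (A : 'M[R]_(m.+1, n)) (B : 'M[R]_(k, p)).
Let AB := block_mx A 0 0 B.

Lemma polytope_block_mxP (x : 'cV_m.+1) (y : 'cV_k) : polytope AB (col_mx x y) <->
  exists (l : 'cV_n) (u : 'cV_p), [/\ forall j, 0 <= l j 0, forall j, 0 <= u j 0,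
    \sum_j l j 0 + \sum_j u j 0 <= 1, x = A *m l & y = B *m u].
Proof.
have E (l : 'cV_n) (u : 'cV_p) : AB *m col_mx l u = col_mx (A *m l) (B *m u).
  by rewrite mul_block_col !mul0mx addr0 add0r.
have S (l : 'cV[R]_n) (u : 'cV_p) :
    \sum_j (col_mx l u) j 0 = \sum_j l j 0 + \sum_j u j 0.
  rewrite big_split_ord; congr (_ + _); apply: eq_bigr => j _.
    by rewrite col_mxEu.
  by rewrite col_mxEd.
split=> [[v [v0 v1]]|[l [u [l0 u0 lu -> ->]]]].
  rewrite -[v]vsubmxK E => /eq_col_mx[<- <-].
  exists (usubmx v), (dsubmx v); split=> // [j|j|]; rewrite ?mxE //.
  by rewrite -S vsubmxK.
exists (col_mx l u); last by rewrite E.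
split=> [j|]; last by rewrite S.
by case: (split_ordP j) => i ->; rewrite ?col_mxEu ?col_mxEd.
Qed.

Let section x := [set y : 'cV_k | polytope AB (col_mx x y)].

Variable N : nat.
Let t i : R := i%:R / N.+1%:R.
Let T i := polytope (t i *: A).
Let t0 i : 0 <= t i. Proof. by rewrite divr_ge0. Qed.
Let le_t i j : (i <= j)%N -> t i <= t j.
Proof. by move=> ij; rewrite ler_pM2r ?invr_gt0 ?ltr0n // ler_nat. Qed.
Let tN : t N.+1 = 1. Proof. by rewrite /t divff. Qed.

Lemma le_shell i j : (i <= j)%N -> T i `<=` T j.
Proof.
move=> ij x [l [l0 l1] <-]; rewrite -scalemxAl scalemxAr; apply: polytopeZP => //.
  by move=> h; rewrite mxE mulr_ge0.
under eq_bigr do rewrite mxE; rewrite -mulr_sumr.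
by rewrite (le_trans _ (le_t ij)) // ler_piMr.
Qed.

(** Outside [T i] every representation of [x] spends weight at least [t i] on [A], leaving at most
    [1 - t i] for [B]. For [i = 0] this is automatic, as [t 0 = 0]. *)
Lemma section_upper i x : (0 < i -> ~ T i x)%N ->
  section x `<=` polytope ((1 - t i) *: B).
Proof.
move=> xT y /polytope_block_mxP[l [u [l0 u0 lu xE ->]]].
have lt : t i <= \sum_j l j 0.
  case: i xT => [_|i xT]; first by rewrite /t mul0r sumr_ge0.
  by rewrite leNgt; apply/negP => /ltW h; apply: xT; rewrite // xE; exact: polytopeZP.
have us : \sum_j u j 0 <= 1 - t i by lra.
by apply: polytopeZP => //; rewrite (le_trans _ us) // sumr_ge0.
Qed.

(** A point of [T i] can be represented with weight at most [t i], so [1 - t i] remains available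
    for [B]. *)
Lemma section_lower i x : (i <= N.+1)%N -> T i x ->
  polytope ((1 - t i) *: B) `<=` section x.
Proof.
move=> iN [l [l0 l1] <-] y [u [u0 u1] <-]; apply/polytope_block_mxP.
have ti1 : 0 <= 1 - t i by rewrite subr_ge0 -tN le_t.
exists (t i *: l), ((1 - t i) *: u).
split; last by rewrite -scalemxAl -scalemxAr.
- by move=> j; rewrite mxE mulr_ge0.
- by move=> j; rewrite mxE mulr_ge0.
- under eq_bigr do rewrite mxE; under [X in _ + X]eq_bigr do rewrite mxE.
  rewrite -!mulr_sumr.
  have h1 : t i * \sum_j l j 0 <= t i by rewrite ler_piMr.
  have h2 : (1 - t i) * \sum_j u j 0 <= 1 - t i by rewrite ler_piMr.
  lra.
- by rewrite -scalemxAl -scalemxAr.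
Qed.

Variables vA vB : R.
Hypotheses (hA : volume (polytope A) = vA%:E) (hB : volume (polytope B) = vB%:E).

Let vB0 : 0 <= vB. Proof. by rewrite -lee_fin -hB volume_ge0. Qed.

Let w := weight R k N.

Lemma volume_slice i : (i <= N)%N ->
  volume (polytope ((1 - t i) *: B)) = (w i * vB)%:E.
Proof.
move=> iN; rewrite volume_polytopeZ ?hB -?EFinM; last first.
  by rewrite subr_gt0 ltr_pdivrMr ?ltr0n // mul1r ltr_nat ltnS.
by rewrite /w /weight iN.
Qed.

Lemma volume_shell i : volume (T i.+1) = (t i.+1 ^+ m.+1 * vA)%:E.
Proof. by rewrite volume_polytopeZ ?hA -?EFinM // divr_gt0 ?ltr0n. Qed.

Let dw i := (w i - w i.+1) * vB.
Let dw0 i : 0 <= dw i. Proof. by rewrite mulr_ge0 // subr_ge0 le_weight. Qed.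

Lemma sum_dw j : (j <= N.+1)%N -> \sum_(j <= i < N.+1) dw i = w j * vB.
Proof.
move=> jN; rewrite -mulr_suml (@telescope_sumr_eq _ j N.+1 (fun i => - w i)) //.
  by rewrite /w {1}/weight ltnn oppr0 opprK add0r.
by move=> i _; rewrite opprK addrC.
Qed.

(* For s = 1 (resp. s = 0) the value is the volume of the largest (resp.
   smallest) section over the shell containing x. *)
Let step (s : nat) x : \bar R :=
  (\sum_(i < N.+1) (dw i)%:E * (\1_(T (i + s)) x : R)%:E)%E.

Lemma stepE s j x : (j <= N.+1)%N -> (forall i, T (i + s) x <-> (j <= i)%N) ->
  step s x = (w j * vB)%:E.
Proof.
move=> jN Tj; rewrite -sum_dw // /step.
rewrite -(big_mkord xpredT (fun i => (dw i)%:E * (\1_(T (i + s)) x : R)%:E)%E).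
rewrite (@big_cat_nat _ _ _ j) //= big_nat big1 ?add0e => [|i /andP[_ ij]].
  rewrite -sumEFin [LHS]big_nat [RHS]big_nat; apply: eq_bigr => i /andP[ji _].
  by rewrite indicE mem_set ?mule1 //; apply/Tj.
by rewrite indicE memNset ?mule0 // => /Tj; rewrite leqNgt ij.
Qed.

Lemma first_shell s x : (exists2 i, (i <= N)%N & T (i + s) x) ->
  exists2 j, (j <= N)%N & forall i, T (i + s) x <-> (j <= i)%N.
Proof.
move=> [i0 i0N Ti0]; have ex : exists i, `[< T (i + s) x >] by exists i0; apply/asboolP.
case: (ex_minnP ex) => j /asboolP Tj jmin; exists j.
  by apply: leq_trans i0N; apply: jmin; apply/asboolP.
move=> i; split=> [Ti|ji]; first by apply: jmin; apply/asboolP.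
by apply: le_shell Tj; rewrite leq_add2r.
Qed.

Lemma section_le_step x : (volume (section x) <= step 1 x)%E.
Proof.
have [/first_shell[j jN Tj]|noT] := pselect (exists2 i, (i <= N)%N & T (i + 1) x).
  rewrite (stepE (leqW jN) Tj) -volume_slice //; apply/le_volume/section_upper.
  by case: j Tj {jN} => // j Tj _; rewrite -addn1 => /Tj; rewrite ltnn.
(* [T N.+1] is the whole of [polytope A], so the section over a point outside it is empty. *)
rewrite (_ : section x = set0) ?volume0 //; last first.
  rewrite -subset0 => y.
  move=> /polytope_block_mxP[l [u [l0 u0 lu xE _]]].
  apply: noT; exists N => //; rewrite addn1 /T tN scale1r xE; exists l => //.
  by split=> //; apply: le_trans lu; rewrite lerDl sumr_ge0.
by apply: sume_ge0 => i _; rewrite mule_ge0 // lee_fin.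
Qed.

Lemma step_le_section x : (step 0 x <= volume (section x))%E.
Proof.
have [/first_shell[j jN Tj]|noT] := pselect (exists2 i, (i <= N)%N & T (i + 0) x).
  rewrite (stepE (leqW jN) Tj) -volume_slice //; apply/le_volume/section_lower.
    exact: leqW.
  by rewrite -[j]addn0; apply/Tj.
rewrite /step big1 ?volume_ge0 // => i _; rewrite indicE memNset ?mule0 // => Ti.
by apply: noT; exists i => //; rewrite -ltnS.
Qed.

(** Only the step functions are integrated exactly; [le_iint] compares them with the volumes of
    sections without measurability of the latter. *)
Lemma volume_block_bounds :
  ((lower_sum R k m N * (vA * vB))%:E <= volume (polytope AB))%E /\
  (volume (polytope AB) <= (upper_sum R k m N * (vA * vB))%:E)%E.
Proof.
have vT s i : vmeasurable (T (i + s)) by exact: polytope_vmeasurable.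
rewrite volume_sections; split.
  apply: (@le_trans _ _ (iint (step 0))); last first.
    apply: le_iint => x; last exact: step_le_section.
    by apply: sume_ge0 => i _; rewrite mule_ge0 // lee_fin.
  rewrite iint_sum_indic // /lower_sum mulr_suml -sumEFin; apply: lee_sum => i _.
  have -> : ((w i - w i.+1) * t i ^+ m.+1 * (vA * vB))%:E =
      ((dw i)%:E * (t i ^+ m.+1 * vA)%:E)%E.
    by rewrite -EFinM /dw; congr EFin; ring.
  (* The scaling formula requires a positive factor; for the innermost copy, with factor 0,
     nonnegativity of the volume suffices. *)
  rewrite lee_wpmul2l ?lee_fin //; case: (val i) => [|j].
    by rewrite /t mul0r expr0n mul0r volume_ge0.
  by rewrite addn0 volume_shell.
apply: (@le_trans _ _ (iint (step 1))).
  by apply: le_iint => x; [exact: volume_ge0 | exact: section_le_step].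
rewrite iint_sum_indic // /upper_sum mulr_suml -sumEFin; apply: lee_sum => i _.
rewrite addn1 volume_shell -EFinM lee_fin /dw le_eqVlt; apply/orP; left.
by apply/eqP; rewrite /w /t; ring.
Qed.

End Shells.

(** The volume and the claimed value lie between the same two sums, which differ by at most a
    constant over [N.+1], for every [N]. *)
Lemma volume_polytope_block (R : realType) m n k p (A : 'M[R]_(m.+1, n))
    (B : 'M[R]_(k, p)) (vA vB : R) :
  volume (polytope A) = vA%:E -> volume (polytope B) = vB%:E ->
  volume (polytope (block_mx A 0 0 B)) = (beta_coef R k m.+1 * (vA * vB))%:E.
Proof.
move=> hA hB; set V := volume _.
have b N := @volume_block_bounds R m n k p A B N vA vB hA hB; rewrite -/V in b.
have V0 : (0 <= V)%E by exact: volume_ge0.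
have c0 : 0 <= vA * vB.
  by rewrite -lee_fin EFinM -hA -hB mule_ge0 ?volume_ge0.
have : V \is a fin_num.
  rewrite ge0_fin_numE //; have [_ h] := b 0; apply: le_lt_trans h _.
  exact: ltry.
case: V b {V0} => // v b _; congr EFin.
have {}b N : `|v - beta_coef R k m.+1 * (vA * vB)| <= m.+1%:R / N.+1%:R * (vA * vB).
  have [] := b N; rewrite !lee_fin => b1 b2.
  have d1 := ler_wpM2r c0 (lower_le_beta R k m N).
  have d2 := ler_wpM2r c0 (beta_le_upper R k m N).
  have d3 := ler_wpM2r c0 (upper_lower_sum R k m N).
  rewrite mulrBl in d3; rewrite ler_norml; move: d1 d2 d3 b1 b2.
  move: (lower_sum _ _ _ _ * _) (upper_sum _ _ _ _ * _) (beta_coef _ _ _ * _).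
  by move: (m.+1%:R / _ * _) => c L U be d1 d2 d3 b1 b2; apply/andP; split; lra.
apply/eqP; rewrite -subr_eq0 -normr_le0 leNgt; apply/negP => vb.
set e := `|_| in vb b.
have C0 : 0 < m.+1%:R * (vA * vB) + 1 by rewrite ltr_wpDl // mulr_ge0.
have [N _ /(_ N (leqnn N)) /=] := near_infty_natSinv_lt (PosNum (divr_gt0 vb C0)).
rewrite ltr_pdivlMr // => h; have := b N; rewrite leNgt => /negP; apply.
apply: le_lt_trans h; rewrite mulrAC mulrC ler_wpM2l ?invr_ge0 //.
by rewrite lerDl.
Qed.

(** * Index and conclusion *)

Lemma card_fsetM (T U : choiceType) (E : {fset T}) (F : {fset U}) :
  #|` (E `*` F)%fset| = (#|` E| * #|` F|)%N.
Proof.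
rewrite !cardfE -!cardfE -(size_allpairs pair E F); apply/perm_size/uniq_perm.
- exact: fset_uniq.
- by apply: allpairs_uniq => // -[? ?] [? ?].
move=> [x y]; rewrite in_fsetM; apply/andP/allpairsP => /= [[xE yF]|[[u v] [? ? [-> ->]]]].
  by exists (x, y).
by [].
Qed.

Section CosetProduct.
Variables (d1 n1 d2 n2 : nat) (A : 'M[int]_(d1, n1)) (B : 'M[int]_(d2, n2)).

Definition col_mx_prod (S : set 'cV[int]_d1 * set 'cV[int]_d2) :
  set 'cV[int]_(d1 + d2) := [set w | S.1 (usubmx w) /\ S.2 (dsubmx w)].

Lemma col_mx_prodE S T y z : col_mx_prod (S, T) (col_mx y z) = (S y /\ T z).
Proof. by rewrite /col_mx_prod /mkset /= col_mxKu col_mxKd. Qed.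

Lemma coset_direct_sum (y : 'cV[int]_d1) (z : 'cV[int]_d2) :
  coset_ZA (direct_sum A B) (col_mx y z) = col_mx_prod (coset_ZA A y, coset_ZA B z).
Proof.
have E (u : 'cV[int]_n1) (v : 'cV[int]_n2) :
    direct_sum A B *m col_mx u v = col_mx (A *m u) (B *m v).
  by rewrite /direct_sum mul_block_col !mul0mx addr0 add0r.
apply/seteqP; split=> [w [u ->]|w [[u hu] [v hv]]].
  rewrite -[u]vsubmxK E add_col_mx; split; rewrite /= ?col_mxKu ?col_mxKd.
    by exists (usubmx u).
  by exists (dsubmx u).
by exists (col_mx u v); rewrite E add_col_mx -hu -hv vsubmxK.
Qed.

Lemma range_coset_direct_sum : range (coset_ZA (direct_sum A B)) =
  col_mx_prod @` (range (coset_ZA A) `*` range (coset_ZA B)).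
Proof.
apply/seteqP; split=> [_ [z _ <-]|_ [[_ _] [[/= y _ <-] [z _ <-]] <-]].
  exists (coset_ZA A (usubmx z), coset_ZA B (dsubmx z)).
    by split; [exists (usubmx z) | exists (dsubmx z)].
  by rewrite -coset_direct_sum vsubmxK.
by exists (col_mx y z) => //; rewrite coset_direct_sum.
Qed.

Lemma coset_refl d n (M : 'M[int]_(d, n)) z : coset_ZA M z z.
Proof. by exists 0; rewrite mulmx0 addr0. Qed.

(** Cosets of the sum are products of cosets, and a product determines its factors because cosets
    are nonempty ([coset_refl]). *)
Lemma index_direct_sum :
  finite_set (range (coset_ZA A)) -> finite_set (range (coset_ZA B)) ->
  finite_set (range (coset_ZA (direct_sum A B))) /\
  index_ZA (direct_sum A B) = (index_ZA A * index_ZA B)%N.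
Proof.
move=> fA fB; have fAB := finite_setX fA fB.
rewrite range_coset_direct_sum; split; first exact: finite_image.
rewrite /index_ZA range_coset_direct_sum fset_set_image // card_in_imfset /=.
  by rewrite fset_setX // card_fsetM.
move=> [S1 T1] [S2 T2]; rewrite !in_fset_set // => /set_mem[/= [y1 _ <-] [z1 _ <-]].
move=> /set_mem[/= [y2 _ <-] [z2 _ <-]] /seteqP[h1 h2].
have c1 := coset_refl A y1; have c2 := coset_refl B z1.
have c3 := coset_refl A y2; have c4 := coset_refl B z2.
congr pair; apply/seteqP; split=> w cw.
- by have := h1 (col_mx w z1); rewrite !col_mx_prodE => /(_ (conj cw c2))[].
- by have := h2 (col_mx w z2); rewrite !col_mx_prodE => /(_ (conj cw c4))[].
- by have := h1 (col_mx y1 w); rewrite !col_mx_prodE => /(_ (conj c1 cw))[].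
- by have := h2 (col_mx y2 w); rewrite !col_mx_prodE => /(_ (conj c3 cw))[].
Qed.

End CosetProduct.

Lemma index_ZA0 (A : 'M[int]_(0, 0)) :
  finite_set (range (coset_ZA A)) /\ index_ZA A = 1%N.
Proof.
have E : range (coset_ZA A) = [set coset_ZA A 0].
  apply/seteqP; split=> [_ [z _ <-]|_ ->]; last by exists 0.
  by rewrite (_ : z = 0) //; apply/colP => -[].
by rewrite /index_ZA E fset_set1 cardfs1; split=> //; exact: finite_set1.
Qed.

Lemma volume_Delta0 (R : realType) (A : 'M[int]_(0, 0)) :
  volume (Delta A : set 'cV[R]_0) = 1%:E.
Proof.
rewrite /= indicE mem_set // Delta_polytope; exists 0; rewrite ?mulmx0 //.
by split=> [[]//|]; rewrite big_ord0.
Qed.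

Lemma volume_Delta_direct_sum (R : realType) d1 n1 d2 n2 (A : 'M[int]_(d1.+1, n1))
    (B : 'M[int]_(d2, n2)) (vA vB : R) :
  volume (Delta A) = vA%:E -> volume (Delta B) = vB%:E ->
  volume (Delta (direct_sum A B)) = (beta_coef R d2 d1.+1 * (vA * vB))%:E.
Proof.
rewrite !Delta_polytope => hA hB; rewrite -(volume_polytope_block hA hB).
by congr (volume (polytope _)); rewrite /direct_sum map_block_mx !map_mx0.
Qed.

(** The factorial of the total dimension cancels the denominator of [beta_coef], whose numerator
    supplies the factorials of the summands. *)
Lemma normalized_volume_direct_sum (R : realType) d1 n1 d2 n2
    (A : 'M[int]_(d1.+1, n1)) (B : 'M[int]_(d2, n2)) :
  (volume (Delta A : set 'cV[R]_d1.+1) \is a fin_num)%E ->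
  (volume (Delta B : set 'cV[R]_d2) \is a fin_num)%E ->
  finite_set (range (coset_ZA A)) -> finite_set (range (coset_ZA B)) ->
  normalized_volume R (direct_sum A B) =
    normalized_volume R A * normalized_volume R B.
Proof.
move=> /fineK hA /fineK hB fA fB; rewrite /normalized_volume.
rewrite (volume_Delta_direct_sum (esym hA) (esym hB)) (index_direct_sum fA fB).2 [fine (EFin _)]/=.
rewrite /beta_coef [(d2 + _)%N]addnC (natrM _ d2`!) (natrM _ (index_ZA A)) invfM.
have f0 : (d1.+1 + d2)`!%:R != 0 :> R by rewrite pnatr_eq0 -lt0n fact_gt0.
move: f0; move: ((d1.+1 + d2)`!%:R) (d1.+1`!%:R) (d2`!%:R) => c x y c0.
move: (fine _) (_%:R^-1) => vA iA; move: (fine _) (_%:R^-1) => vB iB.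
transitivity (c / c * (x * (vA * iA) * (y * (vB * iB)))); first by ring.
by rewrite divff // mul1r.
Qed.

Section Copies.
Variables (R : realType) (d n : nat) (A : 'M[int]_(d.+1, n)) (beta : 'cV[Cplx R]_d.+1).
Hypothesis rank_gt0 : (0 < hyp_rank A beta)%N.
Hypothesis NV_gt0 : 0 < normalized_volume R A.

(** [fine] sends an infinite volume to 0, contrary to positivity of the normalized volume. *)
Lemma volume_fin_num : (volume (Delta A : set 'cV[R]_d.+1) \is a fin_num)%E.
Proof.
move: NV_gt0; rewrite /normalized_volume.
by case: (volume _) => //=; rewrite mul0r mulr0 ltxx.
Qed.

(** Infinitely many cosets would make [index_ZA A] and its inverse 0. *)
Lemma finite_range_coset : finite_set (range (coset_ZA A)).
Proof.
move: NV_gt0; rewrite /normalized_volume /index_ZA /fset_set.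
by case: pselect => //; rewrite cardfs0 invr0 !mulr0 ltxx.
Qed.

Lemma rank_spec_copies r : rank_spec (Weyl.hypergeometric_ideal
  (direct_sum_copies A r) (vector_copies beta r)) (hyp_rank A beta ^ r).
Proof.
elim: r => [|r ih]; first exact: rank_spec0.
have l0 : (0 < hyp_rank A beta ^ r)%N by rewrite expn_gt0 rank_gt0.
rewrite expnS.
exact (hyp_rank_direct_sum rank_gt0 l0 (rank_spec_holonomic rank_gt0) ih).
Qed.

Lemma volume_copies r :
  [/\ (volume (Delta (direct_sum_copies A r) : set 'cV[R]_(r * d.+1)) \is a fin_num)%E,
      finite_set (range (coset_ZA (direct_sum_copies A r))) &
      normalized_volume R (direct_sum_copies A r) = normalized_volume R A ^+ r].
Proof.
elim: r => [|r [ih1 ih2 ih3]].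
  have [h1 h2] := @index_ZA0 (direct_sum_copies A 0).
  have h3 := @volume_Delta0 R (direct_sum_copies A 0).
  split=> //.
  change (0`!%:R * (fine (volume (Delta (direct_sum_copies A 0) : set 'cV[R]_0))
    / (@index_ZA 0 0 (direct_sum_copies A 0))%:R) = 1 :> R).
  by rewrite h3 h2 divr1 mulr1.
have fA := volume_fin_num; have cA := finite_range_coset.
split.
- by rewrite (volume_Delta_direct_sum (esym (fineK fA)) (esym (fineK ih1))).
- exact: (index_direct_sum cA ih2).1.
- by rewrite exprS -ih3; exact: normalized_volume_direct_sum.
Qed.

End Copies.

Theorem theorem2p4 (R : realType) (d n : nat) (A : 'M[int]_(d, n))
    (beta : 'cV[Cplx R]_d) (q a : R)
    (hd : (1 <= d)%N) (hdn : (d <= n)%N)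
    (hA : \rank (map_mx (intr : int -> rat) A) = d)
    (hq : q = (hyp_rank A beta)%:R / normalized_volume R A)
    (hjump : 1 < q)
    (ha : a = q `^ (d%:R^-1)) :
  1 < a /\
  forall r : nat, (1 <= r)%N ->
    a ^+ (r * d) <=
      (hyp_rank (direct_sum_copies A r) (vector_copies beta r))%:R
        / normalized_volume R (direct_sum_copies A r).
Proof.
have q0 : 0 < q by exact: lt_trans hjump.
have d0 : d%:R != 0 :> R by rewrite pnatr_eq0 -lt0n.
have aq : a ^+ d = q.
  by rewrite ha -powR_mulrn ?powR_ge0 // -powRrM mulVf // powRr1 // ltW.
have a0 : 0 <= a by rewrite ha powR_ge0.
split; first by rewrite -(@expr_gt1 _ d) // ?aq.
case: d A beta hd {hdn hA} hq d0 aq {ha} => // d A beta _ hq d0 aq r _.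
have NV_ge0 : 0 <= normalized_volume R A.
  rewrite /normalized_volume mulr_ge0 // divr_ge0 // fine_ge0 //; exact: volume_ge0.
(* A zero volume or a zero rank would give [q = 0], division by 0 being 0. *)
have NV0 : 0 < normalized_volume R A.
  rewrite lt0r NV_ge0 andbT; apply/eqP => h.
  by move: q0; rewrite hq h invr0 mulr0 ltxx.
have m0 : (0 < hyp_rank A beta)%N.
  by rewrite lt0n; apply/eqP => h; move: q0; rewrite hq h mul0r ltxx.
have [_ _ ->] := volume_copies NV0 r.
rewrite /hyp_rank (holonomic_rank_spec (rank_spec_copies m0 r)).
(* Both sides equal [q ^+ r]. *)
by rewrite mulnC exprM aq hq expr_div_n natrX.
Qed.
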